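(* There exists a universal constant $K>0$ such that for every probability measure $\mu$ on $\mathbb{R}$ with mean $0$ and variance $1$ that is infinitely divisible with respect to free additive convolution $\boxplus$, $$d_{Kol}(\mathcal{S}(0,1),\mu)\leq K\sqrt{m_4-2},$$ where $m_4=\int_{\mathbb{R}}x^4\,\mu(dx)$ denotes the fourth moment of $\mu$.
   Context: $\mathcal{S}(0,1)$ is the centered semicircle law with unit variance, i.e. the probability measure on $\mathbb{R}$ with density $\frac{1}{2\pi}\sqrt{4-s^2}\,\mathbf{1}_{(-2,2)}(s)$. For probability measures $\mu,\nu$ on $\mathbb{R}$ with distribution functions $F(x)=\mu((-\infty,x])$ and $G(x)=\nu((-\infty,x])$, the Kolmogorov distance is $d_{Kol}(\mu,\nu)=\sup_{x\in\mathbb{R}}|F(x)-G(x)|$. Free additive convolution: for a probability measure $\mu$ on $\mathbb{R}$ let $G_\mu(z)=\int_{\mathbb{R}}\frac{\mu(dx)}{z-x}$ for $z\in\mathbb{C}^+$ be its Cauchy transform and $F_\mu(z)=1/G_\mu(z)$. There are $\eta,M>0$ such that $F_\mu$ has a right inverse $F_\mu^{-1}$ on $\Gamma_{\eta,M}=\{z\in\mathbb{C}^+:|\mathrm{Re}(z)|<\eta\,\mathrm{Im}(z),\ |z|>M\}$ (the standard analytic one of Bercovici and Voiculescu), and the Voiculescu transform is $\phi_\mu(z)=F_\mu^{-1}(z)-z$. The free additive convolution $\mu_1\boxplus\mu_2$ is the probability measure on $\mathbb{R}$ with $\phi_{\mu_1\boxplus\mu_2}(z)=\phi_{\mu_1}(z)+\phi_{\mu_2}(z)$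 on a common domain of this form; it corresponds to the distribution of the sum of two freely independent random variables with distributions $\mu_1,\mu_2$. A probability measure $\mu$ on $\mathbb{R}$ is $n$-divisible with respect to $\boxplus$ if $\mu=\rho^{\boxplus n}$ (the $n$-fold free convolution) for some probability measure $\rho$ on $\mathbb{R}$; it is infinitely divisible with respect to $\boxplus$ if it is $n$-divisible with respect to $\boxplus$ for all integers $n\geq 1$. The bound is only meaningful when $m_4<\infty$; when $m_4=\infty$ the right-hand side is read as $+\infty$. *)

(* Defs.v *)
From HB Require Import structures.
From mathcomp Require Import all_boot all_order all_algebra.
From mathcomp Require Import all_classical all_reals all_analysis.
From mathcomp Require Import measurable_realfun.
From mathcomp Require Import complex.
From mathcomp Require Import ring lra.

Set Implicit Arguments.
Unset Strict Implicit.
Unset Printing Implicit Defensive.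

Import Order.TTheory GRing.Theory Num.Theory.
Import numFieldNormedType.Exports.

Local Open Scope classical_set_scope.
Local Open Scope complex_scope.
Local Open Scope ring_scope.

Section semicircle.
Context (R : realType).

Definition semicircle_pdf (s : R) : R :=
  (2 * pi)^-1 * Num.sqrt (4 - s ^+ 2) * \1_(`]- 2, 2[%classic : set R) s.

Definition semicircle_prob (A : set (measurableTypeR R)) : \bar R :=
  (\int[lebesgue_measure]_(s in A) (semicircle_pdf s)%:E)%E.

Lemma semicircle_pdf_ge0 s : 0 <= semicircle_pdf s.
Proof.
rewrite /semicircle_pdf !mulr_ge0 ?invr_ge0 ?sqrtr_ge0//.
by rewrite mulr_ge0// pi_ge0.
Qed.

Lemma continuous_sqrt_semicircle :
  continuous (fun s : R => Num.sqrt (4 - s ^+ 2)).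
Proof.
move=> s; apply: continuous_comp; last exact: sqrt_continuous.
apply: continuousB; first exact: cst_continuous.
exact: exprn_continuous.
Qed.

Lemma measurable_sqrt_semicircle : measurable_fun setT
  ((fun s : R => Num.sqrt (4 - s ^+ 2)) : measurableTypeR R -> R).
Proof.
apply: continuous_measurable_fun; exact: continuous_sqrt_semicircle.
Qed.

Lemma measurable_semicircle_pdf :
  measurable_fun setT (semicircle_pdf : measurableTypeR R -> R).
Proof.
rewrite /semicircle_pdf; apply: measurable_funM.
  apply: measurable_funM => //; exact: measurable_sqrt_semicircle.
by apply: measurable_indic.
Qed.

Lemma integral_sqrt_semicircle :
  (\int[lebesgue_measure]_(s in `[(- 2)%R, 2%R]) (Num.sqrt (4 - s ^+ 2))%:E
   = (2 * pi : R)%:E)%E.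
Proof.
have pi0 := @pi_gt0 R.
pose F : R -> R := fun t => 2 * sin t.
have dF (t : R) : is_derive t 1 F (2 * cos t).
  exact: (@is_deriveZ _ _ _ sin 2 t 1 (cos t)).
have F'E : derive1 F = (fun t => 2 * cos t).
  by apply/funext => t; rewrite derive1E; exact: (@derive_val _ _ _ _ _ _ _ (dF t)).
have F'c : continuous (derive1 F : R -> R).
  rewrite F'E => t; apply: (@continuousM _ _ (cst 2) cos).
    exact: cst_continuous.
  exact: continuous_cos.
have LR (G : R -> R) a b : (forall t : R, derivable G t 1) ->
    derivable_oo_LRcontinuous G a b.
  move=> dG; have cG (t : R) : {for t, continuous G}.
    exact/differentiable_continuous/derivable1_diffP.
  split=> [t _||]; first exact: dG.
    exact/cvg_at_right_filter/cG.
  exact/cvg_at_left_filter/cG.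
have Fa : F (- (pi / 2)) = - 2 by rewrite /F sinN sin_pihalf mulrN1.
have Fb : F (pi / 2) = 2 by rewrite /F sin_pihalf mulr1.
have ab : - (pi / 2) < pi / 2 :> R by lra.
have := @integration_by_substitution_increasing R F
  (fun s => Num.sqrt (4 - s ^+ 2)) _ _ (ltW ab).
rewrite Fa Fb => ->; last 6 first.
- by move=> x y xI yI xy; rewrite /F ltr_pM2l// ltr_sin.
- by move=> t _; exact: F'c.
- by apply/cvg_ex; exists (derive1 F (- (pi / 2))); exact/cvg_at_right_filter/F'c.
- by apply/cvg_ex; exists (derive1 F (pi / 2)); exact/cvg_at_left_filter/F'c.
- by apply: LR => t; have [] := dF t.
- exact/continuous_subspaceT/continuous_sqrt_semicircle.
pose H : R -> R := fun t => 2 * t + 2 * (sin t * cos t).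
have dH (t : R) : is_derive t 1 H (4 * cos t ^+ 2).
  have -> : 4 * cos t ^+ 2 =
      2 *: (1 : R) + 2 *: (sin t *: (- sin t) + cos t *: cos t).
    rewrite /GRing.scale/= mulr1 mulrN -!expr2 sin2cos2; ring.
  by rewrite /H; apply: is_deriveD; apply: is_deriveZ.
have E (t : R) : - (pi / 2) <= t <= pi / 2 ->
    Num.sqrt (4 - F t ^+ 2) * derive1 F t = 4 * cos t ^+ 2.
  move=> tI; rewrite F'E /F.
  have c0 : 0 <= cos t by exact: cos_ge0_pihalf.
  have -> : 4 - (2 * sin t) ^+ 2 = (2 * cos t) ^+ 2.
    by rewrite !exprMn sin2cos2; ring.
  by rewrite sqrtr_sqr ger0_norm ?mulr_ge0//; ring.
rewrite (eq_integral (fun t : measurableTypeR R => (4 * cos t ^+ 2)%:E));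
  last first.
  move=> t; rewrite inE/= in_itv/= => tI; congr EFin; exact: E.
rewrite (@continuous_FTC2 R (fun t : R => 4 * cos t ^+ 2) H)//.
- rewrite /H sinN cosN sin_pihalf cos_pihalf !mulr0 !addr0 -EFinB; congr EFin.
  by field.
- apply: continuous_subspaceT => t.
  apply: (@continuousM _ _ (cst 4) (fun x : R => cos x ^+ 2)).
    exact: cst_continuous.
  apply: (@continuous_comp _ _ _ cos (fun x : R => x ^+ 2)).
    exact: continuous_cos.
  exact: exprn_continuous.
- by apply: LR => t; have [] := dH t.
- move=> t _; rewrite derive1E; exact: (@derive_val _ _ _ _ _ _ _ (dH t)).
Qed.

Lemma integral_semicircle_pdf :
  (\int[lebesgue_measure]_s (semicircle_pdf s)%:E = 1)%E.
Proof.
have pi0 := @pi_gt0 R.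
have -> : (fun s => (semicircle_pdf s)%:E) =
    (fun s : R => ((2 * pi)^-1)%:E * (Num.sqrt (4 - s ^+ 2))%:E)%E
      \_ (`[- 2, 2]%classic : set R).
  apply/funext => s; rewrite patchE /semicircle_pdf indicE.
  have [|sI] := boolP (s \in `]- 2, 2[%classic).
    rewrite inE/= in_itv/= => /andP[s1 s2].
    by rewrite mem_set ?mulr1//= in_itv/= !ltW.
  rewrite mulr0; case: ifPn => //; rewrite inE/= in_itv/= => /andP[s1 s2].
  suff -> : 4 - s ^+ 2 = 0 by rewrite sqrtr0 mule0.
  move: sI; rewrite notin_setE/= in_itv/= => /negP.
  rewrite negb_and -!leNgt => /orP[s3|s3].
    have -> : s = - 2 by lra.
    ring.
  have -> : s = 2 by lra.
  ring.
rewrite -integral_mkcond ge0_integralZl//.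
- by rewrite integral_sqrt_semicircle -EFinM mulVf// mulf_neq0// gt_eqF.
- apply/measurable_EFinP/measurable_funTS; exact: measurable_sqrt_semicircle.
- by rewrite lee_fin invr_ge0 mulr_ge0// ltW.
Qed.

Let semicircle0 : semicircle_prob set0 = 0%E.
Proof. by rewrite /semicircle_prob integral_set0. Qed.

Let semicircle_ge0 A : (0 <= semicircle_prob A)%E.
Proof.
by apply: integral_ge0 => s _; rewrite lee_fin semicircle_pdf_ge0.
Qed.

Let semicircle_sigma_additive : semi_sigma_additive semicircle_prob.
Proof.
move=> /= F mF tF mUF; rewrite /semicircle_prob; apply: cvg_toP.
  apply: ereal_nondecreasing_is_cvgn => m n mn.
  apply: lee_sum_nneg_natr => // k _ _.
  by apply: integral_ge0 => s _; rewrite lee_fin semicircle_pdf_ge0.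
rewrite ge0_integral_bigcup//=.
- apply: measurable_funTS; apply: measurableT_comp => //.
  exact: measurable_semicircle_pdf.
- by move=> s _; rewrite lee_fin semicircle_pdf_ge0.
Qed.

HB.instance Definition _ := isMeasure.Build _ _ _ semicircle_prob
  semicircle0 semicircle_ge0 semicircle_sigma_additive.

Let semicircle_setT : semicircle_prob [set: _] = 1%E.
Proof. exact: integral_semicircle_pdf. Qed.

HB.instance Definition _ :=
  @Measure_isProbability.Build _ _ R semicircle_prob semicircle_setT.

End semicircle.
Arguments semicircle_prob R A : clear implicits.

Section free_convolution.
Context (R : realType).
Local Notation prob := (probability (measurableTypeR R) R).
Implicit Types (mu nu rho : prob) (eta M : R) (z : R[i]).

Definition kolmogorov_dist mu nu : \bar R :=
  ereal_sup (range (fun x : R =>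
    `|mu `]-oo, x]%classic - nu `]-oo, x]%classic|%E)).

(* The library integrates real-valued functions only: the complex integral of
   t |-> (z - t)^-1 is taken componentwise. *)
Definition cauchy_transform mu z : R[i] :=
  (\int[mu]_t complex.Re ((z - (t : R)%:C)^-1)) +i*
  (\int[mu]_t complex.Im ((z - (t : R)%:C)^-1)).

Definition F_transform mu z : R[i] := (cauchy_transform mu z)^-1.

Definition truncated_cone eta M : set R[i] :=
  [set z | [/\ 0 < complex.Im z,
               `|complex.Re z| < eta * complex.Im z &
               M%:C < `|z| ]].

(* A right inverse of F_mu on a truncated cone is not unique in general (for
   mu = (dirac 1 + dirac (-1)) / 2, z = F_mu w has two solutions w in the upper
   half-plane). The standard one inverts the restriction of F_mu to a truncated
   cone on which F_mu is univalent; any two such inverses agree wherever both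
   are defined. The scalar field of the derivative is R[i], through R[i]^o. *)
Definition F_right_inverse mu eta M (Finv : R[i] -> R[i]) : Prop :=
  (forall z, truncated_cone eta M z ->
     F_transform mu (Finv z) = z /\
     derivable (Finv : R[i]^o -> R[i]^o) z 1) /\
  exists a b : R, [/\ 0 < a, 0 < b,
    set_inj (truncated_cone a b) (F_transform mu) &
    forall z, truncated_cone eta M z -> truncated_cone a b (Finv z)].

Definition voiculescu_transform mu eta M (phi : R[i] -> R[i]) : Prop :=
  exists Finv, F_right_inverse mu eta M Finv /\
    forall z, truncated_cone eta M z -> phi z = Finv z - z.

Definition free_conv mu nu rho : Prop :=
  exists eta M : R, exists phi_mu phi_nu phi_rho : R[i] -> R[i],
    [/\ 0 < eta /\ 0 < M,
        voiculescu_transform mu eta M phi_mu,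
        voiculescu_transform nu eta M phi_nu,
        voiculescu_transform rho eta M phi_rho &
        forall z, truncated_cone eta M z -> phi_rho z = phi_mu z + phi_nu z].

Inductive free_power mu : nat -> prob -> Prop :=
| free_power1 : free_power mu 1 mu
| free_powerS n nu rho :
    free_power mu n nu -> free_conv nu mu rho -> free_power mu n.+1 rho.

Definition free_divisible (n : nat) mu : Prop :=
  exists rho, free_power rho n mu.

Definition free_infinitely_divisible mu : Prop :=
  forall n : nat, (1 <= n)%N -> free_divisible n mu.

End free_convolution.

(* Main.v *)
(** Let [G] be the Cauchy transform of [mu], [F = 1/G], and let [rho] be an n-th
    free root of [mu]. The subordination function of [mu] with respect to [rho] is
    [omega z = ((n-1) F z + z) / n], so that [G_rho (omega z) = G z]; the definition
    gives this far up the imaginary axis, and the identity theorem extends it to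
    the upper half-plane. Expanding along the imaginary axis shows that [rho] is
    centered, has variance [1/n], and that [n * m4(rho) <= m4 - 2 + 2/n].
    Writing [z - F] as an integral against the probability measure [n x^2 rho(dx)]
    and letting n tend to infinity at fixed [z] gives, for [e^2 >= m4 - 2],
    [|z - F| <= 1] and [|z - F - G| <= e |G|]. Hence, at height [v] of order [e],
    [G^2 - u G + 1] is of size [e |G|], so [G (u + i v)] is within
    [C e |G| / sqrt |u^2 - 4|] of the boundary value at [u] of the Cauchy transform
    of the semicircle law, and the two are at distance [O(e)] in [L^1(du)].
    Convolving [mu] with the kernel [2 P_v - P_2v] built from Poisson kernels moves
    its distribution function by [O(v)], because the kernel decays fast enough for
    the error to be bounded by [v |Im G|]. *)

From mathcomp Require Import all_boot all_order all_algebra.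
From mathcomp Require Import all_classical all_reals all_analysis.
From mathcomp Require Import measurable_realfun complex ring lra.
Require Import Defs.

Set Implicit Arguments.
Unset Strict Implicit.
Unset Printing Implicit Defensive.

Import Order.TTheory GRing.Theory Num.Theory.
Import numFieldNormedType.Exports.
Import ComplexField.

Local Open Scope classical_set_scope.
Local Open Scope complex_scope.
Local Open Scope ring_scope.

(** The bounds drawn from the roots hold on the whole upper half-plane with constants independent of
    [Im z]; estimating a resolvent by [1 / Im z] would ruin the rate at height of order [e]. What
    saves them is that, with [om] the subordination function at [z], [- Im G] is both [Im om] times
    the [rho]-integral of [|om - t|^-2] and [Im F] times [|G|^2], while
    [Im F <= n / (n - 1) * Im om]. Hence [n] times the integral of [t^2 / |om - t|^2] is at most [1]
    in the limit. Cauchy-Schwarz, as a weighted AM-GM, between this quantity and [n * m4(rho)]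
    produces [e]. The number [m4 - 2] is the fourth free cumulant of [mu], of which a root carries
    one [n]-th.

    No limit law of the roots is formed: inequalities between numbers pass to the limit.

    Moments of [rho] are not known to exist beforehand; Fatou's lemma recovers them from the
    expansion of its Cauchy transform along the curve that [omega] draws from the imaginary axis.

    That the error is relative to [|G|] gives the decay in [u] needed for integrability on the
    line. *)

Notation Re := (@complex.Re _).
Notation Im := (@complex.Im _).
Notation nc := (@Normc.normc _).

(** * Complex moduli and complex-valued integrals *)

Section complex_modulus.
Context (R : realType).
Implicit Types (x y z w : R[i]) (a b : R).

Lemma ReD x y : Re (x + y) = Re x + Re y. Proof. by case: x; case: y. Qed.
Lemma ImD x y : Im (x + y) = Im x + Im y. Proof. by case: x; case: y. Qed.
Lemma ReN x : Re (- x) = - Re x. Proof. by case: x. Qed.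
Lemma ImN x : Im (- x) = - Im x. Proof. by case: x. Qed.
Lemma ReM x y : Re (x * y) = Re x * Re y - Im x * Im y.
Proof. by case: x; case: y. Qed.
Lemma ImM x y : Im (x * y) = Re x * Im y + Im x * Re y.
Proof. by case: x => ? ?; case: y. Qed.
Lemma ReV x : Re x^-1 = Re x / (Re x ^+ 2 + Im x ^+ 2). Proof. by case: x. Qed.
Lemma ImV x : Im x^-1 = - (Im x / (Re x ^+ 2 + Im x ^+ 2)).
Proof. by case: x. Qed.
Lemma ReR a : Re a%:C = a. Proof. by []. Qed.
Lemma ImR a : Im a%:C = 0. Proof. by []. Qed.
Lemma Re1 : Re (1 : R[i]) = 1. Proof. by []. Qed.
Lemma Im1 : Im (1 : R[i]) = 0. Proof. by []. Qed.
Lemma Re0 : Re (0 : R[i]) = 0. Proof. by []. Qed.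
Lemma Im0 : Im (0 : R[i]) = 0. Proof. by []. Qed.
Lemma Re_i : Re ('i : R[i]) = 0. Proof. by []. Qed.
Lemma Im_i : Im ('i : R[i]) = 1. Proof. by []. Qed.
Definition ReImE := (Re_i, Im_i, ReD, ImD, ReN, ImN, ReM, ImM, ReR, ImR, Re1, Im1, Re0, Im0).

Lemma complex_ext x y : Re x = Re y -> Im x = Im y -> x = y.
Proof. by case: x => ? ?; case: y => ? ? /= -> ->. Qed.

Lemma normE z : `|z| = (nc z)%:C. Proof. by case: z. Qed.
Lemma nc_ge0 z : 0 <= nc z. Proof. by case: z => ? ?; exact: sqrtr_ge0. Qed.
Lemma nc_eq0 z : (nc z == 0) = (z == 0).
Proof. by apply/eqP/eqP => [/Normc.eq0_normc//|->]; exact: Normc.normc0. Qed.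
Lemma nc_gt0 z : (0 < nc z) = (z != 0).
Proof. by rewrite lt_neqAle nc_ge0 andbT eq_sym nc_eq0. Qed.
Lemma nc0 : nc (0 : R[i]) = 0. Proof. exact: Normc.normc0. Qed.
Lemma nc1 : nc (1 : R[i]) = 1. Proof. exact: Normc.normc1. Qed.
Lemma ncM x y : nc (x * y) = nc x * nc y. Proof. exact: Normc.normcM. Qed.
Lemma ncV x : nc x^-1 = (nc x)^-1. Proof. exact: Normc.normcV. Qed.
Lemma ncD x y : nc (x + y) <= nc x + nc y. Proof. exact: le_normcD. Qed.
Lemma ncN x : nc (- x) = nc x. Proof. exact: normcN. Qed.
Lemma ncB x y : nc (x - y) <= nc x + nc y. Proof. by rewrite -(ncN y) ncD. Qed.
Lemma ncBC x y : nc (x - y) = nc (y - x). Proof. by rewrite -ncN opprB. Qed.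
Lemma ncX x n : nc (x ^+ n) = nc x ^+ n.
Proof. by elim: n => [|n IH]; rewrite ?nc1// !exprS ncM IH. Qed.
Lemma nc_sq z : nc z ^+ 2 = Re z ^+ 2 + Im z ^+ 2.
Proof. by case: z => a b /=; rewrite sqr_sqrtr// addr_ge0// sqr_ge0. Qed.
Lemma ncR a : nc a%:C = `|a|.
Proof. by rewrite /= expr0n/= addr0 sqrtr_sqr. Qed.
Lemma Re_le_nc z : `|Re z| <= nc z.
Proof.
rewrite -(ler_pXn2r (n:=2))// ?nnegrE ?nc_ge0// nc_sq real_normK ?num_real//.
by rewrite lerDl sqr_ge0.
Qed.
Lemma Im_le_nc z : `|Im z| <= nc z.
Proof.
rewrite -(ler_pXn2r (n:=2))// ?nnegrE ?nc_ge0// nc_sq real_normK ?num_real//.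
by rewrite lerDr sqr_ge0.
Qed.
Lemma nc_le_ReIm z : nc z <= `|Re z| + `|Im z|.
Proof.
rewrite -(ler_pXn2r (n:=2))// ?nnegrE ?nc_ge0 ?addr_ge0// nc_sq sqrrD.
by rewrite !real_normK ?num_real// addrAC lerDl mulrn_wge0// mulr_ge0.
Qed.
Lemma ler_ncB x y : nc x - nc y <= nc (x - y).
Proof. by rewrite lerBlDr (le_trans _ (ncD _ _))// subrK. Qed.
Lemma Im_neq0 z : 0 < Im z -> z != 0.
Proof. by move=> h; apply: contraTneq h => ->; rewrite ltxx. Qed.
Lemma ncV_sq z : nc z^-1 ^+ 2 = (nc z ^+ 2)^-1. Proof. by rewrite ncV exprVn. Qed.

Lemma natC n : (n%:R : R[i]) = (n%:R : R)%:C.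
Proof. by rewrite rmorph_nat. Qed.

End complex_modulus.

Section complex_integral.
Context (R : realType).
Notation MR := (measurableTypeR R).
Variable mu : probability MR R.
Implicit Types (f g : R -> R[i]) (c : R[i]).

Definition cmeas f := measurable_fun setT (Re \o f : MR -> R) /\
  measurable_fun setT (Im \o f : MR -> R).
Definition rint (f : R -> R) := mu.-integrable setT (EFin \o f : MR -> \bar R).
Definition cintegrable f := rint (Re \o f) /\ rint (Im \o f).
Definition cint f : R[i] := (\int[mu]_t Re (f t)) +i* (\int[mu]_t Im (f t)).

Lemma rint_measurable (f : R -> R) : rint f -> measurable_fun setT (f : MR -> R).
Proof. by move=> /measurable_int/measurable_EFinP. Qed.

Lemma rintZ a (f : R -> R) : rint f -> rint (fun t => a * f t).
Proof.
move=> fi; have := @integrableZl _ _ _ mu setT measurableT a _ fi.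
by apply: eq_integrable => // x _; rewrite /= EFinM.
Qed.

Lemma rintD (f g : R -> R) : rint f -> rint g -> rint (fun t => f t + g t).
Proof.
move=> fi gi; have := @integrableD _ _ _ mu setT measurableT _ _ fi gi.
by apply: eq_integrable => // x _; rewrite /= EFinD.
Qed.

Lemma rint_cst a : rint (fun=> a).
Proof. exact: finite_measure_integrable_cst. Qed.

Lemma rint_le (f g : R -> R) : measurable_fun setT (f : MR -> R) ->
  (forall t, `|f t| <= g t) -> rint g -> rint f.
Proof.
move=> mf fg gi.
apply: (@le_integrable _ _ _ mu setT measurableT (EFin \o f) (EFin \o g)) => //.
  exact/measurable_EFinP.
by move=> x _ /=; rewrite lee_fin (le_trans (fg x))// ler_norm.
Qed.

Lemma cintegrable_cmeas f : cintegrable f -> cmeas f.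
Proof. by case=> /rint_measurable ? /rint_measurable ?. Qed.

Lemma cmeasM f g : cmeas f -> cmeas g -> cmeas (fun t => f t * g t).
Proof.
move=> [f1 f2] [g1 g2]; split.
  rewrite (_ : _ \o _ = fun t => Re (f t) * Re (g t) - Im (f t) * Im (g t)).
    by apply: measurable_funB; apply: measurable_funM.
  by apply/funext => t /=; rewrite ReM.
rewrite (_ : _ \o _ = fun t => Re (f t) * Im (g t) + Im (f t) * Re (g t)).
  by apply: measurable_funD; apply: measurable_funM.
by apply/funext => t /=; rewrite ImM.
Qed.

Lemma cmeas_cst c : cmeas (fun=> c).
Proof. by split; exact: measurable_cst. Qed.

Lemma cmeas_R (h : R -> R) : measurable_fun setT (h : MR -> R) ->
  cmeas (fun t => (h t)%:C).
Proof. by move=> mh; split => //=; exact: measurable_cst. Qed.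

Lemma cmeas_nc f : cmeas f -> measurable_fun setT ((fun t => nc (f t)) : MR -> R).
Proof.
move=> [f1 f2].
rewrite (_ : (fun t => nc (f t)) =
    (fun t => Num.sqrt (Re (f t) ^+ 2 + Im (f t) ^+ 2))); last first.
  by apply/funext => t; case: (f t).
apply: measurableT_comp => //.
  apply: continuous_measurable_fun; exact: sqrt_continuous.
by apply: measurable_funD; apply: measurable_funX.
Qed.

Lemma cintegrable_le f (g : R -> R) : cmeas f -> (forall t, nc (f t) <= g t) ->
  rint g -> cintegrable f.
Proof.
move=> [f1 f2] fg gi; split; apply: (rint_le _ _ gi) => // t.
  exact: le_trans (Re_le_nc _) _.
exact: le_trans (Im_le_nc _) _.
Qed.

Lemma rint_nc f : cintegrable f -> rint (fun t => nc (f t)).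
Proof.
move=> fi; have [r1 i1] := fi.
apply: (@rint_le _ (fun t => `|Re (f t)| + `|Im (f t)|)).
- exact: cmeas_nc (cintegrable_cmeas fi).
- by move=> t; rewrite ger0_norm ?nc_ge0 ?nc_le_ReIm.
- by apply: rintD; [have := integrable_norm r1|have := integrable_norm i1].
Qed.

Lemma cintegrableZ c f : cintegrable f -> cintegrable (fun t => c * f t).
Proof.
move=> fi; apply: (@cintegrable_le _ (fun t => nc c * nc (f t))).
- exact/(cmeasM (cmeas_cst c))/cintegrable_cmeas.
- by move=> t; rewrite ncM.
- exact/rintZ/rint_nc.
Qed.

Lemma cintegrableD f g : cintegrable f -> cintegrable g ->
  cintegrable (fun t => f t + g t).
Proof.
move=> [f1 f2] [g1 g2]; split.
  rewrite (_ : _ \o _ = fun t => Re (f t) + Re (g t)); first exact: rintD.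
  by apply/funext => t /=; rewrite ReD.
rewrite (_ : _ \o _ = fun t => Im (f t) + Im (g t)); first exact: rintD.
by apply/funext => t /=; rewrite ImD.
Qed.

Lemma cintegrableB f g : cintegrable f -> cintegrable g ->
  cintegrable (fun t => f t - g t).
Proof.
move=> fi /(cintegrableZ (-1)) gi.
by have := cintegrableD fi gi; congr cintegrable; apply/funext => t; rewrite mulN1r.
Qed.

Lemma cintegrable_R (h : R -> R) : rint h -> cintegrable (fun t => (h t)%:C).
Proof. by move=> hi; split => //; exact: (rint_cst 0). Qed.

Lemma cintegrable_cst c : cintegrable (fun=> c).
Proof. by split; exact: rint_cst. Qed.

Lemma cint_R (h : R -> R) : cint (fun t => (h t)%:C) = (\int[mu]_t h t)%:C.
Proof. by rewrite /cint /= Rintegral_cst// mul0r. Qed.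

Lemma cint_cst c : cint (fun=> c) = c.
Proof.
rewrite /cint !Rintegral_cst//= (_ : fine (mu setT) = 1); last first.
  by rewrite (@probability_setT _ _ _ mu).
by rewrite !mulr1; apply: complex_ext.
Qed.

Lemma cintD f g : cintegrable f -> cintegrable g ->
  cint (fun t => f t + g t) = cint f + cint g.
Proof.
move=> [f1 f2] [g1 g2]; apply: complex_ext; rewrite ?ReD ?ImD /=.
  by rewrite -RintegralD//; apply: eq_Rintegral => t _; rewrite ReD.
by rewrite -RintegralD//; apply: eq_Rintegral => t _; rewrite ImD.
Qed.

Lemma cintZ c f : cintegrable f -> cint (fun t => c * f t) = c * cint f.
Proof.
move=> [f1 f2]; apply: complex_ext; rewrite ?ReM ?ImM /=.
  rewrite -!RintegralZl// -RintegralB//; [|exact: rintZ..].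
  by apply: eq_Rintegral => t _; rewrite ReM.
rewrite -!RintegralZl// -RintegralD//; [|exact: rintZ..].
by apply: eq_Rintegral => t _; rewrite ImM.
Qed.

Lemma cintB f g : cintegrable f -> cintegrable g ->
  cint (fun t => f t - g t) = cint f - cint g.
Proof.
move=> fi gi; rewrite -[in RHS](mulN1r (cint g)) -cintZ// -cintD//.
  by congr cint; apply/funext => t; rewrite mulN1r.
exact: cintegrableZ.
Qed.

Lemma eq_cint f g : f =1 g -> cint f = cint g.
Proof. by move=> /funext ->. Qed.

(** Multiplied by its own conjugate, the integral becomes its squared modulus, a real number, and a
    real part is at most a modulus. *)
Lemma nc_cint f : cintegrable f -> nc (cint f) <= \int[mu]_t nc (f t).
Proof.
move=> fi; have [->|I0] := eqVneq (cint f) 0.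
  by rewrite nc0 Rintegral_ge0// => t _; rewrite nc_ge0.
rewrite -(ler_pM2l (_ : 0 < nc (cint f))) ?nc_gt0//.
have -> : nc (cint f) * nc (cint f) = Re (cint (fun t => (cint f)^* * f t)).
  rewrite cintZ// ReM; rewrite -expr2 nc_sq.
  by case: (cint f) => a b /=; ring.
rewrite -RintegralZl//; last exact: rint_nc.
have [h1 _] := @cintegrableZ ((cint f)^*) f fi.
apply: le_Rintegral => //.
  exact/(rintZ _)/rint_nc.
move=> t _; apply: le_trans (ler_norm _) _; apply: le_trans (Re_le_nc _) _.
by rewrite ncM; case: (cint f) => a b /=; rewrite sqrrN.
Qed.

End complex_integral.

(** * Resolvents and the half-plane properties of the Cauchy transform *)

Section resolvent.
Context (R : realType).
Notation MR := (measurableTypeR R).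
Variable mu : probability MR R.
Implicit Types (z w : R[i]) (t : R).

Definition res z (t : R) : R[i] := (z - t%:C)^-1.

Lemma Im_sub_real z t : Im (z - t%:C) = Im z.
Proof. by rewrite ImD ImN /= oppr0 addr0. Qed.

Lemma nc_sub_real z t : `|Im z| <= nc (z - t%:C).
Proof. by rewrite -(Im_sub_real z t) Im_le_nc. Qed.

Lemma sub_real_neq0 z t : 0 < Im z -> z - t%:C != 0.
Proof. by move=> h; apply: Im_neq0; rewrite Im_sub_real. Qed.

Lemma nc_res z t : 0 < Im z -> nc (res z t) <= (Im z)^-1.
Proof.
move=> z0; rewrite /res ncV lef_pV2 ?posrE ?nc_gt0 ?sub_real_neq0//.
by rewrite -[leLHS]gtr0_norm// nc_sub_real.
Qed.

Lemma cmeas_res z : 0 < Im z -> cmeas (res z).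
Proof.
move=> z0; pose D (t : R) := (Re z - t) ^+ 2 + Im z ^+ 2.
have D0 t : D t != 0.
  by rewrite gt_eqF// /D ltr_wpDl ?sqr_ge0 ?exprn_gt0.
have cl : continuous (fun t : R => Re z - t).
  by move=> t; apply: continuousB; [exact: cst_continuous|exact: cvg_id].
have cD : continuous (fun t : R => (D t)^-1).
  move=> t; apply: continuousV; first exact: D0.
  apply: continuousD; last exact: cst_continuous.
  by apply: (@continuous_comp _ _ _ (fun t => Re z - t) (fun x => x ^+ 2));
    [exact: cl|exact: exprn_continuous].
split.
  rewrite (_ : _ \o _ = fun t => (Re z - t) * (D t)^-1).
    apply: continuous_measurable_fun => t.
    by apply: (@continuousM _ _ (fun t : R => Re z - t)); [exact: cl|exact: cD].
  by apply/funext => t; rewrite /= /res ReV Im_sub_real ReD ReN.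
rewrite (_ : _ \o _ = fun t => - Im z * (D t)^-1).
  apply: continuous_measurable_fun => t.
  by apply: (@continuousM R R (fun=> - Im z) (fun t : R => (D t)^-1)); [exact: cst_continuous|exact: cD].
by apply/funext => t; rewrite /= /res ImV Im_sub_real ReD ReN mulNr.
Qed.

Lemma cmeasX (f : R -> R[i]) n : cmeas f -> cmeas (fun t => f t ^+ n).
Proof.
move=> mf; elim: n => [|n IH]; first exact: (cmeas_cst 1).
rewrite (_ : (fun t => _) = fun t => f t * f t ^+ n); first exact: cmeasM.
by apply/funext => t; rewrite exprS.
Qed.

Lemma cintegrable_resX z n : 0 < Im z -> cintegrable mu (fun t => res z t ^+ n).
Proof.
move=> z0; apply: (@cintegrable_le _ _ _ (fun=> (Im z)^-1 ^+ n)).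
- exact/cmeasX/cmeas_res.
- move=> t; rewrite ncX; apply: lerXn2r; rewrite ?nnegrE ?nc_ge0 ?nc_res//.
  by rewrite invr_ge0 ltW.
- exact: rint_cst.
Qed.

Lemma cintegrable_res z : 0 < Im z -> cintegrable mu (res z).
Proof. exact: (@cintegrable_resX z 1). Qed.

Lemma cauchy_transformE z : cauchy_transform mu z = cint mu (res z).
Proof. by []. Qed.

Lemma cintegrable_sum n (f : nat -> R -> R[i]) :
  (forall i, cintegrable mu (f i)) -> cintegrable mu (fun t => \sum_(i < n) f i t).
Proof.
move=> fi; elim: n => [|n IH].
  rewrite (_ : (fun t => _) = fun=> 0); first exact: cintegrable_cst.
  by apply/funext => t; rewrite big_ord0.
rewrite (_ : (fun t => _) = fun t => \sum_(i < n) f i t + f n t).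
  exact: cintegrableD.
by apply/funext => t; rewrite big_ord_recr.
Qed.

Lemma cint_sum n (f : nat -> R -> R[i]) : (forall i, cintegrable mu (f i)) ->
  cint mu (fun t => \sum_(i < n) f i t) = \sum_(i < n) cint mu (f i).
Proof.
move=> fi; elim: n => [|n IH].
  rewrite big_ord0 -[RHS](cint_cst mu 0); apply: eq_cint => t.
  by rewrite big_ord0.
rewrite big_ord_recr /= -IH -cintD//; last exact: cintegrable_sum.
by apply: eq_cint => t; rewrite big_ord_recr.
Qed.

Lemma cauchy_Im z : 0 < Im z ->
  Im (cauchy_transform mu z) = - (Im z * \int[mu]_t nc (res z t) ^+ 2).
Proof.
move=> z0; rewrite /= -mulNr -RintegralZl//.
  apply: eq_Rintegral => t _; rewrite ImV Im_sub_real /res ncV_sq nc_sq.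
  by rewrite Im_sub_real mulNr.
have := rint_nc (cintegrable_resX 2 z0).
by apply: eq_integrable => // t _ /=; rewrite ncX.
Qed.

Lemma rint_res2 z : 0 < Im z -> rint mu (fun t => nc (res z t) ^+ 2).
Proof.
move=> z0; have := rint_nc (cintegrable_resX 2 z0).
by apply: eq_integrable => // t _ /=; rewrite ncX.
Qed.

(** A zero integral would force [f = 0] almost everywhere; as [f] vanishes nowhere, the whole line
    would be a null set. *)
Lemma Rintegral_gt0 (f : R -> R) : rint mu f -> (forall t, 0 < f t) ->
  0 < \int[mu]_t f t.
Proof.
move=> fi f0; rewrite lt_neqAle Rintegral_ge0 ?andbT; last by move=> t _; rewrite ltW.
apply/eqP => h.
have e : ((\int[mu]_t `|(f t)%:E|) = 0)%E.
  rewrite (eq_integral (EFin \o f : MR -> \bar R)) => [|t _]; last by rewrite /= gtr0_norm.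
  rewrite -[LHS]fineK; last exact: integrable_fin_num.
  by rewrite -/(Rintegral mu setT f) -h.
have mf : measurable_fun setT (EFin \o f : MR -> \bar R).
  exact: measurable_int fi.
have /(ae_eq_integral_abs mu measurableT mf).1 [N [mN N0 sN]] := e.
have NT : N = setT.
  apply/seteqP; split => // t _; apply: sN => /= /(_ I) [] ft.
  by have := f0 t; rewrite ft ltxx.
move: N0; rewrite NT => N0.
have [/eqP] : (1 : \bar R)%E = 0%E := etrans (esym (@probability_setT _ _ _ mu)) N0.
by rewrite oner_eq0.
Qed.

Lemma cauchy_Im_lt0 z : 0 < Im z -> Im (cauchy_transform mu z) < 0.
Proof.
move=> z0; rewrite cauchy_Im// oppr_lt0 mulr_gt0// Rintegral_gt0//.
  exact: rint_res2.
by move=> t; rewrite exprn_gt0// nc_gt0 invr_eq0 sub_real_neq0.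
Qed.

Lemma cauchy_neq0 z : 0 < Im z -> cauchy_transform mu z != 0.
Proof.
by move=> /cauchy_Im_lt0; apply: contraTneq => ->; rewrite ltxx.
Qed.

Lemma F_Im_gt0 z : 0 < Im z -> 0 < Im (F_transform mu z).
Proof.
move=> z0; rewrite /F_transform ImV oppr_gt0 pmulr_llt0 ?cauchy_Im_lt0//.
by rewrite invr_gt0 -nc_sq exprn_gt0// nc_gt0 cauchy_neq0.
Qed.

End resolvent.

(** * Polynomial approximation and the identity theorem *)

Section polynomial_norm.
Context (R : realType).
Implicit Types (p q : {poly R[i]}) (r : R).

(** A weighted l^1 norm of the coefficients: it is submultiplicative, compatible with composition,
    and dominates the polynomial on the disc of radius [r]. *)
Definition pnorm p r := \sum_(i < size p) nc p`_i * r ^+ i.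

Lemma pnormE n p r : (size p <= n)%N -> pnorm p r = \sum_(i < n) nc p`_i * r ^+ i.
Proof.
move=> /subnKC <-; rewrite big_split_ord /= [X in _ + X]big1 ?addr0// => i _.
by rewrite nth_default ?leq_addr// nc0 mul0r.
Qed.

Lemma pnorm_ge0 p r : 0 <= r -> 0 <= pnorm p r.
Proof. by move=> r0; apply: sumr_ge0 => i _; rewrite mulr_ge0 ?nc_ge0 ?exprn_ge0. Qed.

Lemma le_pnorm p r1 r2 : 0 <= r1 -> r1 <= r2 -> pnorm p r1 <= pnorm p r2.
Proof.
move=> r10 r12; apply: ler_sum => i _; apply: ler_wpM2l; first exact: nc_ge0.
by apply: lerXn2r; rewrite ?nnegrE// (le_trans r10).
Qed.

Lemma pnormMXaddC p (c : R[i]) r : pnorm (p * 'X + c%:P) r = pnorm p r * r + nc c.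
Proof.
rewrite (@pnormE (size p).+1); last by rewrite size_MXaddC; case: ifP.
rewrite big_ord_recl /= coefD coefMX coefC eqxx /= add0r expr0 mulr1 addrC.
rewrite /pnorm mulr_suml; congr (_ + _); apply: eq_bigr => i _.
by rewrite coefD coefMX coefC /= addr0 exprSr mulrA.
Qed.

Lemma pnormC (c : R[i]) r : pnorm c%:P r = nc c.
Proof.
have := pnormMXaddC 0 c r; rewrite mul0r add0r => ->.
by rewrite /pnorm size_poly0 big_ord0 mul0r add0r.
Qed.

Lemma pnormMX p r : pnorm (p * 'X) r = pnorm p r * r.
Proof. by have := pnormMXaddC p 0 r; rewrite addr0 nc0 addr0. Qed.

Lemma pnormMXn p n r : pnorm (p * 'X^n) r = pnorm p r * r ^+ n.
Proof.
by elim: n => [|n IH]; rewrite ?expr0 ?mulr1// !exprSr mulrA pnormMX IH mulrA.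
Qed.

Lemma pnormD p q r : 0 <= r -> pnorm (p + q) r <= pnorm p r + pnorm q r.
Proof.
move=> r0; set n := maxn (size p) (size q).
rewrite !(@pnormE n) ?leq_maxl ?leq_maxr ?(leq_trans (size_polyD _ _))//.
rewrite -big_split /=; apply: ler_sum => i _.
by rewrite -mulrDl ler_wpM2r ?exprn_ge0// coefD ncD.
Qed.

Lemma pnormZ (c : R[i]) p r : pnorm (c *: p) r = nc c * pnorm p r.
Proof.
rewrite (@pnormE (size p)) ?size_scale_leq// /pnorm mulr_sumr.
by apply: eq_bigr => i _; rewrite coefZ ncM mulrA.
Qed.

Lemma pnormM p q r : 0 <= r -> pnorm (p * q) r <= pnorm p r * pnorm q r.
Proof.
move=> r0; elim/poly_ind: p => [|p c IH].
  by rewrite mul0r /pnorm size_poly0 !big_ord0 mul0r.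
rewrite mulrDl (le_trans (pnormD _ _ r0))// pnormMXaddC mulrDl.
rewrite mulrAC pnormMX mul_polyC pnormZ lerD2r mulrAC.
by rewrite ler_wpM2r.
Qed.

Lemma pnorm_comp p q r : 0 <= r -> pnorm (p \Po q) r <= pnorm p (pnorm q r).
Proof.
move=> r0; elim/poly_ind: p => [|p c IH].
  by rewrite comp_poly0 /pnorm size_poly0 !big_ord0.
rewrite comp_polyD comp_polyM comp_polyX comp_polyC.
rewrite (le_trans (pnormD _ _ r0))// pnormMXaddC pnormC lerD2r.
rewrite (le_trans (pnormM _ _ r0))//.
by rewrite ler_wpM2r ?pnorm_ge0.
Qed.

Lemma nc_horner p (h : R[i]) : nc p.[h] <= pnorm p (nc h).
Proof.
elim/poly_ind: p => [|p c IH].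
  by rewrite horner0 nc0 /pnorm size_poly0 big_ord0.
rewrite hornerMXaddC pnormMXaddC (le_trans (ncD _ _))// lerD2r ncM.
by rewrite ler_wpM2r ?nc_ge0.
Qed.

(** [a^n - b^n] is [a - b] times a sum of [n] products of size at most [(s / 2)^(n - 1)]; halving
    the radius pays for the factor [n]. *)
Lemma horner_lipschitz p (s : R) (a b : R[i]) : 0 < s -> nc a <= s / 2 -> nc b <= s / 2 ->
  nc (p.[a] - p.[b]) * s <= nc (a - b) * pnorm p s.
Proof.
move=> s0 ha hb; have s20 : 0 <= s / 2 by rewrite divr_ge0// ltW.
have pow n : nc (a ^+ n - b ^+ n) * s <= nc (a - b) * s ^+ n.
  elim: n => [|n IH]; first by rewrite !expr0 subrr nc0 mul0r mulr1 nc_ge0.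
  have [->|n0] := posnP n; first by rewrite !expr1.
  have -> : a ^+ n.+1 - b ^+ n.+1 = a * (a ^+ n - b ^+ n) + (a - b) * b ^+ n.
    by rewrite !exprS; ring.
  rewrite (le_trans (ler_wpM2r (ltW s0) (ncD _ _)))// mulrDl !ncM ncX.
  have hn : nc b ^+ n <= s ^+ n / 2.
    apply: (@le_trans _ _ ((s / 2) ^+ n)).
      by apply: lerXn2r; rewrite ?nnegrE ?nc_ge0.
    rewrite exprMn ler_wpM2l ?exprn_ge0 ?(ltW s0)//.
    rewrite -(prednK n0) exprS ler_piMr// exprn_ile1// ?invr_ge0//.
    by rewrite invf_le1//; lra.
  have h1 : nc a * nc (a ^+ n - b ^+ n) * s <= s / 2 * (nc (a - b) * s ^+ n).
    by rewrite -mulrA ler_pM ?nc_ge0 ?mulr_ge0 ?nc_ge0// ltW.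
  have h2 : nc (a - b) * nc b ^+ n * s <= nc (a - b) * (s ^+ n / 2) * s.
    by rewrite ler_wpM2r ?(ltW s0)// ler_wpM2l ?nc_ge0.
  by rewrite (le_trans (lerD h1 h2))// exprS; lra.
rewrite !horner_coef -sumrB.
have -> : \sum_(i < size p) (p`_i * a ^+ i - p`_i * b ^+ i) =
    \sum_(i < size p) p`_i * (a ^+ i - b ^+ i).
  by apply: eq_bigr => i _; rewrite mulrBr.
rewrite (le_trans (ler_wpM2r (ltW s0) (_ : _ <= \sum_(i < size p) nc p`_i * nc (a ^+ i - b ^+ i))))//.
  elim/big_ind2 : _ => [|x1 y1 x2 y2 h1 h2|i _]; rewrite ?nc0 ?ncM//.
  by rewrite (le_trans (ncD _ _))// lerD.
rewrite mulr_suml /pnorm mulr_sumr; apply: ler_sum => i _.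
by rewrite -mulrA [leRHS]mulrCA ler_wpM2l ?nc_ge0.
Qed.

End polynomial_norm.

Section jets.
Context (R : realType).
Implicit Types (f g : R[i] -> R[i]) (z w h : R[i]) (r C : R).

(* A substitute for analyticity at [z] that involves neither series nor the
   Cauchy formula: the Taylor remainders decay geometrically. The degree of the
   N-th approximant is not required to be less than N, which makes the notion
   stable under compositions without any truncation. *)
Definition jet_at r C f z := forall N, exists p : {poly R[i]},
  pnorm p r <= C /\
  forall h, nc h <= r -> nc (f (z + h) - p.[h]) <= C * (nc h / r) ^+ N.

Definition jet f z := exists r C, [/\ 0 < r, 0 < C & jet_at r C f z].

Lemma jet_at_le r1 r2 C1 C2 f z : 0 < r1 -> r1 <= r2 -> 0 <= C2 -> C2 <= C1 ->
  jet_at r2 C2 f z -> jet_at r1 C1 f z.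
Proof.
move=> r10 r12 C20 C12 H N; have [p [p1 p2]] := H N; exists p.
have r20 := lt_le_trans r10 r12; split.
  by rewrite (le_trans _ C12)// (le_trans _ p1)// le_pnorm// ltW.
move=> h hr; rewrite (le_trans (p2 _ (le_trans hr r12)))//.
apply: ler_pM => //.
  by rewrite exprn_ge0// divr_ge0 ?nc_ge0// ltW.
apply: lerXn2r; rewrite ?nnegrE ?divr_ge0 ?nc_ge0 ?(ltW r10) ?(ltW r20)//.
by rewrite ler_wpM2l ?nc_ge0// lef_pV2.
Qed.

Lemma jetD f g z : jet f z -> jet g z -> jet (fun z => f z + g z) z.
Proof.
move=> [r1 [C1 [r10 C10 H1]]] [r2 [C2 [r20 C20 H2]]].
pose r := Num.min r1 r2; have r0 : 0 < r by rewrite lt_min r10.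
have rr1 : r <= r1 by rewrite ge_min lexx.
have rr2 : r <= r2 by rewrite ge_min lexx orbT.
exists r, (C1 + C2); split; [by []|exact: addr_gt0|] => N.
have [p [p1 p2]] := jet_at_le r0 rr1 (ltW C10) (lexx _) H1 N.
have [q [q1 q2]] := jet_at_le r0 rr2 (ltW C20) (lexx _) H2 N.
exists (p + q); split; first by rewrite (le_trans (pnormD _ _ (ltW r0)))// lerD.
move=> h hr; rewrite hornerD opprD addrACA (le_trans (ncD _ _))// mulrDl.
by rewrite lerD ?p2 ?q2.
Qed.

Lemma jetZ (c : R[i]) f z : jet f z -> jet (fun z => c * f z) z.
Proof.
move=> [r [C [r0 C0 H]]]; have cC : 0 <= nc c * C by rewrite mulr_ge0 ?nc_ge0 ?ltW.
exists r, (nc c * C + 1); split; [by []|by rewrite ltr_wpDl|].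
apply: (@jet_at_le r r _ (nc c * C)) => //; first by rewrite lerDl.
move=> N; have [p [p1 p2]] := H N; exists (c *: p); split.
  by rewrite pnormZ ler_wpM2l ?nc_ge0.
by move=> h hr; rewrite hornerZ -mulrBr ncM -mulrA ler_wpM2l ?nc_ge0 ?p2.
Qed.

Lemma jet_id z : jet id z.
Proof.
exists 1, (1 + nc z); split => //; first by rewrite ltr_pwDl// nc_ge0.
move=> N; exists ('X + z%:P); split.
  have := pnormMXaddC (1 : {poly R[i]}) z 1; rewrite mul1r => ->.
  by rewrite -[1 : {poly _}]polyC1 pnormC nc1 mulr1.
move=> h h1; rewrite hornerD hornerX hornerC /= [z + h]addrC subrr nc0.
by rewrite mulr_ge0 ?exprn_ge0 ?divr_ge0 ?nc_ge0// addr_ge0 ?nc_ge0.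
Qed.

(** The approximants are composed after recentring [p] at [f z]. The error is the remainder of [g]
    at the true increment [a], plus the variation of [P] between [a] and the approximate increment
    [b], which [horner_lipschitz] controls. *)
Lemma jet_comp f g z : jet f z -> jet g (f z) -> jet (g \o f) z.
Proof.
move=> [r [C [r0 C0 Hf]]] [s [D [s0 D0 Hg]]].
(* On this radius the approximate increment of [f] stays within [s / 4], and the true one, with its
   remainder, within [s / 2]. *)
pose r' := Num.min r (r * s / (4 * C)).
have r'0 : 0 < r' by rewrite lt_min r0/= divr_gt0// mulr_gt0.
have r'r : r' <= r by rewrite ge_min lexx.
have r's : C * r' / r <= s / 4.
  have : r' <= r * s / (4 * C) by rewrite ge_min lexx orbT.
  rewrite ler_pdivlMr ?mulr_gt0// ler_pdivrMr// => H.
  by move: H; lra.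
have DC0 : 0 < D * C / s by rewrite divr_gt0// mulr_gt0.
exists r', (D + D * C / s); split => //; first exact: addr_gt0.
(* With order [N.+1] the remainder bound vanishes at [h = 0] even when [N = 0], which forces [p.[0]
   = f z]. *)
move=> N; have [p [p1 p2]] := Hf N.+1; have [P [P1 P2]] := Hg N.
have p0 : p.[0] = f z.
  apply/eqP; rewrite eq_sym -subr_eq0 -nc_eq0 eq_le nc_ge0 andbT.
  have := p2 0; rewrite nc0 addr0 mul0r expr0n mulr0; apply.
  exact: ltW.
have [q [c pE]] : exists q c, p = q * 'X + c%:P.
  by elim/poly_ind: (p) => [|q c _]; [exists 0, 0; rewrite mul0r addr0|exists q, c].
have cE : c = f z by rewrite -p0 pE hornerMXaddC mulr0 add0r.
have pw : p - (f z)%:P = q * 'X by rewrite pE cE addrK.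
have qC : pnorm q r * r <= C.
  by rewrite (le_trans _ p1)// pE pnormMXaddC lerDl nc_ge0.
have qX t : 0 <= t -> t <= r -> pnorm (q * 'X) t <= C * (t / r).
  move=> t0 tr; rewrite pnormMX mulrA ler_pdivlMr// mulrAC.
  by rewrite ler_wpM2r// (le_trans _ qC)// ler_wpM2r ?(ltW r0)// le_pnorm.
exists (P \Po (p - (f z)%:P)); split.
  rewrite (le_trans (pnorm_comp _ _ (ltW r'0)))// (@le_trans _ _ D) ?lerDl ?(ltW DC0)//.
  rewrite (le_trans _ P1)// le_pnorm ?pnorm_ge0 ?(ltW r'0)// pw.
  rewrite (le_trans (qX _ (ltW r'0) r'r))// mulrA (le_trans r's)//.
  by move: s0; lra.
move=> h hr'; rewrite horner_comp !hornerE /=.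
have hr := le_trans hr' r'r.
set a := f (z + h) - f z; set b := p.[h] - f z.
have t0 : 0 <= nc h / r by rewrite divr_ge0 ?nc_ge0 ?ltW.
have t1 : nc h / r <= 1 by rewrite ler_pdivrMr// mul1r.
have t'0 : 0 <= nc h / r' by rewrite divr_ge0 ?nc_ge0 ?ltW.
have t'1 : nc h / r' <= 1 by rewrite ler_pdivrMr// mul1r.
have hb : nc b <= C * (nc h / r).
  have -> : b = (q * 'X).[h] by rewrite -pw !hornerE.
  exact: le_trans (nc_horner _ _) (qX _ (nc_ge0 _) hr).
have hab : nc (a - b) <= C * (nc h / r) ^+ N.+1.
  by rewrite /a /b opprB addrA subrK p2.
have ha : nc a <= s / 2 * (nc h / r').
  have -> : a = (a - b) + b by rewrite subrK.
  have h1 : nc (a - b) + nc b <= C * (nc h / r) + C * (nc h / r).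
    apply: lerD => //; apply: (le_trans hab).
    by rewrite ler_wpM2l ?(ltW C0)// exprS ler_piMr// exprn_ile1.
  rewrite (le_trans (ncD _ _))// (le_trans h1)//.
  have -> : C * (nc h / r) = C * r' / r * (nc h / r').
    by field; rewrite !gt_eqF.
  by rewrite -mulrDl ler_wpM2r//; lra.
have s2 : 0 <= s / 2 by rewrite divr_ge0// ltW.
have ha2 : nc a <= s / 2 by rewrite (le_trans ha)// ler_piMr.
have hb2 : nc b <= s / 2.
  rewrite (le_trans hb)//.
  have -> : C * (nc h / r) = C * r' / r * (nc h / r').
    by field; rewrite !gt_eqF.
  apply: (@le_trans _ _ (s / 4 * 1)); last by move: s0; lra.
  by apply: ler_pM => //; rewrite divr_ge0 ?mulr_ge0 ?(ltW C0) ?(ltW r0) ?(ltW r'0).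
have -> : g (f (z + h)) - P.[b] = (g (f z + a) - P.[a]) + (P.[a] - P.[b]).
  by rewrite addrA subrK /a addrCA subrr addr0.
rewrite (le_trans (ncD _ _))// mulrDl lerD//.
  have as1 : nc a <= s by rewrite (le_trans ha2)//; move: s0; lra.
  rewrite (le_trans (P2 _ as1))// ler_wpM2l ?(ltW D0)//.
  apply: lerXn2r; rewrite ?nnegrE ?divr_ge0 ?nc_ge0 ?(ltW s0) ?(ltW r'0)//.
  rewrite ler_pdivrMr// (le_trans ha)// mulrC ler_wpM2l//.
  by move: s0; lra.
have := horner_lipschitz P s0 ha2 hb2; rewrite -ler_pdivlMr// => /le_trans; apply.
rewrite [leRHS]mulrAC ler_wpM2r ?invr_ge0 ?(ltW s0)//.
rewrite mulrC -[leRHS]mulrA ler_pM ?pnorm_ge0 ?nc_ge0 ?(ltW s0)//.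
rewrite (le_trans hab)// ler_wpM2l ?(ltW C0)//.
rewrite exprSr (@le_trans _ _ ((nc h / r) ^+ N))//.
  by rewrite ler_piMr// exprn_ge0.
by apply: lerXn2r; rewrite ?nnegrE// ler_wpM2l ?nc_ge0// lef_pV2.
Qed.

Lemma jet_inv z : z != 0 -> jet (fun w => w^-1) z.
Proof.
move=> z0; have nz : 0 < nc z by rewrite nc_gt0.
have r0 : 0 < nc z / 2 by rewrite divr_gt0.
exists (nc z / 2), (2 / nc z); split=> //; first by rewrite divr_gt0.
move=> N; exists (\poly_(k < N) ((-1) ^+ k * z ^- k.+1)).
have hx (h : R[i]) : nc h <= nc z / 2 -> z + h != 0.
  move=> hh; rewrite -nc_gt0; have := ler_ncB z (- h); rewrite opprK ncN.
  by apply: lt_le_trans; move: hh nz; lra.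
split.
  rewrite (@pnormE _ N) ?size_poly//.
  have -> : \sum_(i < N) nc (\poly_(k < N) ((-1) ^+ k * z ^- k.+1))`_i * (nc z / 2) ^+ i
    = (nc z)^-1 * \sum_(i < N) (2^-1) ^+ i.
    rewrite mulr_sumr; apply: eq_bigr => i _; rewrite coef_poly ltn_ord.
    rewrite ncM ncX ncN nc1 expr1n mul1r ncV ncX exprS exprMn.
    by rewrite invfM mulrA -[X in X * _ = _]mulrA mulVf ?mulr1// expf_neq0// gt_eqF.
  rewrite mulrC ler_wpM2r ?invr_ge0 ?nc_ge0//.
  have -> : \sum_(i < N) (2^-1 : R) ^+ i = 2 * (1 - (2^-1) ^+ N).
    by elim: N => [|N IH]; rewrite ?big_ord0 ?expr0 ?subrr ?mulr0// big_ord_recr/= IH exprS; field.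
  by rewrite ler_piMr// gerBl exprn_ge0// invr_ge0.
move=> h hh; have xh := hx _ hh.
have -> : (\poly_(k < N) ((-1) ^+ k * z ^- k.+1)).[h] =
    (1 - (- h / z) ^+ N) / (z + h).
  rewrite horner_poly; apply: (mulIf xh); rewrite mulfVK//.
  elim: N => [|N IH]; first by rewrite big_ord0 expr0 subrr mul0r.
  rewrite big_ord_recr /= mulrDl IH !exprS !exprMn exprVn [(- h) ^+ N]exprNn.
  have zN : z ^+ N != 0 by rewrite expf_neq0.
  by field; rewrite zN z0.
rewrite mulrBl mul1r opprB addrCA subrr addr0 ncM ncX ncM ncN ncV ncV.
have h2 : (nc (z + h))^-1 <= 2 / nc z.
  rewrite -invf_div lef_pV2 ?posrE ?nc_gt0//.
  have := ler_ncB z (- h); rewrite opprK ncN; apply: le_trans.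
  by move: hh nz; lra.
rewrite mulrC ler_pM ?invr_ge0 ?nc_ge0 ?exprn_ge0 ?mulr_ge0 ?invr_ge0 ?nc_ge0//.
apply: lerXn2r; rewrite ?nnegrE ?divr_ge0 ?nc_ge0 ?(ltW nz) ?(ltW r0)//.
rewrite ler_wpM2l ?nc_ge0// lef_pV2 ?posrE//.
by move: nz; lra.
Qed.

End jets.

Section cauchy_jet.
Context (R : realType).
Variable mu : probability (measurableTypeR R) R.
Implicit Types (z h : R[i]).

Lemma geometric_resolvent z h N : z != 0 -> z + h != 0 ->
  (z + h)^-1 - \sum_(k < N) (-1) ^+ k * z^-1 ^+ k.+1 * h ^+ k =
  (- h / z) ^+ N / (z + h).
Proof.
move=> z0 zh; apply: (mulIf zh); rewrite mulrBl mulVf// mulfVK//.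
elim: N => [|N IH]; first by rewrite big_ord0 mul0r subr0 expr0.
rewrite big_ord_recr /= mulrDl opprD addrA IH !exprS !exprMn exprVn.
rewrite [(- h) ^+ N]exprNn.
have zN : z ^+ N != 0 by rewrite expf_neq0.
by field; rewrite zN z0.
Qed.

(** The finite geometric expansion of the resolvent is integrated term by term; for shifts up to
    half the height of [z] the shifted resolvent is still at most [2 / Im z]. *)
Lemma jet_cauchy z : 0 < Im z -> jet (cauchy_transform mu) z.
Proof.
move=> z0; set y := Im z; have y20 : 0 < y / 2 by rewrite divr_gt0.
exists (y / 2), (2 / y); split; [by []|by rewrite divr_gt0|] => N.
pose c k : R[i] := (-1) ^+ k * cint mu (fun t => res z t ^+ k.+1).
have yI : 0 < y^-1 by rewrite invr_gt0.
exists (\poly_(k < N) c k); split.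
  rewrite (pnormE (n := N)) ?size_poly//.
  apply: (@le_trans _ _ (y^-1 * \sum_(i < N) (2^-1) ^+ i)); last first.
    rewrite mulrC ler_wpM2r ?(ltW yI)//.
    have -> : \sum_(i < N) (2^-1 : R) ^+ i = 2 * (1 - (2^-1) ^+ N).
      by elim: N => [|N IH]; rewrite ?big_ord0 ?expr0 ?subrr ?mulr0// big_ord_recr/= IH exprS; field.
    by rewrite ler_piMr// gerBl exprn_ge0// invr_ge0.
  rewrite mulr_sumr; apply: ler_sum => i _; rewrite coef_poly ltn_ord.
  rewrite ncM ncX ncN nc1 expr1n mul1r exprMn.
  have h1 : nc (cint mu (fun t => res z t ^+ i.+1)) <= y^-1 ^+ i.+1.
    rewrite (le_trans (nc_cint (cintegrable_resX mu i.+1 z0)))//.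
    have -> : y^-1 ^+ i.+1 = \int[mu]_t y^-1 ^+ i.+1.
      by have /(congr1 Re) := cint_cst mu (y^-1 ^+ i.+1)%:C.
    apply: le_Rintegral => //.
    - exact/rint_nc/cintegrable_resX.
    - exact: rint_cst.
    - move=> t _; rewrite ncX; apply: lerXn2r; rewrite ?nnegrE ?nc_ge0 ?(ltW yI)//.
      exact: nc_res.
  rewrite mulrA (le_trans (ler_wpM2r _ (ler_wpM2r _ h1)))//.
  - by rewrite exprn_ge0// ltW.
  - rewrite exprS -[X in X * _ <= _]mulrA -exprMn mulVf ?gt_eqF// expr1n mulr1.
    by [].
move=> h hh.
have zh0 : 0 < Im (z + h).
  rewrite ImD; have := Im_le_nc h; rewrite ler_norml => /andP[h1 _].
  by move: h1 hh y20; rewrite -/y; lra.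
have zhy : y / 2 <= Im (z + h).
  rewrite ImD; have := Im_le_nc h; rewrite ler_norml => /andP[h1 _].
  by move: h1 hh y20; rewrite -/y; lra.
have ci k : cintegrable mu (fun t => ((-1) ^+ k * h ^+ k) * res z t ^+ k.+1).
  exact/cintegrableZ/cintegrable_resX.
have -> : (\poly_(k < N) c k).[h] =
    cint mu (fun t => \sum_(k < N) ((-1) ^+ k * h ^+ k) * res z t ^+ k.+1).
  rewrite (cint_sum _ ci) horner_poly; apply: eq_bigr => i _.
  by rewrite cintZ; [rewrite /c mulrAC|exact: cintegrable_resX].
rewrite cauchy_transformE -cintB; [|exact: cintegrable_res|by have := cintegrable_sum N ci].
have E t : res (z + h) t - \sum_(k < N) ((-1) ^+ k * h ^+ k) * res z t ^+ k.+1 =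
    (- h) ^+ N * (res z t ^+ N * res (z + h) t).
  rewrite /res -addrA [h + _]addrC addrA.
  have n1 := sub_real_neq0 t z0.
  have n2 : z - t%:C + h != 0 by rewrite addrAC sub_real_neq0.
  rewrite mulrA -exprMn -(geometric_resolvent N n1 n2); congr (_ - _).
  by apply: eq_bigr => i _; rewrite mulrAC.
rewrite (eq_cint _ E).
have ciN : cintegrable mu (fun t => res z t ^+ N * res (z + h) t).
  apply: (@cintegrable_le _ _ _ (fun=> y^-1 ^+ N * (2 / y))); last exact: rint_cst.
    by apply: cmeasM; [exact/cmeasX/cmeas_res|exact: cmeas_res].
  move=> t; rewrite ncM ncX ler_pM ?exprn_ge0 ?nc_ge0//.
    by apply: lerXn2r; rewrite ?nnegrE ?nc_ge0 ?(ltW yI)// nc_res.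
  by rewrite (le_trans (nc_res _ _))// -invf_div lef_pV2.
rewrite cintZ// ncM ncX ncN.
have h2 : nc (cint mu (fun t => res z t ^+ N * res (z + h) t)) <= y^-1 ^+ N * (2 / y).
  rewrite (le_trans (nc_cint ciN))//.
  have -> : y^-1 ^+ N * (2 / y) = \int[mu]_t (y^-1 ^+ N * (2 / y)).
    by have /(congr1 Re) := cint_cst mu (y^-1 ^+ N * (2 / y))%:C.
  apply: le_Rintegral => //; [exact: rint_nc|exact: rint_cst|].
  move=> t _; rewrite ncM ncX ler_pM ?exprn_ge0 ?nc_ge0//.
    by apply: lerXn2r; rewrite ?nnegrE ?nc_ge0 ?(ltW yI)// nc_res.
  by rewrite (le_trans (nc_res _ _))// -invf_div lef_pV2.
rewrite (le_trans (ler_wpM2l _ h2)) ?exprn_ge0 ?nc_ge0//.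
rewrite [leLHS]mulrA -exprMn mulrC ler_wpM2l ?divr_ge0 ?(ltW z0)//.
apply: lerXn2r; rewrite ?nnegrE ?divr_ge0 ?nc_ge0 ?(ltW z0) ?(ltW y20)//.
rewrite ler_wpM2l ?nc_ge0// lef_pV2 ?posrE//.
by move: z0; rewrite -/y; lra.
Qed.

End cauchy_jet.

Section identity_theorem.
Context (R : realType).
Implicit Types (f : R[i] -> R[i]) (z h : R[i]).

Lemma geometric_le0 (x C q : R) : 0 <= q -> q < 1 ->
  (forall n, x <= C * q ^+ n) -> x <= 0.
Proof.
move=> q0 q1 H.
have : (fun n => C * q ^+ n) @ \oo --> C * 0.
  by apply: cvgMr; apply: cvg_expr; rewrite ger0_norm.
by rewrite mulr0 => cv; apply: (cvgr_to_ge cv); apply: nearW.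
Qed.

Definition zeros_cluster f z := forall d : R, 0 < d ->
  exists h, [/\ h != 0, nc h < d & f (z + h) = 0].

(** Clustering zeros force the [N]-th approximant to be divisible by ['X^N], so that it and the
    remainder are both at most [C] times [(|h| / r)^N], for every [N]. *)
Lemma jet_isolated_zeros f z : jet f z -> zeros_cluster f z ->
  exists2 r : R, 0 < r & forall h, nc h < r -> f (z + h) = 0.
Proof.
move=> [r [C [r0 C0 H]]] acc; exists r => // h hr.
apply/eqP; rewrite -nc_eq0 eq_le nc_ge0 andbT.
have q0 : 0 <= nc h / r by rewrite divr_ge0 ?nc_ge0 ?ltW.
have q1 : nc h / r < 1 by rewrite ltr_pdivrMr// mul1r.
apply: (geometric_le0 (C := 2 * C) q0 q1) => N.
have [p [p1 p2]] := H N.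
have divX m : (m <= N)%N -> exists q, p = q * 'X^m.
  elim: m => [_|m IH mN]; first by exists p; rewrite expr0 mulr1.
  have [q pE] := IH (ltnW mN).
  have [q' [c qE]] : exists q' c, q = q' * 'X + c%:P.
    by elim/poly_ind: (q) => [|q' c _]; [exists 0, 0; rewrite mul0r addr0|exists q', c].
  suff c0 : c = 0 by exists q'; rewrite pE qE c0 addr0 exprS mulrA.
  (* At a small zero [k], dividing the remainder bound by [|k|^m] gives [|c| <= |k| K], which fails
     for [|k| < |c| / K]. *)
  pose K := C * r ^- m.+1 + pnorm q' r + 1.
  have K0 : 0 < K.
    by rewrite ltr_wpDl// addr_ge0 ?pnorm_ge0 ?(ltW r0)// mulr_ge0 ?(ltW C0)// invr_ge0 exprn_ge0// ltW.
  apply/eqP; rewrite -nc_eq0 eq_le nc_ge0 andbT leNgt; apply/negP => ncpos.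
  have dpos : 0 < Num.min r (nc c / K) by rewrite lt_min r0 divr_gt0.
  have [k [k0]] := acc _ dpos; rewrite lt_min => /andP[kr kc] fk.
  have nk : 0 < nc k by rewrite nc_gt0.
  have := p2 k (ltW kr); rewrite fk sub0r ncN pE hornerM hornerXn ncM ncX.
  have e1 : C * (nc k / r) ^+ N <= C * r ^- m.+1 * nc k * nc k ^+ m.
    have -> : C * r ^- m.+1 * nc k * nc k ^+ m = C * (nc k / r) ^+ m.+1.
      by rewrite exprMn exprVn [nc k ^+ m.+1]exprS; ring.
    rewrite ler_wpM2l ?(ltW C0)// ler_wiXn2l// ?divr_ge0 ?nc_ge0 ?(ltW r0)//.
    by rewrite ler_pdivrMr// mul1r ltW.
  move=> /le_trans /(_ e1); rewrite ler_pM2r ?exprn_gt0// => e2.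
  have e3 : nc c <= nc q.[k] + nc k * pnorm q' r.
    have -> : c = q.[k] - k * q'.[k] by rewrite qE hornerMXaddC; ring.
    rewrite (le_trans (ncB _ _))// lerD2l ncM ler_wpM2l ?nc_ge0//.
    rewrite (le_trans (nc_horner _ _))// le_pnorm ?nc_ge0//.
    exact: ltW.
  have : nc c < nc c.
    apply: (le_lt_trans (le_trans e3 (lerD e2 (lexx _)))).
    apply: (@le_lt_trans _ _ (nc k * K)); last by rewrite -ltr_pdivlMr.
    by rewrite /K; move: nk; nra.
  by rewrite ltxx.
have [q pE] := divX N (leqnn N).
have e1 : nc p.[h] <= C * (nc h / r) ^+ N.
  rewrite pE hornerM hornerXn ncM ncX.
  have e2 : pnorm q r * r ^+ N <= C by rewrite -pnormMXn -pE.
  rewrite exprMn exprVn mulrCA mulrC ler_wpM2l ?exprn_ge0 ?nc_ge0//.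
  rewrite ler_pdivlMr ?exprn_gt0// (le_trans _ e2)// ler_wpM2r ?exprn_ge0 ?(ltW r0)//.
  by rewrite (le_trans (nc_horner _ _))// le_pnorm ?nc_ge0 ?(ltW hr).
have := p2 h (ltW hr) => e2.
have -> : f (z + h) = (f (z + h) - p.[h]) + p.[h] by rewrite subrK.
by rewrite (le_trans (ncD _ _))// -mulrA mulr_natl mulr2n lerD.
Qed.

(** Connectedness is used along the segment from [z0] to the target: at the supremum of the times up
    to which [f] vanishes the zeros still cluster, so the vanishing extends further. *)
Lemma identity_upper_half_plane f z0 : (forall z, 0 < Im z -> jet f z) ->
  0 < Im z0 -> zeros_cluster f z0 -> forall z, 0 < Im z -> f z = 0.
Proof.
move=> jf i0 acc z1 i1.
have [->|z10] := eqVneq z1 z0.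
  have [r r0 H] := jet_isolated_zeros (jf _ i0) acc.
  by rewrite -(addr0 z0) H// nc0.
pose L := nc (z1 - z0); have L0 : 0 < L by rewrite nc_gt0 subr_eq0.
pose g (t : R) := z0 + t%:C * (z1 - z0).
have ig (t : R) : 0 <= t -> t <= 1 -> 0 < Im (g t).
  move=> t0 t1; rewrite /g !ReImE mul0r addr0; nra.
have gE s t : g s = g t + (s - t)%:C * (z1 - z0).
  by rewrite /g -addrA -mulrDl; congr (_ + _ * _); rewrite -rmorphD addrC subrK.
have lz (t : R) : 0 <= t -> t <= 1 -> zeros_cluster f (g t) ->
    exists2 d : R, 0 < d & forall s, `|s - t| < d -> f (g s) = 0.
  move=> t0 t1 /(jet_isolated_zeros (jf _ (ig _ t0 t1)))[r r0 H].
  exists (r / L); first by rewrite divr_gt0.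
  by move=> s st; rewrite (gE s t) H// ncM ncR -ltr_pdivlMr.
have accg (t : R) : (forall d : R, 0 < d -> exists s, [/\ s != t, `|s - t| < d & f (g s) = 0]) ->
    zeros_cluster f (g t).
  move=> H d d0; have [s [s1 s2 s3]] := H _ (divr_gt0 d0 L0).
  exists ((s - t)%:C * (z1 - z0)); split; last by rewrite -gE.
    rewrite mulf_neq0// ?subr_eq0// -nc_eq0 ncR normr_eq0 subr_eq0//.
  by rewrite ncM ncR -ltr_pdivlMr.
pose A := [set t : R | 0 <= t <= 1 /\ forall s : R, 0 <= s <= t -> f (g s) = 0].
have g0 : g 0 = z0 by rewrite /g mul0r addr0.
have [d0 d00 Hd0] := lz 0 (lexx _) ler01 (eq_ind_r _ acc g0).
have A0 : A 0.
  split; first by rewrite lexx ler01.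
  by move=> s s0; apply: Hd0; rewrite -(le_anti s0) subrr normr0.
have supA : has_sup A.
  by split; [exists 0|exists 1 => t [/andP[]]].
pose a := sup A.
have a0 : 0 <= a by apply: ub_le_sup => //; exact: supA.2.
have a1 : a <= 1 by apply: ge_sup; [exists 0|move=> t [/andP[]]].
have below (s : R) : 0 <= s -> s < a -> f (g s) = 0.
  move=> s0 sa; have [t [_ tA] st] := sup_gt (ex_intro _ 0 A0) sa.
  by apply: tA; rewrite s0 ltW.
have acca : zeros_cluster f (g a).
  have [ap|an] := ltP 0 a; last first.
    have -> : a = 0 by apply/le_anti; rewrite an.
    by rewrite g0.
  apply: accg => d dp; pose s := Num.max 0 (a - d / 2).
  have sa : s < a by rewrite gt_max ap/= ltrBlDr ltrDl divr_gt0.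
  exists s; split; first by rewrite lt_eqF.
    rewrite ltr0_norm ?subr_lt0// opprB.
    have : a - d / 2 <= s by rewrite le_max lexx orbT.
    by move: dp; lra.
  by apply: below => //; rewrite le_max lexx.
have [d dp Hd] := lz a a0 a1 acca.
have upto (s : R) : 0 <= s -> s < a + d -> f (g s) = 0.
  move=> s0 sd; have [|sa] := ltP s a; first exact: below.
  by apply: Hd; rewrite ger0_norm ?subr_ge0// ltrBlDl.
have [|ad] := ltP 1 (a + d).
  by move=> h; have := upto 1 ler01 h; rewrite /g mul1r addrC subrK.
have : A (a + d / 2).
  split; first by move: a0 dp ad; lra.
  by move=> s /andP[s0 s1]; apply: upto => //; move: s1 dp; lra.
move=> /(ub_le_sup supA.2); rewrite -/a => h.
by exfalso; move: h dp; lra.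
Qed.

End identity_theorem.

(** * Subordination for free roots *)

Section right_inverses.
Context (R : realType).
Notation MR := (measurableTypeR R).
Notation prob := (probability MR R).
Implicit Types (mu nu rho : prob) (eta M a b : R) (z h : R[i]).

Lemma truncated_coneE eta M z : truncated_cone eta M z <->
  [/\ 0 < Im z, `|Re z| < eta * Im z & M < nc z].
Proof. by rewrite /truncated_cone /= normE ltcR. Qed.

Definition outside (L : R) : set MR := [set t : R | L < `|t|].

Lemma measurable_outside L : measurable (outside L).
Proof.
have := @measurable_fun_ltr _ MR R setT (cst L) (fun t : R => `|t|).
move=> /(_ _ _ measurableT [set true]) h.
have : measurable (setT `&` (fun t : MR => cst L t < `|t|) @^-1` [set true]).
  apply: h => //; exact: measurableT_comp.
by rewrite setTI.
Qed.

(** Tightness; it stands in for moments, which are not yet available for free roots. *)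
Lemma outside_small mu (e : R) : 0 < e ->
  exists L, 0 < L /\ fine (mu (outside L)) < e.
Proof.
move=> e0.
have cv : mu (outside n%:R) @[n --> \oo] --> mu (\bigcap_n outside n%:R).
  apply: nonincreasing_cvg_mu => //.
  - exact: le_lt_trans (probability_le1 _ (measurable_outside _)) (ltey _).
  - by move=> n; exact: measurable_outside.
  - by apply: bigcap_measurable => // n _; exact: measurable_outside.
  - move=> m n mn; apply/subsetPset => t /=; rewrite /outside /=.
    by apply: le_lt_trans; rewrite ler_nat.
have cap0 : \bigcap_n outside n%:R = set0.
  rewrite -subset0 => t /(_ (Num.trunc `|t|).+1 I); rewrite /outside /= => h.
  have := truncnS_gt `|t|.
  by move=> /(lt_trans h); rewrite ltxx.
rewrite cap0 measure0 in cv.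
have /fine_cvgP[_ /cvgrPdist_lt/(_ e e0)[N' _ HN']] := cv.
exists (maxn N' 1)%:R; split; first by rewrite ltr0n leq_max orbT.
have := HN' (maxn N' 1) (leq_maxl _ _).
by rewrite /= sub0r normrN; apply: le_lt_trans; exact: ler_norm.
Qed.

Lemma Rintegral_indic mu (A : set MR) : measurable A ->
  \int[mu]_t \1_A t = fine (mu A).
Proof. by move=> mA; rewrite /Rintegral integral_indic// setIT. Qed.

Lemma rint_indic mu (A : set MR) : measurable A -> rint mu (\1_A).
Proof.
move=> mA; apply: (rint_le _ _ (rint_cst mu 1)).
  exact: measurable_indic.
by move=> t; rewrite indicE; case: (_ \in _); rewrite ?normr1 ?normr0.
Qed.

Lemma nc_cone a b z : 0 < a -> truncated_cone a b z -> nc z <= (1 + a) * Im z.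
Proof.
move=> a0 /truncated_coneE[i0 h _]; rewrite (le_trans (nc_le_ReIm _))//.
by rewrite (gtr0_norm i0) mulrDl mul1r addrC lerD2l ltW.
Qed.

Lemma mul_res z (t : R) : 0 < Im z -> t%:C * res z t = z * res z t - 1.
Proof.
move=> z0; rewrite /res -[X in _ = _ - X](mulfV (sub_real_neq0 t z0)) -mulrBl.
by congr (_ * _); rewrite opprB addrC subrK.
Qed.

Lemma cintegrable_mul_res mu z : 0 < Im z -> cintegrable mu (fun t => t%:C * res z t).
Proof.
move=> z0; rewrite (_ : (fun _ => _) = fun t => z * res z t - 1).
  by apply: cintegrableB; [exact/cintegrableZ/cintegrable_res|exact: cintegrable_cst].
by apply/funext => t; exact: mul_res.
Qed.

Lemma zcauchy mu z : 0 < Im z ->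
  z * cauchy_transform mu z - 1 = cint mu (fun t => t%:C * res z t).
Proof.
move=> z0; rewrite cauchy_transformE -cintZ; last exact: cintegrable_res.
rewrite -[X in _ - X](cint_cst mu 1) -cintB; last exact: cintegrable_cst.
  by apply: eq_cint => t; rewrite mul_res.
exact/cintegrableZ/cintegrable_res.
Qed.

(** The integrand [t / (z - t)] is at most [L / Im z] where [|t| <= L]. Elsewhere it is at most
    [2 + a], because [|t| <= |z| + |z - t|] and [|z| <= (1 + a) Im z] in the cone, and the mass
    there is small. *)
Lemma cauchy_nontangential mu a (e : R) : 0 < a -> 0 < e -> exists2 B, 0 < B &
  forall b z, truncated_cone a b z -> B <= nc z ->
    nc (z * cauchy_transform mu z - 1) <= e.
Proof.
move=> a0 e0; have K0 : 0 < 2 + a by rewrite addr_gt0.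
have [L [L0 HL]] := outside_small mu (divr_gt0 e0 (mulr_gt0 (ltr0n _ 2) K0)).
have a10 : 0 < 1 + a by rewrite addr_gt0.
exists (2 * L * (1 + a) / e); first by rewrite divr_gt0// !mulr_gt0.
move=> b z zT zB; have [z0 _ _] := (truncated_coneE a b z).1 zT.
have nz : 0 < nc z by rewrite nc_gt0 Im_neq0.
rewrite zcauchy// (le_trans (nc_cint (cintegrable_mul_res mu z0)))//.
have bnd t : nc (t%:C * res z t) <= L / Im z + (2 + a) * \1_(outside L) t.
  have zt := nc_sub_real z t; rewrite gtr0_norm// in zt.
  have nzt : 0 < nc (z - t%:C) by rewrite (lt_le_trans z0).
  rewrite ncM ncR /res ncV.
  have [tL|tL] := leP `|t| L.
    rewrite -[leLHS]addr0 lerD//; last by rewrite mulr_ge0 ?(ltW K0)// indicE.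
    by rewrite ler_pM// ?invr_ge0 ?nc_ge0// lef_pV2.
  rewrite indicE mem_set// mulr1 (@le_trans _ _ (2 + a))//; last first.
    by rewrite lerDr divr_ge0// ltW.
  rewrite ler_pdivrMr// -ncR.
  have := ncB z (z - t%:C); rewrite opprB addrC subrK => /le_trans; apply.
  rewrite (le_trans (lerD (nc_cone a0 zT) (lexx _)))//.
  by move: zt a0; nra.
have iI := rint_indic mu (measurable_outside L).
have iz : rint mu (fun t => (2 + a) * \1_(outside L) t) by exact: rintZ.
apply: (@le_trans _ _ (\int[mu]_t (L / Im z + (2 + a) * \1_(outside L) t))).
  apply: le_Rintegral => //; first exact/rint_nc/cintegrable_mul_res.
  by apply: rintD => //; exact: rint_cst.
rewrite RintegralD//; last exact: rint_cst.
rewrite RintegralZl// Rintegral_indic; last exact: measurable_outside.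
have -> : \int[mu]_t (L / Im z) = L / Im z.
  by have /(congr1 Re) := cint_cst mu (L / Im z)%:C.
have h1 : L / Im z <= e / 2.
  have := nc_cone a0 zT => h; move: zB; rewrite ler_pdivrMr// => zB.
  rewrite ler_pdivrMr//.
  have : 2 * L * (1 + a) <= (1 + a) * (Im z * e).
    by rewrite (le_trans zB)// mulrA ler_wpM2r// ltW.
  rewrite mulrC ler_pM2l//; lra.
have h2 : (2 + a) * fine (mu (outside L)) <= e / 2.
  rewrite -ler_pdivlMl// ltW// (lt_le_trans HL)//.
  by rewrite invfM mulrA mulrC.
by rewrite (le_trans (lerD h1 h2))//; lra.
Qed.

(** This keeps preimages of far points far away. At least half of the mass lies in [[-L, L]], which
    bounds [- Im G] from below on a bounded piece of the cone. *)
Lemma F_bounded mu a b B : 0 < a -> 0 < b -> exists Y, forall z,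
  truncated_cone a b z -> nc z <= B -> nc (F_transform mu z) <= Y.
Proof.
move=> a0 b0; have [L [L0 HL]] := outside_small mu (@divr_gt0 _ 1 2 ltr01 (ltr0n _ 2)).
pose B' := Num.max B 0 + L; have B'0 : 0 < B' by rewrite ltr_wpDl// le_max lexx orbT.
(* In the cone [b < |z| <= (1 + a) Im z], so [y] is a lower bound for the height. *)
pose y := b / (1 + a); have y0 : 0 < y by rewrite divr_gt0// addr_gt0.
exists (y * (B' ^- 2 / 2))^-1 => z zT zB.
have [z0 _ zb] := (truncated_coneE a b z).1 zT.
have yz : y <= Im z.
  by rewrite ler_pdivrMr ?addr_gt0// mulrC (le_trans (ltW zb))// (nc_cone a0 zT).
rewrite /F_transform ncV lef_pV2 ?posrE ?nc_gt0 ?cauchy_neq0//; last first.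
  by rewrite mulr_gt0// divr_gt0// invr_gt0 exprn_gt0.
apply: le_trans (Im_le_nc _); rewrite cauchy_Im// normrN ger0_norm; last first.
  by rewrite mulr_ge0 ?(ltW z0)// Rintegral_ge0// => t _; rewrite exprn_ge0// nc_ge0.
apply: ler_pM => //; first exact: ltW.
  by rewrite divr_ge0// invr_ge0 exprn_ge0// ltW.
have iI := rint_indic mu (measurable_outside L).
have iZ : rint mu (fun t => - B' ^- 2 * \1_(outside L) t) by exact: rintZ.
apply: (@le_trans _ _ (\int[mu]_t (B' ^- 2 + - B' ^- 2 * \1_(outside L) t))).
  rewrite RintegralD//; last exact: rint_cst.
  rewrite RintegralZl// Rintegral_indic; last exact: measurable_outside.
  have -> : \int[mu]_t (B' ^- 2) = B' ^- 2.
    by have /(congr1 Re) := cint_cst mu (B' ^- 2)%:C.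
  have : 0 < B' ^- 2 by rewrite invr_gt0 exprn_gt0.
  by move: HL; nra.
apply: le_Rintegral => //.
- by apply: rintD => //; exact: rint_cst.
- exact: rint_res2.
move=> t _; rewrite indicE; have [|tL] := boolP (t \in outside L).
  by rewrite mulr1 subrr exprn_ge0// nc_ge0.
rewrite mulr0 addr0 /res ncV exprVn lef_pV2 ?posrE ?exprn_gt0//; last first.
  by rewrite nc_gt0 sub_real_neq0.
apply: lerXn2r; rewrite ?nnegrE ?nc_ge0 ?(ltW B'0)//.
rewrite (le_trans (ncB _ _))// lerD//; first by rewrite (le_trans zB)// le_max lexx.
by rewrite ncR leNgt; apply/negP => h; move: tL; rewrite mem_set.
Qed.

Definition iy (y : R) : R[i] := 0 +i* y.

Lemma nc_iy y : nc (iy y) = `|y|.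
Proof. by rewrite /= expr0n add0r sqrtr_sqr. Qed.

Lemma cone_iy eta M y : 0 < eta -> 0 < y -> M < y -> truncated_cone eta M (iy y).
Proof.
move=> e0 y0 My; apply/truncated_coneE; rewrite nc_iy /= normr0.
by rewrite mulr_gt0// gtr0_norm.
Qed.

(** By [F_bounded] the point [z = Finv (iy y)] leaves every bounded set; far out in the cone
    [z G(z)] is close to [1], while [G(z)] is exactly [(iy y)^-1]. *)
Lemma right_inverse_asymptotic mu eta M Finv (e : R) :
  0 < eta -> F_right_inverse mu eta M Finv -> 0 < e ->
  exists Y, forall y, Y < y -> nc (Finv (iy y) - iy y) <= e * y.
Proof.
move=> eta0 [Finv1 [a [b [a0 b0 _ Finv2]]]] e0.
have [B B0 HB] := cauchy_nontangential mu a0 e0.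
have [Y HY] := F_bounded mu B a0 b0.
exists (Num.max (Num.max Y M) 0) => y; rewrite !gt_max => /andP[/andP[yY yM] y0].
have yT := cone_iy eta0 y0 yM.
have [FE _] := Finv1 _ yT; have zT := Finv2 _ yT.
set z := Finv (iy y) in FE zT *.
have zB : B <= nc z.
  rewrite leNgt; apply/negP => zB.
  have := HY _ zT (ltW zB); rewrite FE nc_iy gtr0_norm// => /(lt_le_trans yY).
  by rewrite ltxx.
have := HB _ _ zT zB.
have -> : cauchy_transform mu z = (iy y)^-1 by rewrite -FE /F_transform invrK.
have iy0 : iy y != 0 by exact: Im_neq0.
have -> : z / iy y - 1 = (z - iy y) / iy y by rewrite mulrBl mulfV.
by rewrite ncM ncV nc_iy gtr0_norm// ler_pdivrMr.
Qed.

Lemma right_inverse_cone mu eta M Finv a b :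
  0 < eta -> F_right_inverse mu eta M Finv -> 0 < a -> 0 < b ->
  exists Y, forall y, Y < y -> truncated_cone a b (Finv (iy y)).
Proof.
move=> eta0 H a0 b0; pose e := Num.min (1 / 2) (a / 4).
have e0 : 0 < e by rewrite lt_min !divr_gt0.
have e1 : e <= 1 / 2 by rewrite ge_min lexx.
have e2 : e <= a / 4 by rewrite ge_min lexx orbT.
have [Y HY] := right_inverse_asymptotic eta0 H e0.
exists (Num.max Y (2 * b)) => y; rewrite gt_max => /andP[/HY h yb].
have y0 : 0 < y by rewrite (lt_trans _ yb)// mulr_gt0.
set z := Finv _ in h *.
have := le_trans (Re_le_nc _) h; have := le_trans (Im_le_nc _) h.
rewrite ReD ReN ImD ImN /= oppr0 addr0 => hi hr.
have {}hi : y / 2 <= Im z.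
  by move: hi; rewrite ler_norml => /andP[hi _]; move: hi e1 y0; nra.
apply/truncated_coneE; split.
- by rewrite (lt_le_trans _ hi)// divr_gt0.
- rewrite (le_lt_trans hr)//; move: hi e2 y0 a0; nra.
- apply: lt_le_trans (Im_le_nc _); rewrite ger0_norm; first by move: hi yb; lra.
  by rewrite (le_trans _ hi)// divr_ge0// ltW.
Qed.

(** Being asymptotic to [iy y], the value [f2 (iy y)] eventually enters the cone of univalence that
    comes with [f1]. *)
Lemma right_inverse_unique mu eta1 M1 f1 eta2 M2 f2 :
  0 < eta1 -> F_right_inverse mu eta1 M1 f1 ->
  0 < eta2 -> F_right_inverse mu eta2 M2 f2 ->
  exists Y, forall y, Y < y -> f1 (iy y) = f2 (iy y).
Proof.
move=> e1 H1 e2 H2; have [F1 [a [b [a0 b0 inj F1T]]]] := H1.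
have [Y HY] := right_inverse_cone e2 H2 a0 b0.
exists (Num.max (Num.max Y 0) (Num.max M1 M2)) => y.
rewrite !gt_max => /andP[/andP[yY y0] /andP[yM1 yM2]].
have T1 := cone_iy e1 y0 yM1; have T2 := cone_iy e2 y0 yM2.
apply: inj; rewrite ?inE; [exact: F1T|exact: HY|].
by rewrite (F1 _ T1).1 (H2.1 _ T2).1.
Qed.

(** Each convolution of the chain has its own cone and its own inverses; uniqueness far up the
    imaginary axis is what allows their Voiculescu transforms to be added. *)
Lemma free_power_right_inverse rho n nu : free_power rho n nu ->
  forall eta1 M1 f1 eta2 M2 f2,
  0 < eta1 -> F_right_inverse rho eta1 M1 f1 ->
  0 < eta2 -> F_right_inverse nu eta2 M2 f2 ->
  exists Y, forall y, Y < y -> f2 (iy y) - iy y = n%:R * (f1 (iy y) - iy y).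
Proof.
elim=> [|{}n {}nu mu _ IH
    [eta [M [pnu [prho [pmu [[eta0 M0] [gnu [Hgnu Enu]] [grho [Hgrho Erho]]
      [gmu [Hgmu Emu]] E]]]]]]] eta1 M1 f1 eta2 M2 f2 e1 H1 e2 H2.
- have [Y HY] := right_inverse_unique e1 H1 e2 H2.
  by exists Y => y /HY ->; rewrite mul1r.
- have [Y1 HY1] := IH _ _ _ _ _ _ eta0 Hgrho eta0 Hgnu.
  have [Y2 HY2] := right_inverse_unique e1 H1 eta0 Hgrho.
  have [Y3 HY3] := right_inverse_unique e2 H2 eta0 Hgmu.
  exists (Num.max (Num.max Y1 Y2) (Num.max Y3 M)) => y.
  rewrite !gt_max => /andP[/andP[y1 y2] /andP[y3 yM]].
  have yT := cone_iy eta0 (lt_trans M0 yM) yM.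
  have := E _ yT; rewrite (Enu _ yT) (Erho _ yT) (Emu _ yT).
  by rewrite HY2// HY3// => ->; rewrite HY1// -nat1r mulrDl mul1r addrC.
Qed.

End right_inverses.

Section subordination.
Context (R : realType).
Notation MR := (measurableTypeR R).
Notation prob := (probability MR R).
Implicit Types (mu rho : prob) (z : R[i]).

(* The subordination function of [mu] with respect to its n-th free root, which
   is explicit because all the summands have the same law. *)
Definition omega mu (n : nat) z : R[i] :=
  (n%:R - 1) / n%:R * F_transform mu z + n%:R^-1 * z.

Lemma inv_natC n : (n%:R : R[i])^-1 = (n%:R^-1 : R)%:C.
Proof. by rewrite natC -fmorphV. Qed.

Lemma omega_coefC n : ((n%:R - 1) / n%:R : R[i]) = ((n%:R - 1) / n%:R : R)%:C.
Proof. by rewrite natC -(rmorph1 (real_complex R)) -rmorphB -fmorphV -rmorphM. Qed.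

Lemma Im_omega mu n z :
  Im (omega mu n z) = (n%:R - 1) / n%:R * Im (F_transform mu z) + n%:R^-1 * Im z.
Proof. by rewrite /omega omega_coefC inv_natC !ReImE !mul0r !addr0. Qed.

Lemma Im_omega_gt0 mu n z : (0 < n)%N -> 0 < Im z -> 0 < Im (omega mu n z).
Proof.
move=> n0 z0; rewrite Im_omega ltr_wpDl//.
  by rewrite mulr_ge0 ?(ltW (F_Im_gt0 mu z0))// divr_ge0// subr_ge0 ler1n.
by rewrite mulr_gt0// invr_gt0 ltr0n.
Qed.

Lemma jet_omega mu n z : 0 < Im z -> jet (omega mu n) z.
Proof.
move=> z0; apply: jetD; last exact/jetZ/jet_id.
apply: jetZ; apply: (@jet_comp _ (cauchy_transform mu) (fun w => w^-1)).
  exact: jet_cauchy.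
exact/jet_inv/cauchy_neq0.
Qed.

(** The accumulation point for the identity theorem: [Finv] is continuous because it is derivable,
    and injective because [F_transform mu] undoes it. *)
Lemma right_inverse_cluster mu eta M Finv y : 0 < eta -> 0 <= M ->
  F_right_inverse mu eta M Finv -> M < y -> forall e : R, 0 < e ->
  exists y', [/\ y < y', Finv (iy y') != Finv (iy y) &
                 nc (Finv (iy y') - Finv (iy y)) < e].
Proof.
move=> eta0 M0 [H _] My e e0; have y0 := le_lt_trans M0 My.
have yT := cone_iy eta0 y0 My; have [Fy dF] := H _ yT.
have /differentiable_continuous cF := (derivable1_diffP _ _).1 dF.
have eC : (0 : R[i]) < e%:C by rewrite ltcR.
have /cvgrPdist_lt/(_ _ eC)[d /= d0 Hd] := cF.
(* Radii of balls in [R[i]] are complex numbers; a positive one is real. *)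
have [dr dE] : exists dr : R, d = dr%:C.
  have /ger0_Im h := ltW d0; exists (Re d).
  by move: h; case: (d) => a b /= ->.
move: d0 Hd; rewrite dE ltcR => d0 Hd.
have y'T := @cone_iy _ eta M (y + dr / 2) eta0 _ _.
have yy' : y < y + dr / 2 by rewrite ltrDl divr_gt0.
have {}y'T := y'T (lt_trans y0 yy') (lt_trans My yy').
exists (y + dr / 2); split => //.
  apply/eqP => h; have := (H _ y'T).1; rewrite h Fy => /(congr1 Im) /= h2.
  by move: yy'; rewrite -h2 ltxx.
have := Hd (iy (y + dr / 2)).
rewrite /ball_ /= => -/(_ _).
have -> : iy y - iy (y + dr / 2) = iy (- (dr / 2)).
  by apply: complex_ext; rewrite !ReImE /= ?subr0//; ring.
rewrite normE nc_iy normrN gtr0_norm ?divr_gt0// !ltcR => h.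
rewrite ncBC; have := h; apply; move: d0; lra.
Qed.

(** At [w = fm (iy y)] one has [F w = iy y], and the relation between the inverses turns [omega w]
    into [fr (iy y)]; both transforms then equal [(iy y)^-1]. Such points [w] cluster in the upper
    half-plane. *)
Lemma free_root_subordination n rho mu z : (1 < n)%N -> free_power rho n mu ->
  0 < Im z -> cauchy_transform rho (omega mu n z) = cauchy_transform mu z.
Proof.
move=> n1 H z0; apply/eqP; rewrite -subr_eq0; apply/eqP.
have n0 : (0 < n)%N by exact: ltnW.
have nC : (n%:R : R[i]) != 0 by rewrite pnatr_eq0 -lt0n.
(* Since [1 < n], the last step of the power is a convolution, which carries right inverses for
   [rho] and for [mu]. *)
have [eta [M [eta0 M0 [fr [Hr [fm Hm]]]]]] : exists eta M, [/\ 0 < eta, 0 < M &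
    exists fr, F_right_inverse rho eta M fr /\ exists fm, F_right_inverse mu eta M fm].
  case: H n1 => // k nu mu' _ [eta [M [pnu [prho [pmu [[eta0 M0] _ [grho [Hr _]] [gmu [Hm _]] _]]]]]] _.
  by exists eta, M; split=> //; exists grho; split=> //; exists gmu.
have [Y HY] := free_power_right_inverse H eta0 Hr eta0 Hm.
pose f w := cauchy_transform rho (omega mu n w) - cauchy_transform mu w.
have fz y : Y < y -> M < y -> f (fm (iy y)) = 0.
  move=> yY yM; have yT := cone_iy eta0 (lt_trans M0 yM) yM.
  have Fm := (Hm.1 _ yT).1; have Fr := (Hr.1 _ yT).1.
  have oE : omega mu n (fm (iy y)) = fr (iy y).
    rewrite /omega Fm; have := HY _ yY => /(canRL (subrK _)) ->.
    by field.
  rewrite /f oE; apply/eqP; rewrite subr_eq0; apply/eqP; apply: invr_inj.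
  exact: etrans Fr (esym Fm).
have jf w : 0 < Im w -> jet f w.
  move=> w0; rewrite (_ : f = fun w => (cauchy_transform rho \o omega mu n) w
                             + (-1) * cauchy_transform mu w).
    apply: jetD; last exact/jetZ/jet_cauchy.
    apply: jet_comp; first exact: jet_omega.
    exact/jet_cauchy/Im_omega_gt0.
  by apply/funext => v; rewrite /f /= mulN1r.
pose y := Num.max Y M + 1.
have yY : Y < y by rewrite /y (le_lt_trans (y := Num.max Y M)) ?ltrDl// le_max lexx.
have yM : M < y by rewrite /y (le_lt_trans (y := Num.max Y M)) ?ltrDl// le_max lexx orbT.
have [a [b [a0 b0 _ HT]]] := Hm.2.
have iz : 0 < Im (fm (iy y)).
  by have /truncated_coneE[] := HT _ (cone_iy eta0 (lt_trans M0 yM) yM).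
apply: (identity_upper_half_plane jf iz _ z0) => d d0.
have [y' [yy' ne lt]] := right_inverse_cluster eta0 (ltW M0) Hm yM d0.
exists (fm (iy y') - fm (iy y)); split; [by rewrite subr_eq0|by []|].
by rewrite addrC subrK fz// (lt_trans _ yy').
Qed.

End subordination.

(** * Moments of free roots *)

Section complex_sequences.
Context (R : realType).
Implicit Types (u v : nat -> R[i]) (l m : R[i]).

Definition ccvg u l := (u k : R[i]^o) @[k --> \oo] --> (l : R[i]^o).

Lemma ccvgD u v l m : ccvg u l -> ccvg v m -> ccvg (fun k => u k + v k) (l + m).
Proof. exact: cvgD. Qed.

Lemma ccvgB u v l m : ccvg u l -> ccvg v m -> ccvg (fun k => u k - v k) (l - m).
Proof. exact: cvgB. Qed.

Lemma ccvgM u v l m : ccvg u l -> ccvg v m -> ccvg (fun k => u k * v k) (l * m).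
Proof. exact: (@cvgM R[i]). Qed.

Lemma ccvgV u l : l != 0 -> ccvg u l -> ccvg (fun k => (u k)^-1) l^-1.
Proof. exact: (@cvgV R[i]). Qed.

Lemma ccvg_cst l : ccvg (fun=> l) l.
Proof. exact: cvg_cst. Qed.

Lemma ccvgZ (c : R[i]) u l : ccvg u l -> ccvg (fun k => c * u k) (c * l).
Proof. by apply: ccvgM; exact: ccvg_cst. Qed.

Lemma ccvg_unique u l m : ccvg u l -> ccvg u m -> l = m.
Proof. exact: (@cvg_unique _ (@norm_hausdorff R[i] R[i]^o)). Qed.

Lemma cvg_ncP u l : ccvg u l <-> nc (u k - l) @[k --> \oo] --> (0 : R).
Proof.
split=> [/cvgrPdist_lt H|/cvgrPdist_lt H].
  apply/cvgrPdist_lt => e e0; have eC : (0 : R[i]) < e%:C by rewrite ltcR.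
  have [N _ HN] := H _ eC; exists N => // k Nk.
  have /= := HN k Nk; rewrite normE ltcR ncBC => h.
  by rewrite /= sub0r normrN ger0_norm ?nc_ge0.
apply/cvgrPdist_lt => e e0.
have eE : e = (Re e)%:C by move: (ger0_Im (ltW e0)); case: (e) => a b /= ->.
have e0' : 0 < Re e by move: e0; rewrite eE ltcR.
have [N _ HN] := H _ e0'; exists N => // k Nk.
have /= := HN k Nk; rewrite sub0r normrN ger0_norm ?nc_ge0// => h.
by rewrite /= eE -/(nc (l - u k)) normE ltcR ncBC.
Qed.

Lemma cvg_squeeze0 (a b : nat -> R) : (forall k, `|a k| <= b k) ->
  b @ \oo --> (0 : R) -> a @ \oo --> (0 : R).
Proof.
move=> ab b0; apply/norm_cvg0P.
apply: (@squeeze_cvgr _ _ _ _ (fun=> 0) b) => //; last exact: cvg_cst.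
by apply: nearW => k; rewrite normr_ge0 ab.
Qed.

Lemma cvg_Re u l : ccvg u l -> Re (u k) @[k --> \oo] --> Re l.
Proof.
move=> /cvg_ncP H; apply/subr_cvg0/(cvg_squeeze0 _ H) => k.
by apply: le_trans (Re_le_nc _); rewrite ReD ReN.
Qed.

Lemma cvg_Im u l : ccvg u l -> Im (u k) @[k --> \oo] --> Im l.
Proof.
move=> /cvg_ncP H; apply/subr_cvg0/(cvg_squeeze0 _ H) => k.
by apply: le_trans (Im_le_nc _); rewrite ImD ImN.
Qed.

Lemma cvg_nc u l : ccvg u l -> nc (u k) @[k --> \oo] --> nc l.
Proof.
move=> /cvg_ncP H; apply/subr_cvg0/(cvg_squeeze0 _ H) => k.
rewrite ler_norml ler_ncB andbT lerNl opprB.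
by rewrite ncBC ler_ncB.
Qed.

Lemma cvg_ReIm u l : Re (u k) @[k --> \oo] --> Re l ->
  Im (u k) @[k --> \oo] --> Im l -> ccvg u l.
Proof.
move=> hr hi; apply/cvg_ncP.
apply: (@cvg_squeeze0 _ (fun k => `|Re (u k) - Re l| + `|Im (u k) - Im l|)) => [k|].
  rewrite ger0_norm ?nc_ge0//; apply: le_trans (nc_le_ReIm _) _.
  by rewrite ReD ReN ImD ImN.
rewrite -(addr0 0); apply: cvgD; apply/norm_cvg0P/subr_cvg0 => //.
Qed.

Lemma cvg_RC (a : nat -> R) (b : R) : a @ \oo --> b ->
  ccvg (fun k => (a k)%:C) b%:C.
Proof. by move=> ab; apply: cvg_ReIm => //=; exact: cvg_cst. Qed.

End complex_sequences.

Section limit_theorems.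
Context (R : realType).
Notation MR := (measurableTypeR R).
Variable rho : probability MR R.

Lemma cvg_EFin_seq (a : nat -> R) (b : R) : a @ \oo --> b ->
  (a k)%:E @[k --> \oo] --> b%:E.
Proof. by move=> ab; apply: cvg_EFin => //; exact: nearW. Qed.

Lemma Rintegral_dominated_cvg (f_ : nat -> R -> R) (f g : R -> R) :
  (forall k, measurable_fun setT (f_ k : MR -> R)) ->
  (forall t, f_ k t @[k --> \oo] --> f t) ->
  (forall k t, `|f_ k t| <= g t) -> rint rho g ->
  (\int[rho]_t f_ k t) @[k --> \oo] --> \int[rho]_t f t.
Proof.
move=> mf cf fg gi.
have mlim : measurable_fun setT (f : MR -> R).
  by apply: (measurable_fun_cvg mf) => t _; exact: cf.
have c1 : {ae rho, forall t : MR, setT t -> (f_ k t)%:E @[k --> \oo] --> (f t)%:E}.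
  by apply: aeW => t _; exact: cvg_EFin_seq (cf t).
have c2 : {ae rho, forall (t : MR) k, setT t -> (`|(f_ k t)%:E| <= (g t)%:E)%E}.
  by apply: aeW => t k _; rewrite lee_fin.
have [fi _ H] := @dominated_convergence _ MR R rho setT measurableT
  (fun k t => (f_ k t)%:E) (fun t => (f t)%:E) (fun t => (g t)%:E)
  (fun k => (measurable_EFinP _ _).2 (mf k)) ((measurable_EFinP _ _).2 mlim)
  c1 gi c2.
have If : (\int[rho]_t (f t)%:E = (\int[rho]_t f t)%:E)%E.
  by rewrite /Rintegral fineK//; exact: integrable_fin_num.
by rewrite If in H; have /fine_cvgP[_] := H.
Qed.

(** Integrability of the limit belongs to the conclusion: this is how the moments of a root come to
    exist. *)
Lemma Rintegral_fatou (f_ : nat -> R -> R) (f : R -> R) (b : R) :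
  (forall k, rint rho (f_ k)) -> (forall k t, 0 <= f_ k t) ->
  (forall t, f_ k t @[k --> \oo] --> f t) ->
  (\int[rho]_t f_ k t) @[k --> \oo] --> b ->
  rint rho f /\ \int[rho]_t f t <= b.
Proof.
move=> fi f0 cf cb.
have mlim : measurable_fun setT (f : MR -> R).
  by apply: (measurable_fun_cvg (fun k => rint_measurable (fi k))) => t _; exact: cf.
have g0 t : 0 <= f t.
  by apply: (cvgr_to_ge (cf t)); apply: nearW => k; exact: f0.
have cE t : (f_ k t)%:E @[k --> \oo] --> (f t)%:E.
  by apply: cvg_EFin_seq; exact: cf.
have := @fatou _ MR R rho setT measurableT (fun k t => (f_ k t)%:E)
  (fun k => (measurable_EFinP _ _).2 (rint_measurable (fi k)))
  (fun k t _ => f0 k t).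
have -> : (\int[rho]_t limn_einf (fun k => (f_ k t)%:E) = \int[rho]_t (f t)%:E)%E.
  apply: eq_integral => t _; rewrite is_cvg_limn_einfE; last by apply/cvg_ex; exists (f t)%:E.
  exact/cvg_lim.
have cI : (\int[rho]_t (f_ k t)%:E)%E @[k --> \oo] --> b%:E.
  have E k : (\int[rho]_t (f_ k t)%:E = (\int[rho]_t f_ k t)%:E)%E.
    by rewrite /Rintegral fineK//; have := integrable_fin_num measurableT (fi k).
  by under eq_fun do rewrite E; exact: cvg_EFin_seq.
rewrite is_cvg_limn_einfE; last by apply/cvg_ex; exists b%:E.
rewrite (cvg_lim _ cI)// => H.
have fI : rint rho f.
  apply/integrableP; split; first exact: (measurable_EFinP _ _).2 mlim.
  rewrite (eq_integral (fun t : MR => (f t)%:E)) => [|t _]; last first.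
    by rewrite /= ger0_norm.
  exact: le_lt_trans H (ltey _).
split => //; rewrite -lee_fin; apply: le_trans H.
by rewrite /Rintegral fineK//; exact: integrable_fin_num.
Qed.

Lemma cint_dominated_cvg (f_ : nat -> R -> R[i]) (f : R -> R[i]) (g : R -> R) :
  (forall k, cmeas (f_ k)) -> (forall t, ccvg (f_ ^~ t) (f t)) ->
  (forall k t, nc (f_ k t) <= g t) -> rint rho g ->
  ccvg (fun k => cint rho (f_ k)) (cint rho f).
Proof.
move=> mf cf fg gi; apply: cvg_ReIm => /=.
  apply: (Rintegral_dominated_cvg (g := g)) => //.
  - by move=> k; exact: (mf k).1.
  - by move=> t; exact/cvg_Re.
  - by move=> k t; exact: le_trans (Re_le_nc _) _.
apply: (Rintegral_dominated_cvg (g := g)) => //.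
- by move=> k; exact: (mf k).2.
- by move=> t; exact/cvg_Im.
- by move=> k t; exact: le_trans (Im_le_nc _) _.
Qed.

End limit_theorems.

(** * Moments recovered from expansions of weighted resolvents *)

Section weighted_resolvents.
Context (R : realType).
Notation MR := (measurableTypeR R).
Variable rho : probability MR R.
Implicit Types (w : R -> R) (z : R[i]).

Definition wres w z (t : R) : R[i] := (w t)%:C * res z t.

Lemma cmeas_wres w z : measurable_fun setT (w : MR -> R) -> 0 < Im z -> cmeas (wres w z).
Proof. by move=> mw z0; apply: cmeasM; [exact: cmeas_R|exact: cmeas_res]. Qed.

Lemma cintegrable_wres w z : rint rho w -> 0 < Im z -> cintegrable rho (wres w z).
Proof.
move=> wi z0; apply: (@cintegrable_le _ _ _ (fun t => (Im z)^-1 * `|w t|)).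
- exact: cmeas_wres (rint_measurable wi) z0.
- by move=> t; rewrite ncM ncR mulrC ler_wpM2r// nc_res.
- by apply: rintZ; have := integrable_norm wi.
Qed.

Lemma cint_wres_shift w z : rint rho w -> 0 < Im z ->
  cint rho (wres (fun t => t * w t) z) =
  z * cint rho (wres w z) - (\int[rho]_t w t)%:C.
Proof.
move=> wi z0; rewrite -cintZ; last exact: cintegrable_wres.
rewrite -cint_R -cintB; [|exact/cintegrableZ/cintegrable_wres|exact: cintegrable_R].
apply: eq_cint => t; rewrite /wres rmorphM mulrAC mul_res//; ring.
Qed.

Lemma mul_res_cvg1 (om : nat -> R[i]) (C t : R) : (forall k, 0 < Im (om k)) ->
  (forall k, nc (om k) <= C * Im (om k)) ->
  (nc (om k))^-1 @[k --> \oo] --> (0 : R) ->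
  ccvg (fun k => om k * res (om k) t) 1.
Proof.
move=> om0 omC cv; apply/cvg_ncP.
apply: (@cvg_squeeze0 _ _ (fun k => C * `|t| * (nc (om k))^-1)) => [k|]; last first.
  by rewrite -(mulr0 (C * `|t|)); apply: cvgMr.
have n0 : 0 < nc (om k) by rewrite nc_gt0 Im_neq0.
rewrite ger0_norm ?nc_ge0// -mul_res// ncM ncR mulrAC mulrC ler_wpM2r//.
rewrite (le_trans (nc_res _ _))// ler_pdivlMr//.
by rewrite mulrC ler_pdivrMr.
Qed.

(** The sector condition bounds [|om / (om - t)|] by [C], so [C |w|] dominates. *)
Lemma cint_wres_cvg w (om : nat -> R[i]) (C : R) : rint rho w ->
  (forall k, 0 < Im (om k)) -> (forall k, nc (om k) <= C * Im (om k)) ->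
  (nc (om k))^-1 @[k --> \oo] --> (0 : R) ->
  ccvg (fun k => om k * cint rho (wres w (om k))) (\int[rho]_t w t)%:C.
Proof.
move=> wi om0 omC cv.
have E k : om k * cint rho (wres w (om k)) = cint rho (fun t => om k * wres w (om k) t).
  by rewrite cintZ//; exact: cintegrable_wres.
rewrite (funext E) -cint_R; apply: (cint_dominated_cvg (g := fun t => C * `|w t|)).
- move=> k; apply: cmeasM; first exact: cmeas_cst.
  exact: cmeas_wres (rint_measurable wi) (om0 k).
- move=> t; rewrite -[X in ccvg _ X]mulr1.
  have -> : (fun k => om k * wres w (om k) t) = (fun k => (w t)%:C * (om k * res (om k) t)).
    by apply/funext => k; rewrite /wres mulrCA.
  exact/ccvgZ/(@mul_res_cvg1 _ C).
- move=> k t; rewrite !ncM ncR mulrCA mulrC ler_wpM2r//.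
  rewrite (le_trans (ler_wpM2l (nc_ge0 _) (nc_res _ _)))//.
  by rewrite ler_pdivrMr.
- by apply: rintZ; have := integrable_norm wi.
Qed.

(** Isolates the remainder [B] of the expansion. The function [t^2 |z / (z - t)|^2] is the real part
    of [|z|^2 (u z / (z - t) + 1)], where [u = -1 + i Re z / Im z]. Both [u + 1] and the product of
    [u] with the conjugate of [z] have real part [0], which removes the contributions of [m] and
    [a]. *)
Lemma wres_tail_identity w z (N B : R[i]) (m a : R) : rint rho w -> 0 < Im z ->
  N = cint rho (wres w z) -> m = \int[rho]_t w t ->
  N * z ^+ 3 = m%:C * z ^+ 2 + a%:C * z + B ->
  rint rho (fun t => w t * t ^+ 2 * nc (z * res z t) ^+ 2) /\
  \int[rho]_t (w t * t ^+ 2 * nc (z * res z t) ^+ 2) =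
  Re (('i * z^* / (Im z)%:C - 2) * B * (z^* / z)).
Proof.
move=> wi z0 NE mE HN.
have zn0 : z != 0 by exact: Im_neq0.
have zC : z * z^* = (nc z ^+ 2)%:C.
  by rewrite nc_sq; case: (z) => x y; apply: complex_ext => /=; ring.
have iC : (Im z)%:C != 0 by rewrite eq_complex /= negb_and gt_eqF.
pose u : R[i] := 'i * z^* / (Im z)%:C - 2.
have uR : Re u = -1.
  have -> : u = 'i * z^* * ((Im z)^-1)%:C - (2 : R)%:C by rewrite /u fmorphV natC.
  by move: z0; case: (z) => x y /= y0; field; rewrite gt_eqF.
have uzR : Re (u * z^*) = 0.
  have -> : u = 'i * z^* * ((Im z)^-1)%:C - (2 : R)%:C by rewrite /u fmorphV natC.
  by move: z0; case: (z) => x y /= y0; field; rewrite gt_eqF.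
pose f t := (nc z ^+ 2)%:C * (u * z * wres w z t + (w t)%:C).
have fi : cintegrable rho f.
  apply/cintegrableZ/cintegrableD; last exact: cintegrable_R.
  exact/cintegrableZ/cintegrable_wres.
have fE t : w t * t ^+ 2 * nc (z * res z t) ^+ 2 = Re (f t).
  have n0 := sub_real_neq0 t z0.
  rewrite /f ReM ReR ImR mul0r subr0 ncM exprMn mulrCA; congr (_ * _).
  rewrite /wres ReD ReR.
  have -> : u * z * ((w t)%:C * res z t) = (w t)%:C * (u * z * res z t) by ring.
  rewrite ReM ReR ImR mul0r subr0 -[X in _ + X]mulr1 -mulrDr -[LHS]mulrA; congr (_ * _).
  have -> : u * z * res z t = ((nc z ^+ 2 / Im z)%:C * 'i - 2%:R * z) * res z t.
    have -> : (nc z ^+ 2 / Im z)%:C = z * z^* / (Im z)%:C.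
      by rewrite zC -fmorphV -rmorphM.
    by rewrite /u; field.
  rewrite /res ncV_sq nc_sq natC.
  rewrite nc_sq !ReImE ReV ImV !(ReD, ReN, ImD, ImN, ReR, ImR) !subr0.
  have d0 : (Re z - t) ^+ 2 + Im z ^+ 2 != 0.
    by rewrite gt_eqF// ltr_wpDl ?sqr_ge0// exprn_gt0.
  by field; rewrite d0 gt_eqF.
have -> : (fun t => w t * t ^+ 2 * nc (z * res z t) ^+ 2) = (Re \o f).
  by apply/funext => t; exact: fE.
split; first exact: fi.1.
have wzi := cintegrableZ (u * z) (cintegrable_wres wi z0).
have -> : \int[rho]_t (Re \o f) t = Re (cint rho f) by [].
have -> : cint rho f = (nc z ^+ 2)%:C * (u * z * N + m%:C).
  rewrite NE mE -cint_R -cintZ; last exact: cintegrable_wres.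
  rewrite -cintD//; last exact: cintegrable_R.
  by rewrite -cintZ//; apply/cintegrableD/cintegrable_R.
have -> : N = (m%:C * z ^+ 2 + a%:C * z + B) / z ^+ 3.
  by rewrite -HN mulfK// expf_neq0.
have -> : (nc z ^+ 2)%:C * (u * z * ((m%:C * z ^+ 2 + a%:C * z + B) / z ^+ 3) + m%:C) =
   (m * nc z ^+ 2)%:C * (u + 1) + a%:C * (u * z^*) + u * B * (z^* / z).
  have -> : (m * nc z ^+ 2)%:C = m%:C * (z * z^*) by rewrite zC -rmorphM.
  by rewrite -zC; field.
rewrite ReD ReD ReM ReR ImR mul0r subr0 ReD uR Re1 addNr mulr0 add0r.
by rewrite ReM ReR ImR mul0r subr0 uzR mulr0 add0r.
Qed.

(** A converse to expanding at infinity, as in Hamburger's theorem: the limit of the remainder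
    bounds a moment whose existence is not assumed. Fatou's lemma applies because the integrands of
    [wres_tail_identity] tend to [w t * t^2]. *)
Lemma weighted_moment_le w (om theta B : nat -> R[i]) (y : nat -> R) (C m a b : R) :
  rint rho w -> (forall t, 0 <= w t) -> m = \int[rho]_t w t ->
  (forall k, 0 < Im (om k)) -> (forall k, nc (om k) <= C * Im (om k)) ->
  (nc (om k))^-1 @[k --> \oo] --> (0 : R) ->
  (forall k, 0 < y k) -> (forall k, om k = (y k)%:C * theta k) ->
  ccvg theta 'i -> ccvg B b%:C ->
  (forall k, cint rho (wres w (om k)) * om k ^+ 3 =
     m%:C * om k ^+ 2 + a%:C * om k + B k) ->
  rint rho (fun t => w t * t ^+ 2) /\ \int[rho]_t (w t * t ^+ 2) <= b.
Proof.
move=> wi w0 mE om0 omC cv y0 omE ctheta cB HN.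
have th0 k : 0 < Im (theta k).
  by have := om0 k; rewrite omE ImM ReR ImR mul0r addr0 pmulr_rgt0.
have H k := wres_tail_identity wi (om0 k) erefl mE (HN k).
apply: (Rintegral_fatou (fun k => (H k).1)).
- by move=> k t; rewrite mulr_ge0 ?sqr_ge0// mulr_ge0 ?sqr_ge0.
- move=> t; rewrite -[X in _ --> X]mulr1; apply: cvgMr.
  have := cvg_nc (mul_res_cvg1 t om0 omC cv); rewrite nc1 => c1.
  under eq_fun do rewrite expr2.
  by rewrite -(mulr1 1); apply: cvgM.
(* The factors around [B] are homogeneous of degree [0] in [om], hence functions of [theta], which
   converges; at ['i] each of the two equals [-1]. *)
have E k : \int[rho]_t (w t * t ^+ 2 * nc (om k * res (om k) t) ^+ 2) =
    Re (('i * (theta k)^* * ((Im (theta k))^-1)%:C - 2) * B k * ((theta k)^* / theta k)).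
  rewrite (H k).2; congr Re.
  have yC : (y k)%:C != 0 by rewrite eq_complex /= negb_and gt_eqF.
  have iC : (Im (theta k))%:C != 0 by rewrite eq_complex /= negb_and gt_eqF.
  have tn0 : theta k != 0 by exact: Im_neq0.
  have -> : Im (om k) = y k * Im (theta k) by rewrite omE ImM ReR ImR mul0r addr0.
  have cE : (om k)^* = (y k)%:C * (theta k)^*.
    by rewrite omE; case: (theta k) => u v; apply: complex_ext => /=; ring.
  have -> : (y k * Im (theta k))%:C = (y k)%:C * (Im (theta k))%:C by exact: rmorphM.
  have -> : ((Im (theta k))^-1)%:C = (Im (theta k))%:C^-1 by exact: fmorphV.
  rewrite cE omE.
  by field; rewrite yC iC tn0.
under eq_fun do rewrite E.
have cconj : ccvg (fun k => (theta k)^*) (- 'i).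
  have cr := cvg_Re ctheta; have ci := cvg_Im ctheta.
  have E1 k' : Re (theta k')^* = Re (theta k') by case: (theta k').
  have E2 k' : Im (theta k')^* = - Im (theta k') by case: (theta k').
  apply: cvg_ReIm => /=.
    by under eq_fun do rewrite E1; rewrite oppr0.
  by under eq_fun do rewrite E2; exact: cvgN.
have cinv : ccvg (fun k => ((Im (theta k))^-1)%:C) (1^-1 : R)%:C.
  by apply: cvg_RC; apply: cvgV (oner_neq0 _) (cvg_Im ctheta).
have i0 : ('i : R[i]) != 0 by rewrite eq_complex /= negb_and oner_eq0 orbT.
have -> : b = Re (('i * (- 'i) * (1^-1 : R)%:C - 2) * b%:C * ((- 'i) / 'i) : R[i]).
  have -> : (- 'i) / 'i = -1 :> R[i] by rewrite mulNr mulfV.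
  have -> : 'i * (- 'i) = 1 :> R[i] by rewrite mulrN -[X in - X]expr2 sqr_i opprK.
  have -> : (1 * (1^-1 : R)%:C - 2 : R[i]) = - 1 by rewrite invr1 rmorph1; ring.
  by rewrite mulrN1 mulN1r opprK.
have cU := ccvgM (@ccvgZ _ ('i : R[i]) _ _ cconj) cinv.
have cW := ccvgM cconj (ccvgV i0 ctheta).
exact: cvg_Re (ccvgM (ccvgM (ccvgB cU (@ccvg_cst R 2)) cB) cW).
Qed.

End weighted_resolvents.

Section power_moments.
Context (R : realType).
Variable nu : probability (measurableTypeR R) R.

Definition pw (j : nat) (t : R) : R := t ^+ j.
Definition moment (j : nat) : R := \int[nu]_t pw j t.
Definition cmom (j : nat) (z : R[i]) : R[i] := cint nu (wres (pw j) z).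

Lemma measurable_pw j : measurable_fun setT (pw j : measurableTypeR R -> R).
Proof. by apply: measurable_funX; exact: measurable_id. Qed.

Lemma rint_pwW j k : (j <= k)%N -> rint nu (pw k) -> rint nu (pw j).
Proof.
move=> jk ki; apply: (@rint_le _ _ _ (fun t => 1 + `|pw k t|)).
- exact: measurable_pw.
- move=> t; rewrite /pw !normrX; have [t1|/ltW t1] := leP `|t| 1.
    by rewrite (@le_trans _ _ 1) ?exprn_ile1// lerDl exprn_ge0.
  by rewrite (@le_trans _ _ (`|t| ^+ k)) ?lerDr// ler_weXn2l.
- by apply: rintD; [exact: rint_cst|have := integrable_norm ki].
Qed.

Lemma rint_pw0 : rint nu (pw 0).
Proof. exact: (rint_cst nu 1). Qed.

Lemma moment0 : moment 0 = 1.
Proof. by have /(congr1 Re) := cint_cst nu 1. Qed.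

Lemma cmom0 z : cmom 0 z = cauchy_transform nu z.
Proof. by apply: eq_cint => t; rewrite /wres /pw expr0 mul1r. Qed.

Lemma cmomS j z : rint nu (pw j) -> 0 < Im z ->
  cmom j.+1 z = z * cmom j z - (moment j)%:C.
Proof.
move=> ji z0; rewrite -cint_wres_shift//; apply: eq_cint => t.
by rewrite /wres /pw exprS.
Qed.

Lemma nc_cmom2 z : rint nu (pw 2) -> 0 < Im z -> nc (cmom 2 z) <= moment 2 / Im z.
Proof.
move=> i2 z0; rewrite (le_trans (nc_cint (cintegrable_wres i2 z0)))//.
rewrite mulrC -RintegralZl//; apply: le_Rintegral => //.
- exact/rint_nc/cintegrable_wres.
- exact: rintZ.
- move=> t _; rewrite ncM ncR ger0_norm ?sqr_ge0// mulrC ler_wpM2r ?sqr_ge0//.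
  exact: nc_res.
Qed.

End power_moments.

Section free_root_moments.
Context (R : realType).
Variables (mu rho : probability (measurableTypeR R) R) (n : nat).
Hypothesis n1 : (1 < n)%N.
Hypothesis i4 : rint mu (pw 4).
Hypothesis mean0 : moment mu 1 = 0.
Hypothesis var1 : moment mu 2 = 1.
Hypothesis sub : forall z, 0 < Im z ->
  cauchy_transform rho (omega mu n z) = cauchy_transform mu z.

Let i1 : rint mu (pw 1). Proof. exact: rint_pwW i4. Qed.
Let i2 : rint mu (pw 2). Proof. exact: rint_pwW i4. Qed.
Let i3 : rint mu (pw 3). Proof. exact: rint_pwW i4. Qed.
Let m3 := moment mu 3.
Let m4 := moment mu 4.

(** Heights at least [2] give [|p k| <= 1 / y^2 <= 1 / 4], which keeps [g k] away from [0] and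
    [om k] in a fixed sector for all [k]. *)
Let yk (k : nat) : R := k.+2%:R.
Let z (k : nat) : R[i] := iy (yk k).
Let p k := z k * cauchy_transform mu (z k) - 1.
Let p1 k := z k ^+ 2 * p k.
Let c : R[i] := (n%:R - 1) / n%:R.
(** [g] is [z G] and [h] is the ratio [om / z]; both tend to [1], so [om] follows a curve asymptotic
    to the imaginary axis. *)
Let g k := 1 + p k.
Let h k := 1 - c * (p k / g k).
Let om k := omega mu n (z k).

Let y_gt0 k : 0 < yk k. Proof. by rewrite ltr0n. Qed.
Let z_gt0 k : 0 < Im (z k). Proof. exact: y_gt0. Qed.
Let z_neq0 k : z k != 0. Proof. exact: Im_neq0. Qed.
Let n_gt0 : (0 < n)%N. Proof. exact: ltnW. Qed.
Let nC : (n%:R : R[i]) != 0. Proof. by rewrite pnatr_eq0 -lt0n. Qed.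

Let pE k : p k = cmom mu 1 (z k).
Proof. by rewrite cmomS ?cmom0 ?moment0//; exact: rint_pw0. Qed.

Let cmom2E k : cmom mu 2 (z k) = z k * p k.
Proof. by rewrite cmomS// mean0 subr0 pE. Qed.

Let cmom4E k : cmom mu 4 (z k) = z k ^+ 3 * p k - z k - m3%:C.
Proof. by rewrite cmomS// cmomS// cmom2E var1 rmorph1; ring. Qed.

Let p1E k : p1 k = 1 + m3%:C * (z k)^-1 + (z k * cmom mu 4 (z k)) * ((z k)^-1 * (z k)^-1).
Proof. by rewrite cmom4E /p1; field. Qed.

Let p_small k : nc (p k) <= 1 / 4.
Proof.
have -> : p k = cmom mu 2 (z k) / z k by rewrite cmom2E mulrAC mulfV// mul1r.
have y2 : 2 <= yk k by rewrite /yk ler_nat.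
rewrite ncM ncV nc_iy gtr0_norm// ler_pdivrMr//.
have yI : (yk k)^-1 <= 2^-1 by rewrite lef_pV2 ?posrE.
rewrite (le_trans (nc_cmom2 i2 (z_gt0 k)))// var1.
rewrite -[Im (z k)]/(yk k) mul1r (le_trans yI)//.
by move: y2; lra.
Qed.

Let g_ge k : 3 / 4 <= nc (g k).
Proof.
have := ler_ncB (1 : R[i]) (- p k); rewrite opprK ncN nc1; apply: le_trans.
by have := p_small k; lra.
Qed.

Let g_neq0 k : g k != 0.
Proof. by rewrite -nc_gt0 (lt_le_trans _ (g_ge k)). Qed.

Let nc_c : nc c <= 1.
Proof.
rewrite /c omega_coefC ncR ger0_norm.
  by rewrite ler_pdivrMr ?ltr0n// mul1r gerBl.
by rewrite divr_ge0// subr_ge0 ler1n.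
Qed.

Let h_near k : nc (h k - 1) <= 1 / 3.
Proof.
rewrite /h addrAC subrr add0r ncN ncM [nc (p k / g k)]ncM ncV.
have g0 : 0 < nc (g k) by rewrite (lt_le_trans _ (g_ge k)).
rewrite (@le_trans _ _ (1 * (nc (p k) / nc (g k))))//.
  by rewrite ler_wpM2r ?divr_ge0 ?nc_ge0.
rewrite mul1r ler_pdivrMr//.
by have := p_small k; have := g_ge k; lra.
Qed.

Let omE k : om k = z k * h k.
Proof.
have GE : cauchy_transform mu (z k) = g k / z k by rewrite /g /p; field.
by rewrite /om /omega /F_transform GE /h -/c /g /c; field; rewrite nC z_neq0 g_neq0.
Qed.

Let om_gt0 k : 0 < Im (om k).
Proof. exact: Im_omega_gt0. Qed.

Let om_lower k : 2 / 3 * yk k <= Im (om k).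
Proof.
rewrite omE ImM /= mul0r add0r mulrC ler_wpM2l ?(ltW (y_gt0 k))//.
have := le_trans (Re_le_nc _) (h_near k); rewrite ReD ReN Re1 ler_norml => /andP[+ _].
by lra.
Qed.

Let om_sector k : nc (om k) <= 2 * Im (om k).
Proof.
apply: (@le_trans _ _ (2 * (2 / 3 * yk k))); last by rewrite ler_wpM2l.
rewrite omE ncM nc_iy gtr0_norm// mulrA mulrC ler_wpM2r ?(ltW (y_gt0 k))//.
have := ncD (h k - 1) 1; rewrite subrK nc1 => /le_trans; apply.
by have := h_near k; lra.
Qed.

Let yV_cvg : (yk k)^-1 @[k --> \oo] --> (0 : R).
Proof.
have := @cvg_harmonic R; rewrite -(cvg_shiftS (@harmonic R)); apply.
Qed.

Let zV_cvg : ccvg (fun k => (z k)^-1) 0.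
Proof.
apply/cvg_ncP; under eq_fun do rewrite subr0 ncV nc_iy gtr0_norm//.
exact: yV_cvg.
Qed.

Let omV_cvg : (nc (om k))^-1 @[k --> \oo] --> (0 : R).
Proof.
apply: (@cvg_squeeze0 _ _ (fun k => 3 / 2 * (yk k)^-1)) => [k|]; last first.
  by rewrite -(mulr0 (3 / 2)); apply: cvgMr.
rewrite ger0_norm ?invr_ge0 ?nc_ge0//.
have -> : 3 / 2 * (yk k)^-1 = (2 / 3 * yk k)^-1 by rewrite invfM invf_div.
rewrite lef_pV2 ?posrE ?nc_gt0 ?Im_neq0//; last by rewrite mulr_gt0.
rewrite (le_trans (om_lower k))// (le_trans _ (Im_le_nc _))//.
exact: ler_norm.
Qed.

Let e4_cvg : ccvg (fun k => z k * cmom mu 4 (z k)) m4%:C.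
Proof.
apply: (@cint_wres_cvg _ mu (pw 4) z 1) => //.
- by move=> k; rewrite nc_iy gtr0_norm// mul1r.
- by under eq_fun do rewrite nc_iy gtr0_norm//.
Qed.

Let p1_cvg : ccvg p1 1.
Proof.
rewrite (funext p1E) -[X in ccvg _ X](_ : 1 + m3%:C * 0 + m4%:C * (0 * 0) = 1).
  apply: ccvgD; last exact/(ccvgM e4_cvg)/(ccvgM zV_cvg zV_cvg).
  exact: (ccvgD (@ccvg_cst R 1) (@ccvgZ _ m3%:C _ _ zV_cvg)).
by rewrite !mulr0 !addr0.
Qed.

Let p_cvg : ccvg p 0.
Proof.
have -> : p = fun k => p1 k * ((z k)^-1 * (z k)^-1).
  by apply/funext => k; rewrite /p1; field.
rewrite -[X in ccvg _ X](_ : 1 * (0 * 0) = 0); last by rewrite !mulr0.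
exact/(ccvgM p1_cvg)/(ccvgM zV_cvg zV_cvg).
Qed.

Let g_cvg : ccvg g 1.
Proof. by have := ccvgD (@ccvg_cst R 1) p_cvg; rewrite addr0. Qed.

Let h_cvg : ccvg h 1.
Proof.
have := ccvgB (@ccvg_cst R 1) (@ccvgZ _ c _ _ (ccvgM p_cvg (ccvgV (oner_neq0 _) g_cvg))).
by rewrite mul0r mulr0 subr0.
Qed.

Let theta_cvg : ccvg (fun k => 'i * h k) 'i.
Proof. by have := @ccvgZ _ ('i : R[i]) _ _ h_cvg; rewrite mulr1. Qed.

Let om_theta k : om k = (yk k)%:C * ('i * h k).
Proof.
rewrite omE mulrA; congr (_ * _); apply: complex_ext; rewrite !ReImE /=; ring.
Qed.

(** Because [F G = 1], the product is [(n - 1) / n + z G / n]: passing to the root divides [p] by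
    [n]. *)
Let omG k : om k * cauchy_transform rho (om k) = 1 + p k / n%:R.
Proof.
rewrite sub// omE.
have GE : cauchy_transform mu (z k) = g k / z k by rewrite /g /p; field.
by rewrite GE /h /g /c; field; rewrite nC z_neq0 g_neq0.
Qed.

Let rmom1 k : cmom rho 1 (om k) = p k / n%:R.
Proof.
rewrite cmomS//; last exact: rint_pw0.
by rewrite cmom0 moment0 rmorph1 omG addrAC subrr add0r.
Qed.

Let hp_cvg : ccvg (fun k => om k ^+ 2 * (p k / n%:R)) n%:R^-1.
Proof.
have -> : (fun k => om k ^+ 2 * (p k / n%:R)) = (fun k => n%:R^-1 * (h k * h k * p1 k)).
  by apply/funext => k; rewrite omE /p1; ring.
by have := @ccvgZ _ (n%:R^-1) _ _ (ccvgM (ccvgM h_cvg h_cvg) p1_cvg); rewrite !mulr1.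
Qed.

(** Unit weight and [a = 0]: the remainder [om^2 p / n] tends to [1 / n], since [z^2 p] tends to the
    variance of [mu]. *)
Let rho_i2 : rint rho (pw 2).
Proof.
have w0 (t : R) : 0 <= pw 0 t by exact: ler01.
have cB : ccvg (fun k => om k ^+ 2 * (p k / n%:R)) (n%:R^-1 : R)%:C.
  by rewrite -inv_natC; exact: hp_cvg.
have HN k : cint rho (wres (pw 0) (om k)) * om k ^+ 3 =
    (1 : R)%:C * om k ^+ 2 + (0 : R)%:C * om k + om k ^+ 2 * (p k / n%:R).
  rewrite -/(cmom rho 0 (om k)) cmom0 rmorph0 mul0r addr0 rmorph1 mul1r.
  have -> : p k / n%:R = om k * cauchy_transform rho (om k) - 1 by rewrite omG addrAC subrr add0r.
  by ring.
have [+ _] := weighted_moment_le (rint_pw0 rho) w0 (esym (moment0 rho)) om_gt0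
  om_sector omV_cvg y_gt0 om_theta theta_cvg cB HN.
by congr (rint rho _); apply/funext => t; rewrite /pw expr0 mul1r.
Qed.

Lemma free_root_mean : moment rho 1 = 0.
Proof.
have r1 : rint rho (pw 1) by exact: rint_pwW rho_i2.
have c1 := cint_wres_cvg r1 om_gt0 om_sector omV_cvg.
have c2 : ccvg (fun k => om k * cint rho (wres (pw 1) (om k))) 0.
  have -> : (fun k => om k * cint rho (wres (pw 1) (om k))) =
      (fun k => n%:R^-1 * (h k * p1 k * (z k)^-1)).
    apply/funext => k; rewrite -/(cmom rho 1 (om k)) rmom1 omE /p1.
    by field; rewrite nC z_neq0.
  have := @ccvgZ _ (n%:R^-1) _ _ (ccvgM (ccvgM h_cvg p1_cvg) zV_cvg).
  by rewrite !mulr0.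
by have /(congr1 Re) := ccvg_unique c1 c2.
Qed.

Let rmom2 k : cmom rho 2 (om k) = om k * (p k / n%:R).
Proof.
rewrite cmomS//; last exact: rint_pwW rho_i2.
by rewrite free_root_mean subr0 rmom1.
Qed.

Lemma free_root_variance : moment rho 2 = n%:R^-1.
Proof.
have c1 := cint_wres_cvg rho_i2 om_gt0 om_sector omV_cvg.
have c2 : ccvg (fun k => om k * cint rho (wres (pw 2) (om k))) n%:R^-1.
  have -> : (fun k => om k * cint rho (wres (pw 2) (om k))) =
      (fun k => om k ^+ 2 * (p k / n%:R)).
    by apply/funext => k; rewrite -/(cmom rho 2 (om k)) rmom2; ring.
  exact: hp_cvg.
by have := ccvg_unique c1 c2; rewrite inv_natC => /(congr1 Re).
Qed.

(** In free cumulants: the fourth one of [rho] is [(m4 - 2) / n], and the fourth moment adds twice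
    the squared variance [1 / n^2]. Only the inequality is derived, with weight [t^2]. *)
Lemma free_root_fourth_moment :
  rint rho (pw 4) /\ n%:R * moment rho 4 <= m4 - 2 + 2 / n%:R.
Proof.
(* The remainder after the terms in [om^2] and [om]. The part carrying [c] comes from expanding in
   [om = z h] instead of [z]; it tends to [- 2 c = - 2 + 2 / n]. *)
pose B k := n%:R^-1 * (z k * cmom mu 4 (z k) * (h k ^+ 4)
  - c * (p1 k / g k) * (h k ^+ 2 * (h k + 1) + m3%:C * (z k)^-1 * (h k * (h k ^+ 2 + h k + 1)))).
pose b := n%:R^-1 * (m4 - 2 + 2 / n%:R).
have h2_cvg : ccvg (fun k => h k ^+ 2) 1.
  by have := ccvgM h_cvg h_cvg; rewrite mulr1.
have h4_cvg : ccvg (fun k => h k ^+ 4) 1.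
  have := ccvgM h2_cvg h2_cvg; rewrite mulr1.
  by congr ccvg; apply/funext => k; ring.
have cB : ccvg B b%:C.
  have h1_cvg := ccvgD h_cvg (@ccvg_cst R 1).
  have k1 := ccvgM h2_cvg h1_cvg.
  have k2 := ccvgM (@ccvgZ _ m3%:C _ _ zV_cvg) (ccvgM h_cvg (ccvgD (ccvgD h2_cvg h_cvg) (@ccvg_cst R 1))).
  have k3 := @ccvgZ _ c _ _ (ccvgM p1_cvg (ccvgV (oner_neq0 _) g_cvg)).
  have := @ccvgZ _ (n%:R^-1) _ _ (ccvgB (ccvgM e4_cvg h4_cvg) (ccvgM k3 (ccvgD k1 k2))).
  rewrite (_ : n%:R^-1 * _ = b%:C)//.
  have nR : (n%:R : R) != 0 by rewrite pnatr_eq0 -lt0n.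
  rewrite /b /c omega_coefC inv_natC invr1; apply: complex_ext; rewrite !ReImE; last by ring.
  by field.
have w0 (t : R) : 0 <= pw 2 t by exact: sqr_ge0.
have HN k : cint rho (wres (pw 2) (om k)) * om k ^+ 3 =
    (n%:R^-1 : R)%:C * om k ^+ 2 + (n%:R^-1 * m3)%:C * om k + B k.
  rewrite -/(cmom rho 2 (om k)) rmom2 rmorphM -inv_natC.
  have pp : p k = (1 + m3%:C * (z k)^-1 + (z k * cmom mu 4 (z k)) *
      ((z k)^-1 * (z k)^-1)) * ((z k)^-1 * (z k)^-1).
    by rewrite -p1E /p1; field.
  have p1g : c * (p1 k / g k) = z k ^+ 2 * (1 - h k).
    by rewrite /h /p1; field.
  rewrite /B p1g omE pp; field; rewrite nC z_neq0//.
have [+ +] := weighted_moment_le rho_i2 w0 (esym free_root_variance) om_gt0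
  om_sector omV_cvg y_gt0 om_theta theta_cvg cB HN.
have E (t : R) : pw 2 t * t ^+ 2 = pw 4 t by rewrite /pw -exprD.
rewrite (funext E) => i4' H; split => //.
by rewrite -ler_pdivlMl ?ltr0n.
Qed.

End free_root_moments.

(** * The limit of free roots *)

Section free_root_bounds.
Context (R : realType).
Variables (mu rho : probability (measurableTypeR R) R) (n : nat) (z : R[i]).
Hypothesis n1 : (1 < n)%N.
Hypothesis z0 : 0 < Im z.
Hypothesis sub : cauchy_transform rho (omega mu n z) = cauchy_transform mu z.
Hypothesis i4 : rint rho (pw 4).
Hypothesis mean0 : moment rho 1 = 0.
Hypothesis var : moment rho 2 = n%:R^-1.

Let i1 : rint rho (pw 1). Proof. exact: rint_pwW i4. Qed.
Let i2 : rint rho (pw 2). Proof. exact: rint_pwW i4. Qed.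
Let n0 : (0 < n)%N. Proof. exact: ltnW. Qed.
Let nC : (n%:R : R[i]) != 0. Proof. by rewrite pnatr_eq0 -lt0n. Qed.
Let nR : 0 < (n%:R : R). Proof. by rewrite ltr0n. Qed.
Let n1R : 0 < (n%:R - 1 : R). Proof. by rewrite subr_gt0 ltr1n. Qed.
Let G := cauchy_transform mu z.
Let p := z * G - 1.
Let om := omega mu n z.
Let om0 : 0 < Im om. Proof. exact: Im_omega_gt0. Qed.
Let Gn0 : G != 0. Proof. exact: cauchy_neq0. Qed.

Let omG : om * G = 1 + p / n%:R.
Proof. by rewrite /om /omega /F_transform -/G /p; field; rewrite nC Gn0. Qed.

Let r1 : cmom rho 1 om = p / n%:R.
Proof.
rewrite cmomS//; last exact: rint_pw0.
by rewrite cmom0 moment0 rmorph1 sub omG addrAC subrr add0r.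
Qed.

Let r2 : cmom rho 2 om = om * p / n%:R.
Proof. by rewrite cmomS// mean0 subr0 r1 mulrA. Qed.

Let r3 : cmom rho 3 om = (om ^+ 2 * p - 1) / n%:R.
Proof. by rewrite cmomS// var r2 -inv_natC; field. Qed.

(** Estimated naively this costs [(Im om)^-2]; [spread_le] bounds it by a quantity that tends to [1]
    as [n] grows at fixed [z]. *)
Definition spread : R := n%:R * \int[rho]_t (t ^+ 2 * nc (res om t) ^+ 2).

Let spreadi : rint rho (fun t => t ^+ 2 * nc (res om t) ^+ 2).
Proof.
have h := cintegrable_mul_res rho om0.
apply: (@rint_le _ _ _ (fun t => (Im om)^-1 ^+ 2 * pw 2 t)); last exact: rintZ.
  have := cmeas_nc (cintegrable_cmeas h) => /(measurable_funX 2).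
  congr measurable_fun; apply/funext => t /=.
  by rewrite ncM exprMn ncR real_normK ?num_real.
move=> t; rewrite /pw.
have h0 : 0 <= t ^+ 2 * nc (res om t) ^+ 2 by apply: mulr_ge0; exact: sqr_ge0.
rewrite (ger0_norm h0) [leLHS]mulrC ler_wpM2r ?sqr_ge0//.
by apply: lerXn2r; rewrite ?nnegrE ?nc_ge0 ?nc_res// invr_ge0 ltW.
Qed.

(** The integrand is [|om / (om - t) - 1|^2]. Its leading term is computed from
    [Im G = - Im F |G|^2], and [Im F <= n / (n - 1) * Im om] makes it at most
    [n / (n - 1) * |om G|^2]. The other terms nearly cancel this and leave a quantity of order
    [1 / n], which the factor [n] keeps bounded. *)
Lemma spread_le : spread <= nc p ^+ 2 / n%:R +
  n%:R / (n%:R - 1) * nc (1 + p / n%:R) ^+ 2.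
Proof.
have E : \int[rho]_t (t ^+ 2 * nc (res om t) ^+ 2) =
    nc om ^+ 2 * \int[rho]_t nc (res om t) ^+ 2 - 2 * Re (om * G) + 1.
  have ci := cintegrable_res rho om0.
  have -> : 2 * Re (om * G) = \int[rho]_t (2 * Re (om * res om t)).
    rewrite RintegralZl//; last exact: (cintegrableZ om ci).1.
    by rewrite /G -sub cauchy_transformE -cintZ.
  have e1 : \int[rho]_t (1 : R) = 1 by exact: moment0 rho.
  rewrite -{}[X in _ + X]e1 -RintegralZl//; last exact: rint_res2.
  have ri : rint rho (fun t => 2 * Re (om * res om t)).
    exact/rintZ/(cintegrableZ om ci).1.
  have ri2 : rint rho (fun t => nc om ^+ 2 * nc (res om t) ^+ 2).
    exact/rintZ/rint_res2.
  have ri3 : rint rho (fun t => nc om ^+ 2 * nc (res om t) ^+ 2 - 2 * Re (om * res om t)).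
    by have := rintD ri2 (rintZ (-1) ri); congr (rint rho _);
      apply/funext => t; rewrite mulN1r.
  rewrite -RintegralB// -RintegralD//; last exact: (rint_cst rho 1).
  apply: eq_Rintegral => t _.
  have -> : t ^+ 2 * nc (res om t) ^+ 2 = nc (om * res om t - 1) ^+ 2.
    by rewrite -mul_res// ncM exprMn ncR real_normK ?num_real.
  rewrite -exprMn -ncM !nc_sq ReD ImD ReN ImN Re1 Im1; ring.
have GI : \int[rho]_t nc (res om t) ^+ 2 = - Im G / Im om.
  by rewrite /G -sub cauchy_Im// opprK mulrC mulKf// gt_eqF.
have FI : - Im G <= n%:R / (n%:R - 1) * Im om * nc G ^+ 2.
  have -> : - Im G = Im (F_transform mu z) * nc G ^+ 2.
    by rewrite /F_transform -/G ImV -nc_sq mulNr mulfVK// expf_neq0// gt_eqF// nc_gt0.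
  rewrite ler_wpM2r ?sqr_ge0// Im_omega -ler_pdivrMl ?divr_gt0// invf_div.
  by rewrite lerDl mulr_ge0 ?invr_ge0 ?ler0n// ltW.
have sE : nc om ^+ 2 * (- Im G / Im om) <= n%:R / (n%:R - 1) * nc (1 + p / n%:R) ^+ 2.
  rewrite -omG ncM exprMn mulrA ler_pdivrMr//.
  rewrite (le_trans (ler_wpM2l (sqr_ge0 _) FI))//.
  by rewrite le_eqVlt; apply/orP; left; apply/eqP; ring.
rewrite /spread E GI omG.
set X := _ * (- Im G / _) in sE *.
have -> : X - 2 * Re (1 + p / n%:R) + 1 =
    X - nc (1 + p / n%:R) ^+ 2 + nc (p / n%:R) ^+ 2.
  by rewrite !nc_sq ReD ImD Re1 Im1; ring.
have -> : nc (p / n%:R) ^+ 2 = nc p ^+ 2 / n%:R ^+ 2.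
  by rewrite ncM inv_natC ncR exprMn real_normK ?num_real// exprVn.
set Y := nc (1 + _) ^+ 2 in sE *.
rewrite mulrDr addrC; apply: lerD.
  have -> // : n%:R * (nc p ^+ 2 / n%:R ^+ 2) = nc p ^+ 2 / n%:R.
  by field; rewrite gt_eqF.
rewrite (@le_trans _ _ (n%:R * (n%:R / (n%:R - 1) * Y - Y)))//.
  by rewrite ler_pM2l// lerD2r.
have -> : n%:R * (n%:R / (n%:R - 1) * Y - Y) = n%:R / (n%:R - 1) * Y.
  by field; rewrite gt_eqF.
by [].
Qed.

(** [om p] is [n] times the integral of [t^2 / (om - t)]. With [r = |om - t|^-1], use
    [2 t^2 r <= t^2 + t^2 r^2]; the variance contributes the [1]. *)
Lemma nc_omp_le : nc (om * p) <= (1 + spread) / 2.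
Proof.
have -> : om * p = n%:R * cmom rho 2 om by rewrite r2; field.
rewrite ncM natC ncR gtr0_norm//.
have -> : (1 + spread) / 2 = n%:R * (2^-1 * (moment rho 2 +
    \int[rho]_t (t ^+ 2 * nc (res om t) ^+ 2))).
  by rewrite var /spread; field; rewrite gt_eqF.
rewrite ler_pM2l// (le_trans (nc_cint (cintegrable_wres i2 om0)))//.
rewrite -RintegralD// -RintegralZl//; last exact: rintD.
apply: le_Rintegral => //.
- exact: rint_nc (cintegrable_wres i2 om0).
- by apply: rintZ; apply: rintD.
move=> t _; rewrite ncM ncR /pw ger0_norm ?sqr_ge0//.
set r := nc _.
have : 0 <= t ^+ 2 * (1 - r) ^+ 2 by apply: mulr_ge0; exact: sqr_ge0.
have -> : t ^+ 2 * (1 - r) ^+ 2 = t ^+ 2 + t ^+ 2 * r ^+ 2 - 2 * (t ^+ 2 * r) by ring.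
by lra.
Qed.

(** The weight [l] stays free so that the fourth moment and the spread can be balanced later, with
    [l = e^-1]. *)
Lemma nc_om2p_le (l : R) : 0 < l ->
  nc (om ^+ 2 * p - 1) <= (l * (n%:R * moment rho 4) + spread / l) / 2.
Proof.
move=> l0.
have -> : om ^+ 2 * p - 1 = n%:R * cmom rho 3 om by rewrite r3; field.
rewrite ncM natC ncR gtr0_norm//.
have -> : (l * (n%:R * moment rho 4) + spread / l) / 2 =
    n%:R * (2^-1 * (l * moment rho 4 +
    l^-1 * \int[rho]_t (t ^+ 2 * nc (res om t) ^+ 2))).
  by rewrite /spread; field; rewrite gt_eqF.
have i3 : rint rho (pw 3) by exact: rint_pwW i4.
rewrite ler_pM2l// (le_trans (nc_cint (cintegrable_wres i3 om0)))//.
rewrite -!RintegralZl// -RintegralD//; [|exact: rintZ..].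
rewrite -RintegralZl//; last by apply: rintD; exact: rintZ.
apply: le_Rintegral => //.
- exact: rint_nc (cintegrable_wres i3 om0).
- by apply: rintZ; apply: rintD; exact: rintZ.
move=> t _; rewrite ncM ncR /pw.
set r := nc _.
(* AM-GM: [2 |t|^3 r <= l t^4 + t^2 r^2 / l] *)
have : 0 <= l^-1 * (l * t ^+ 2 - `|t| * r) ^+ 2.
  by rewrite mulr_ge0 ?sqr_ge0// invr_ge0 ltW.
have -> : l^-1 * (l * t ^+ 2 - `|t| * r) ^+ 2 =
   l * t ^+ 4 + l^-1 * (`|t| ^+ 2 * r ^+ 2) - 2 * (`|t| * t ^+ 2 * r).
  by field; rewrite gt_eqF.
rewrite real_normK ?num_real// normrX.
have -> : `|t| ^+ 3 = `|t| * t ^+ 2 by rewrite exprS real_normK ?num_real.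
by lra.
Qed.

End free_root_bounds.

Section reciprocal_cauchy_bounds.
Context (R : realType).
Variable mu : probability (measurableTypeR R) R.
Hypothesis i4 : rint mu (pw 4).
Hypothesis mean0 : moment mu 1 = 0.
Hypothesis var1 : moment mu 2 = 1.
Hypothesis infdiv : free_infinitely_divisible mu.
Variable z : R[i].
Hypothesis z0 : 0 < Im z.

Let G := cauchy_transform mu z.
Let F := F_transform mu z.
Let p := z * G - 1.
Let nn (k : nat) : R := k.+2%:R.
Let om k := omega mu k.+2 z.
Let q k := nc p ^+ 2 / nn k + nn k / (nn k - 1) * nc (1 + p / k.+2%:R) ^+ 2.

Let bounds k : nc (om k * p) <= (1 + q k) / 2 /\
  forall l, 0 < l -> nc (om k ^+ 2 * p - 1) <=
    (l * (moment mu 4 - 2 + 2 / nn k) + q k / l) / 2.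
Proof.
have [rho Hrho] := infdiv (n := k.+2) isT.
have n1 : (1 < k.+2)%N by [].
have sub w := free_root_subordination (z := w) n1 Hrho.
have rm := free_root_mean n1 i4 mean0 var1 sub.
have rv := free_root_variance n1 i4 mean0 var1 sub.
have [r4 rm4] := free_root_fourth_moment n1 i4 mean0 var1 sub.
have sl := spread_le n1 z0 (sub z z0).
split; first by have := nc_omp_le n1 z0 (sub z z0) r4 rm rv; move: sl; rewrite -/(q k); lra.
move=> l l0; have := nc_om2p_le n1 z0 (sub z z0) r4 rm rv l0.
move=> /le_trans; apply; rewrite ler_pM2r//; apply: lerD.
  by rewrite ler_pM2l.
by rewrite ler_pM2r ?invr_gt0.
Qed.

Let nV_cvg : (nn k)^-1 @[k --> \oo] --> (0 : R).
Proof. by have := @cvg_harmonic R; rewrite -(cvg_shiftS (@harmonic R)); apply. Qed.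

Let nVC_cvg : ccvg (fun k => (k.+2%:R : R[i])^-1) 0.
Proof.
by have := cvg_RC nV_cvg; congr ccvg; apply/funext => k; rewrite inv_natC.
Qed.

Let pn_cvg : ccvg (fun k => 1 + p / k.+2%:R) 1.
Proof. by have := ccvgD (@ccvg_cst R 1) (@ccvgZ _ p _ _ nVC_cvg); rewrite mulr0 addr0. Qed.

Let Gn0 : G != 0. Proof. exact: cauchy_neq0. Qed.

Let om_cvg : ccvg om F.
Proof.
have -> : om = fun k => F * (1 + p / k.+2%:R).
  apply/funext => k; rewrite /om /omega -/F /p /F /F_transform -/G.
  have : (k.+2%:R : R[i]) != 0 by rewrite pnatr_eq0.
  by move: (k.+2%:R) => N N0; field; rewrite Gn0 N0.
by have := @ccvgZ _ F _ _ pn_cvg; rewrite mulr1.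
Qed.

Let q_cvg : q @ \oo --> (1 : R).
Proof.
have c1 : (1 - (nn k)^-1) @[k --> \oo] --> (1 : R).
  by rewrite -[X in _ --> X](subr0 1); apply: cvgB => //; exact: cvg_cst.
have c2 : (1 - (nn k)^-1)^-1 @[k --> \oo] --> (1^-1 : R).
  exact: cvgV (oner_neq0 _) c1.
have := cvg_nc pn_cvg; rewrite nc1 => c3.
have c4 : (nc p ^+ 2 * (nn k)^-1) @[k --> \oo] --> nc p ^+ 2 * 0 by apply: cvgMr.
have c6 : (nc (1 + p / k.+2%:R) * nc (1 + p / k.+2%:R)) @[k --> \oo] --> (1 * 1 : R).
  exact: (cvgM c3 c3).
have c5 : (nc p ^+ 2 * (nn k)^-1 + (1 - (nn k)^-1)^-1 *
    (nc (1 + p / k.+2%:R) * nc (1 + p / k.+2%:R))) @[k --> \oo] --> (1 : R).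
  have e1 : 1 = nc p ^+ 2 * 0 + 1^-1 * (1 * 1) by rewrite mulr0 invr1 !mulr1 add0r.
  by rewrite [X in _ --> X]e1; apply: cvgD c4 _; apply: cvgM c2 c6.
apply: cvg_trans c5; apply: near_eq_cvg; apply: nearW => k /=.
rewrite /q expr2; congr (_ + _ * _).
have n0 : nn k != 0 by rewrite pnatr_eq0.
have n10 : nn k - 1 != 0 by rewrite gt_eqF// subr_gt0 ltr1n.
by move: (nn k) n0 n10 => N N0 N1; field; rewrite N0 N1.
Qed.

(** [z - F = F p] is the limit of [om p], and the bound [(1 + q) / 2] tends to [1]. *)
Lemma reciprocal_cauchy_dist_le1 : nc (z - F) <= 1.
Proof.
have c1 := cvg_nc (ccvgM om_cvg (@ccvg_cst R p)).
have -> : z - F = F * p by rewrite /p /F /F_transform -/G; field.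
have c2 : ((1 + q k) / 2) @[k --> \oo] --> ((1 + 1) / 2 : R).
  by apply: cvgMl; apply: cvgD => //; exact: cvg_cst.
have H : nc (F * p) <= (1 + 1) / 2.
  by apply: (ler_cvg_to c1 c2); apply: nearW => k; exact: (bounds k).1.
by rewrite (le_trans H)//; lra.
Qed.

(** The defect is [(F^2 p - 1) G], whence the factor [|G|]. For [l = e^-1] the two terms being
    averaged are each at most [e] in the limit. *)
Lemma semicircle_equation_defect e : 0 < e -> moment mu 4 - 2 <= e ^+ 2 ->
  nc (z - F - G) <= e * nc G.
Proof.
move=> e0 me; have eV : 0 < e^-1 by rewrite invr_gt0.
have c1 := cvg_nc (ccvgB (ccvgM (ccvgM om_cvg om_cvg) (@ccvg_cst R p)) (@ccvg_cst R 1)).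
have c2 : ((e^-1 * (moment mu 4 - 2 + 2 * (nn k)^-1) + q k * e) / 2) @[k --> \oo]
    --> ((e^-1 * (moment mu 4 - 2 + 2 * 0) + 1 * e) / 2 : R).
  apply: cvgMl; apply: cvgD; last by apply: cvgMl.
  by apply: cvgMr; apply: cvgD; [exact: cvg_cst|exact: cvgMr].
have H : nc (F * F * p - 1) <= (e^-1 * (moment mu 4 - 2 + 2 * 0) + 1 * e) / 2.
  apply: (ler_cvg_to c1 c2); apply: nearW => k.
  by have := (bounds k).2 _ eV; rewrite invrK expr2.
have -> : z - F - G = (F * F * p - 1) * G.
  by rewrite /p /F /F_transform -/G; field.
rewrite ncM ler_wpM2r ?nc_ge0// (le_trans H)//.
have : e^-1 * (moment mu 4 - 2) <= e by rewrite ler_pdivrMl// -expr2.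
by rewrite mulr0 addr0; lra.
Qed.

End reciprocal_cauchy_bounds.

(** * Perturbation of the semicircle equation *)

Section semicircle_perturbation.
Context (R : realType).
Implicit Types (z G : R[i]) (e u : R).

(** The distance between the two roots of [X^2 - u X + 1]. *)
Definition edge u : R := Num.sqrt `|u ^+ 2 - 4|.

(** [s] is the boundary value of the semicircle Cauchy transform and [t] the other root of
    [X^2 - u X + 1]. A point [G] of the lower half of the unit disc is far from [t]: for [|u| <= 2]
    because [Im t = edge u / 2], otherwise because [|t| >= 1 + edge u / 2]. *)
Lemma semicircle_roots u : exists s t : R[i],
  [/\ s + t = u%:C, s * t = 1, nc s <= 1, Im s = - (Num.sqrt (4 - u ^+ 2) / 2) &
      forall G, Im G < 0 -> nc G <= 1 -> edge u / 2 <= nc (G - t)].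
Proof.
have [u2|u2] := leP (u ^+ 2) 4.
  have dE : edge u = Num.sqrt (4 - u ^+ 2).
    by rewrite /edge distrC ger0_norm// subr_ge0.
  have d2 : edge u ^+ 2 = 4 - u ^+ 2 by rewrite dE sqr_sqrtr// subr_ge0.
  have st : nc ((u / 2) +i* (- (edge u / 2))) ^+ 2 = 1.
    by rewrite nc_sq /= sqrrN !exprMn d2; field.
  exists ((u / 2) +i* (- (edge u / 2))), ((u / 2) +i* (edge u / 2)); split.
  - by apply: complex_ext => /=; [field|rewrite addNr].
  - by apply: complex_ext => /=; [field: d2|ring].
  - by rewrite -(ler_pXn2r (n:=2))// ?nnegrE ?nc_ge0// st expr1n.
  - by rewrite dE.
  - move=> G G0 _; rewrite (le_trans _ (Im_le_nc _))// ImD ImN /= ler_normr.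
    by apply/orP; right; move: G0; lra.
have d2 : edge u ^+ 2 = u ^+ 2 - 4 by rewrite sqr_sqrtr// gtr0_norm// subr_gt0.
have d0 : 0 <= edge u by exact: sqrtr_ge0.
have sq0 : Num.sqrt (4 - u ^+ 2) = 0 by apply: ler0_sqrtr; rewrite subr_le0 ltW.
suff [s [t [h1 h2 h3 h4]]] : exists s t : R,
    [/\ s + t = u, s * t = 1, `|s| <= 1 & 1 + edge u / 2 <= `|t|].
  exists s%:C, t%:C; split; rewrite ?sq0 ?mul0r ?oppr0 ?ncR//.
  - by rewrite -rmorphD h1.
  - by rewrite -rmorphM h2.
  - move=> G _ G1; have := ler_ncB t%:C G; rewrite ncR ncBC; apply: le_trans.
    by move: h4 G1; lra.
have [u0|u0] := leP 0 u.
  have u2' : 2 < u by nra.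
  exists ((u - edge u) / 2), ((u + edge u) / 2); split; first by field.
  - by have : (u - edge u) * (u + edge u) = 4; [rewrite -subr_sqr d2; ring|lra].
  - by rewrite ler_norml; nra.
  - by rewrite (le_trans _ (ler_norm _))//; lra.
have u2' : u < -2 by nra.
exists ((u + edge u) / 2), ((u - edge u) / 2); split; first by field.
- by have : (u - edge u) * (u + edge u) = 4; [rewrite -subr_sqr d2; ring|lra].
- by rewrite ler_norml; nra.
- by rewrite -normrN (le_trans _ (ler_norm _))//; lra.
Qed.

Variables (z G : R[i]) (e : R).
Hypothesis e0 : 0 < e.
Hypothesis e1 : e <= 1 / 2.
Hypothesis ze3 : 3 * e <= Im z.
Hypothesis ze6 : Im z <= 6 * e.
Hypothesis G0 : Im G < 0.
Hypothesis zF : nc (z - G^-1) <= 1.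
Hypothesis zFG : nc (z - G^-1 - G) <= e * nc G.

Let Gn0 : G != 0. Proof. by apply: contraTneq G0 => ->; rewrite ltxx. Qed.

(** If [|G| > 1], then [Im (- G^-1 - G) >= 0], so the defect has imaginary part at least
    [Im z >= 3 e], while its modulus is at most [e |G| <= 2 e]. This fixes the lowest admissible
    height. *)
Lemma perturbed_nc_le1 : nc G <= 1.
Proof.
have h2 : nc G <= 2.
  have : nc G <= nc (z - G^-1) + nc (z - G^-1 - G).
    by rewrite -[X in nc X <= _](subKr (z - G^-1)) ncB.
  move=> /le_trans/(_ (lerD zF zFG)); move: e1 (nc_ge0 G); nra.
rewrite leNgt; apply/negP => h.
have := le_trans (Im_le_nc _) zFG; rewrite ler_norml => /andP[_].
rewrite !(ImD, ImN) ImV -nc_sq opprK.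
have hI : nc G ^+ 2 > 1 by rewrite exprn_egt1.
have : Im G <= Im G / nc G ^+ 2.
  by rewrite ler_pdivlMr ?(lt_trans _ hI)//; move: G0 hI; nra.
have : e * nc G <= e * 2 by rewrite ler_pM2l.
by move: ze3 e0; lra.
Qed.

Lemma semicircle_perturbation : exists X,
  [/\ `|- Im G - Num.sqrt (4 - Re z ^+ 2) / 2| <= X, 0 <= X, X <= 2 &
      X * edge (Re z) <= 14 * e * nc G].
Proof.
have G1 := perturbed_nc_le1; set u := Re z.
have [s [t [h1 h2 h3 h4 h5]]] := semicircle_roots u.
exists (nc (G - s)); split.
- rewrite (le_trans _ (Im_le_nc _))// ImD ImN h4 opprK -normrN.
  by rewrite le_eqVlt; apply/orP; left; apply/eqP; congr `|_|; ring.
- exact: nc_ge0.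
- by rewrite (le_trans (ncB _ _))//; move: h3 G1; lra.
have E : (G - s) * (G - t) = G * (z - u%:C - (z - G^-1 - G)).
  have -> : (G - s) * (G - t) = G * G - (s + t) * G + s * t by ring.
  by rewrite h1 h2 -(mulfV Gn0); ring.
(* [|z - u| = Im z] gives [6 e], and the defect adds [e |G| <= e]. *)
have H : nc (G - s) * nc (G - t) <= 7 * e * nc G.
  rewrite -ncM E ncM mulrC ler_wpM2r ?nc_ge0// (le_trans (ncB _ _))//.
  have -> : nc (z - u%:C) = Im z.
    have -> : z - u%:C = (0 +i* Im z) by apply: complex_ext; rewrite !ReImE /= /u; ring.
    by rewrite /= expr0n add0r sqrtr_sqr ger0_norm// (le_trans _ ze3)// mulr_ge0// ltW.
  have : e * nc G <= e * 1 by rewrite ler_pM2l.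
  by move: ze6 zFG; lra.
have := h5 _ G0 G1 => h.
have : nc (G - s) * (edge u / 2) <= nc (G - s) * nc (G - t).
  by rewrite ler_wpM2l ?nc_ge0.
by move: H; lra.
Qed.

(** [14 e / edge u] blows up at [2] and [-2]. Adding [X e <= 2 e] gives [X (edge u + e) <= 16 e],
    and [edge u + e] dominates a root regularised by [e^2]. On each half-line, one factor of
    [u^2 - 4] has modulus at least [1]. *)
Lemma perturbation_center : exists X,
  [/\ `|- Im G - Num.sqrt (4 - Re z ^+ 2) / 2| <= X &
      (0 <= Re z -> X <= 16 * e / Num.sqrt (`|Re z - 2| + e ^+ 2)) /\
      (Re z <= 0 -> X <= 16 * e / Num.sqrt (`|Re z + 2| + e ^+ 2))].
Proof.
have [X [h1 X0 X2 h2]] := semicircle_perturbation; exists X; split => //.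
have G1 := perturbed_nc_le1.
have Xd : X * edge (Re z) <= 14 * e.
  by rewrite (le_trans h2)// ler_piMr// mulr_ge0// ltW.
have key a : 0 <= a -> a <= `|Re z ^+ 2 - 4| -> X <= 16 * e / Num.sqrt (a + e ^+ 2).
  move=> a0 aD; have ae : 0 < a + e ^+ 2 by rewrite ltr_wpDl// exprn_gt0.
  rewrite ler_pdivlMr ?sqrtr_gt0//.
  have sE : Num.sqrt (a + e ^+ 2) <= edge (Re z) + e.
    rewrite -(ler_pXn2r (n:=2))// ?nnegrE ?sqrtr_ge0 ?addr_ge0 ?sqrtr_ge0 ?(ltW e0)//.
    rewrite sqr_sqrtr ?(ltW ae)// sqrrD sqr_sqrtr//.
    have : 0 <= edge (Re z) * e by rewrite mulr_ge0 ?sqrtr_ge0 ?(ltW e0).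
    by move: aD; lra.
  rewrite (le_trans (ler_wpM2l X0 sE))// mulrDr.
  have : X * e <= 2 * e by rewrite ler_pM2r.
  by move: Xd; lra.
have DE : `|Re z ^+ 2 - 4| = `|Re z - 2| * `|Re z + 2|.
  by rewrite -normrM; congr `|_|; ring.
split=> u0; apply: key => //; rewrite DE.
  by rewrite ler_peMr// ger0_norm; move: u0; lra.
by rewrite ler_peMl// ler0_norm; move: u0; lra.
Qed.

(** Here [|z - G^-1| <= 1] gives [|G| <= 2 / |u|], and [edge u >= |u| / 2]. So [X u^2 <= 56 e], and
    [u^2 >= 9] yields [X <= 7 e]; [63] is the sum. *)
Lemma perturbation_tail : 3 <= `|Re z| ->
  `|- Im G - Num.sqrt (4 - Re z ^+ 2) / 2| <= 63 * e / (1 + Re z ^+ 2).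
Proof.
move=> u3; have [X [h1 X0 X2 h2]] := semicircle_perturbation.
apply: (le_trans h1); set u := Re z in u3 h2 *.
have u2E : u ^+ 2 = `|u| ^+ 2 by rewrite real_normK ?num_real.
have un : 0 < `|u| by move: u3; lra.
have eu : `|u| / 2 <= edge u.
  rewrite -(ler_pXn2r (n:=2))// ?nnegrE ?sqrtr_ge0 ?divr_ge0//.
  rewrite sqr_sqrtr// u2E; have u4 : 0 <= `|u| ^+ 2 - 4 by move: u3; nra.
  by rewrite (ger0_norm u4); move: u3; nra.
have Gu : nc G * `|u| <= 2.
  have hF : `|u| - 1 <= nc G^-1.
    have := ler_ncB z (z - G^-1); rewrite subKr; apply: le_trans.
    by apply: lerB => //; exact: Re_le_nc.
  have nG : 0 < nc G by rewrite nc_gt0.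
  have {}hF : (`|u| - 1) * nc G <= 1 by rewrite -ler_pdivlMr// div1r -ncV.
  by move: hF u3 nG; nra.
have step : X * u ^+ 2 <= 56 * e.
  rewrite u2E.
  have s1 : X * (`|u| / 2) <= 14 * e * nc G by rewrite (le_trans _ h2)// ler_wpM2l.
  have s2 : X * (`|u| / 2) * `|u| <= 14 * e * nc G * `|u| by rewrite ler_pM2r.
  have s3 : 14 * e * (nc G * `|u|) <= 14 * e * 2 by rewrite ler_pM2l// mulr_gt0.
  by move: s2 s3; lra.
rewrite ler_pdivlMr ?ltr_wpDr ?sqr_ge0// mulrDr mulr1.
have : X * 9 <= X * u ^+ 2 by rewrite ler_wpM2l// u2E; move: u3; nra.
by move: step; lra.
Qed.

End semicircle_perturbation.

(** * Explicit integrals and the bound in [L^1] *)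

Section lebesgue_bounds.
Context (R : realType).
Notation MR := (measurableTypeR R).
Notation leb := (@lebesgue_measure R).
Implicit Types (a b c e : R).

Lemma ge0_integral_setU_le (A B : set MR) (f : MR -> \bar R) :
  measurable A -> measurable B -> measurable_fun setT f -> (forall x, 0 <= f x)%E ->
  (\int[leb]_(x in A `|` B) f x <=
   \int[leb]_(x in A) f x + \int[leb]_(x in B) f x)%E.
Proof.
move=> mA mB mf f0; have mBA := measurableD mB mA.
have -> : A `|` B = A `|` (B `\` A) by rewrite setDE setUIr setUv setIT.
rewrite ge0_integral_setU//.
- rewrite leeD2l//; apply: ge0_subset_integral => //; first exact: measurable_funTS.
- exact: measurable_funTS.
- by rewrite disj_set2E setDE setIC -setIA setICl setI0.
Qed.

Lemma derivable_oo_LRcontinuous_is_derive (F f : R -> R) a b :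
  (forall x : R, a <= x <= b -> is_derive x 1 F (f x)) -> a < b ->
  derivable_oo_LRcontinuous F a b.
Proof.
move=> dF ab; have cF (x : R) : a <= x <= b -> {for x, continuous F}.
  move=> /dF dx; apply/differentiable_continuous/derivable1_diffP.
  by have [] := dx.
split=> [x xab||].
- have /andP[x1 x2] : a < x < b by rewrite in_itv/= in xab.
  by have [] := dF x; rewrite ?ltW.
- by apply/cvg_at_right_filter/cF; rewrite lexx ltW.
- by apply/cvg_at_left_filter/cF; rewrite lexx ltW.
Qed.

Lemma integral_inv_sqrtD a b c : a < b -> 0 < c + a ->
  (\int[leb]_(u in `[a, b]) ((Num.sqrt (c + u))^-1)%:E =
   (2 * Num.sqrt (c + b) - 2 * Num.sqrt (c + a))%:E)%E.
Proof.
move=> ab ca; pose F (u : R) := 2 * Num.sqrt (c + u).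
have pos u : a <= u -> 0 < c + u by move: ca; lra.
have dF (u : R) : a <= u <= b -> is_derive u 1 F (Num.sqrt (c + u))^-1.
  move=> /andP[/pos u0 _].
  have d1 : is_derive u 1 (fun u : R => c + u) (0 + 1) by exact: is_deriveD.
  have d2 := is_derive1_sqrt u0.
  have d3 := @is_derive1_comp _ Num.sqrt (fun u => c + u) u _ _ d2 d1.
  have d4 := @is_deriveZ _ _ _ (fun u => Num.sqrt (c + u)) 2 u 1 _ d3.
  apply: is_derive_eq d4 _; rewrite /GRing.scale/= add0r mulr1 invfM mulrA.
  by rewrite mulfV ?mul1r.
rewrite (@continuous_FTC2 _ _ F)//.
- apply: continuous_in_subspaceT => u; rewrite inE/= in_itv/= => /andP[/pos u0 _].
  apply: (@continuousV R R (fun u : R => Num.sqrt (c + u))).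
    by rewrite gt_eqF// sqrtr_gt0.
  apply: (@continuous_comp _ _ _ (fun u => c + u) Num.sqrt).
    by apply: continuousD; [exact: cst_continuous|exact: cvg_id].
  exact: sqrt_continuous.
- exact: derivable_oo_LRcontinuous_is_derive dF ab.
- move=> u; rewrite in_itv/= => /andP[u1 u2].
  by rewrite derive1E; apply: derive_val; apply: dF; rewrite !ltW.
Qed.

Lemma integral_inv_sqrtB a b c : a < b -> 0 < c - b ->
  (\int[leb]_(u in `[a, b]) ((Num.sqrt (c - u))^-1)%:E =
   (2 * Num.sqrt (c - a) - 2 * Num.sqrt (c - b))%:E)%E.
Proof.
move=> ab ca; pose F (u : R) := - 2 * Num.sqrt (c - u).
have pos u : u <= b -> 0 < c - u by move: ca; lra.
have dF (u : R) : a <= u <= b -> is_derive u 1 F (Num.sqrt (c - u))^-1.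
  move=> /andP[_ /pos u0].
  have d1 : is_derive u 1 (fun u : R => c - u) (0 - 1) by exact: is_deriveB.
  have d2 := is_derive1_sqrt u0.
  have d3 := @is_derive1_comp _ Num.sqrt (fun u => c - u) u _ _ d2 d1.
  have d4 := @is_deriveZ _ _ _ (fun u => Num.sqrt (c - u)) (- 2) u 1 _ d3.
  apply: is_derive_eq d4 _; rewrite /GRing.scale/= sub0r invfM.
  by field; rewrite gt_eqF// sqrtr_gt0.
rewrite (@continuous_FTC2 _ _ F)//.
- by rewrite /F -EFinB; congr EFin; ring.
- apply: continuous_in_subspaceT => u; rewrite inE/= in_itv/= => /andP[_ /pos u0].
  apply: (@continuousV R R (fun u : R => Num.sqrt (c - u))).
    by rewrite gt_eqF// sqrtr_gt0.
  apply: (@continuous_comp _ _ _ (fun u => c - u) Num.sqrt).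
    by apply: continuousB; [exact: cst_continuous|exact: cvg_id].
  exact: sqrt_continuous.
- exact: derivable_oo_LRcontinuous_is_derive dF ab.
- move=> u; rewrite in_itv/= => /andP[u1 u2].
  by rewrite derive1E; apply: derive_val; apply: dF; rewrite !ltW.
Qed.

Lemma integralT_oneDsqr : (\int[leb]_x ((1 + x ^+ 2)^-1)%:E = (pi : R)%:E)%E.
Proof.
rewrite (@ge0_symfun_integralT _ (fun x => (1 + x ^+ 2)^-1)).
- rewrite (_ : [set x | _] = `[0, +oo[%classic); last first.
    by apply/seteqP; split => x/=; rewrite in_itv/= andbT.
  have := @integral0y_oneDsqr R; rewrite /oneDsqr => ->.
  by rewrite -EFinM mulrCA mulfV// mulr1.
- by move=> x; rewrite invr_ge0 addr_ge0// sqr_ge0.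
- exact: (@continuous_oneDsqrV R).
- by move=> x /=; rewrite sqrrN.
Qed.

Lemma pi_le4 : pi <= 4 :> R.
Proof. by have := @pihalf_lt2 R; lra. Qed.

(** [508 = 252 + 4 * 64]. The tails cost [63 pi <= 252]. Each of the four intervals cut at [-2],
    [0], [2] inside [[-3, 3]] costs [16 * 4], the primitive being twice a square root that is at
    most [2]; the [e^2] keeps these integrals proper. *)
Lemma L1_bound (E : R -> R) e : 0 < e -> e <= 1 / 2 ->
  measurable_fun setT (E : MR -> R) -> (forall u, 0 <= E u) ->
  (forall u, 0 <= u -> E u <= 16 * e / Num.sqrt (`|u - 2| + e ^+ 2)) ->
  (forall u, u <= 0 -> E u <= 16 * e / Num.sqrt (`|u + 2| + e ^+ 2)) ->
  (forall u, 3 <= `|u| -> E u <= 63 * e / (1 + u ^+ 2)) ->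
  (\int[leb]_u (E u)%:E <= (508 * e)%:E)%E.
Proof.
move=> e0 e1 mE E0 Hp Hn Ht.
have mEE : measurable_fun setT (fun u : MR => (E u)%:E) by exact/measurable_EFinP.
have E0E (u : MR) : (0 <= (E u)%:E)%E by rewrite lee_fin.
have e2 : 0 < e ^+ 2 by rewrite exprn_gt0.
have e21 : e ^+ 2 <= 1 by move: e0 e1; nra.
have s2 (x : R) : x <= 4 -> Num.sqrt x <= 2.
  have -> : 2 = Num.sqrt 4 :> R.
    by rewrite (_ : 4 = 2 ^+ 2) ?sqrtr_sqr ?ger0_norm//; ring.
  exact: ler_wsqrtr.
have piece (I : set MR) (g : R -> R) (s : R) : measurable I ->
    measurable_fun I (fun u : MR => (g u)%:E) ->
    (forall u, I u -> E u <= 16 * e * g u) -> (forall u, I u -> 0 <= g u) ->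
    (\int[leb]_(u in I) (g u)%:E = s%:E)%E -> s <= 4 ->
    (\int[leb]_(u in I) (E u)%:E <= (64 * e)%:E)%E.
  move=> mI mg EI g0 gs s4.
  apply: (@le_trans _ _ (\int[leb]_(u in I) ((16 * e)%:E * (g u)%:E))%E).
    apply: ge0_le_integral => //.
    - exact: measurable_funTS.
    - exact: measurable_funeM.
  rewrite ge0_integralZl//; last by rewrite lee_fin mulr_ge0// ltW.
  by rewrite gs -EFinM lee_fin; move: s4 e0; nra.
have m_inv_sqrt (h : R -> R) : continuous h ->
    measurable_fun setT (fun u : MR => ((Num.sqrt (h u))^-1)%:E).
  move=> ch; apply/measurable_EFinP.
  rewrite (_ : (fun _ => _) = (fun x : R => x `^ (-1)) \o (Num.sqrt \o h)); last first.
    by apply/funext => u /=; rewrite powR_inv1// sqrtr_ge0.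
  apply: measurableT_comp; first exact: measurable_powR.
  apply: continuous_measurable_fun => u.
  by apply: continuous_comp; [exact: ch|exact: sqrt_continuous].
have cD c : continuous (fun u : R => c + u).
  by move=> u; apply: continuousD; [exact: cst_continuous|exact: cvg_id].
have cB c : continuous (fun u : R => c - u).
  by move=> u; apply: continuousB; [exact: cst_continuous|exact: cvg_id].
pose T : set MR := [set u | 3 <= `|u|].
have mT : measurable T.
  have := @measurable_fun_ler _ MR R setT (cst 3) (fun t : R => `|t|).
  move=> /(_ _ _ measurableT [set true]) h.
  have : measurable (setT `&` (fun t : MR => cst 3 t <= `|t|) @^-1` [set true]).
    by apply: h => //; exact: measurableT_comp.
  by rewrite setTI.
have co : continuous (fun u : R => (1 + u ^+ 2)^-1) by exact: (@continuous_oneDsqrV R).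
have mo : measurable_fun setT (fun u : MR => ((1 + u ^+ 2)^-1)%:E).
  by apply/measurable_EFinP; exact: continuous_measurable_fun co.
have iT : (\int[leb]_(u in T) (E u)%:E <= (252 * e)%:E)%E.
  apply: (@le_trans _ _ (\int[leb]_u ((63 * e)%:E * ((1 + u ^+ 2)^-1)%:E))%E); last first.
    rewrite ge0_integralZl//.
    - rewrite integralT_oneDsqr -EFinM lee_fin.
      by move: pi_le4 e0; nra.
    - by move=> u _; rewrite lee_fin invr_ge0 addr_ge0// sqr_ge0.
    - by rewrite lee_fin mulr_ge0// ltW.
  have mg : measurable_fun setT (fun u : MR => ((63 * e)%:E * ((1 + u ^+ 2)^-1)%:E)%E).
    apply: measurable_funeM.
    exact: mo.
  have g0 (u : MR) : (0 <= (63 * e)%:E * ((1 + u ^+ 2)^-1)%:E)%E.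
    by rewrite -EFinM lee_fin divr_ge0 ?mulr_ge0 ?(ltW e0)// addr_ge0// sqr_ge0.
  apply: (@le_trans _ _ (\int[leb]_(u in T) ((63 * e)%:E * ((1 + u ^+ 2)^-1)%:E))%E).
    by apply: ge0_le_integral => //; exact: measurable_funTS.
  exact: ge0_subset_integral.
have i1 : (\int[leb]_(u in `[(- 3)%R, (- 2)%R]) (E u)%:E <= (64 * e)%:E)%E.
  have I := @integral_inv_sqrtB (- 3) (- 2) (- 2 + e ^+ 2).
  apply: (piece _ (fun u => (Num.sqrt ((- 2 + e ^+ 2) - u))^-1) _ (measurable_itv _) _ _ _ (I _ _)).
  - by apply: measurable_funTS; exact: m_inv_sqrt.
  - move=> u; rewrite /= in_itv/= => /andP[u1 u2].
    have -> : (- 2 + e ^+ 2) - u = `|u + 2| + e ^+ 2.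
      by rewrite ler0_norm; [ring|move: u1 u2; lra].
    by apply: Hn; move: u1 u2; lra.
  - by move=> u _; rewrite invr_ge0 sqrtr_ge0.
  - by lra.
  - by move: e2; lra.
  - have h1 : Num.sqrt ((- 2 + e ^+ 2) - (- 3)) <= 2 by apply: s2; move: e21; lra.
    by have := sqrtr_ge0 ((- 2 + e ^+ 2) - (- 2)); move: h1; lra.
have i2 : (\int[leb]_(u in `[(- 2)%R, 0%R]) (E u)%:E <= (64 * e)%:E)%E.
  have I := @integral_inv_sqrtD (- 2) 0 (2 + e ^+ 2).
  apply: (piece _ (fun u => (Num.sqrt ((2 + e ^+ 2) + u))^-1) _ (measurable_itv _) _ _ _ (I _ _)).
  - by apply: measurable_funTS; exact: m_inv_sqrt.
  - move=> u; rewrite /= in_itv/= => /andP[u1 u2].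
    have -> : (2 + e ^+ 2) + u = `|u + 2| + e ^+ 2.
      by rewrite ger0_norm; [ring|move: u1 u2; lra].
    by apply: Hn; move: u1 u2; lra.
  - by move=> u _; rewrite invr_ge0 sqrtr_ge0.
  - by lra.
  - by move: e2; lra.
  - have h1 : Num.sqrt ((2 + e ^+ 2) + 0) <= 2 by apply: s2; move: e21; lra.
    by have := sqrtr_ge0 ((2 + e ^+ 2) + (- 2)); move: h1; lra.
have i3 : (\int[leb]_(u in `[0%R, 2%R]) (E u)%:E <= (64 * e)%:E)%E.
  have I := @integral_inv_sqrtB 0 2 (2 + e ^+ 2).
  apply: (piece _ (fun u => (Num.sqrt ((2 + e ^+ 2) - u))^-1) _ (measurable_itv _) _ _ _ (I _ _)).
  - by apply: measurable_funTS; exact: m_inv_sqrt.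
  - move=> u; rewrite /= in_itv/= => /andP[u1 u2].
    have -> : (2 + e ^+ 2) - u = `|u - 2| + e ^+ 2.
      by rewrite ler0_norm; [ring|move: u1 u2; lra].
    by apply: Hp; move: u1 u2; lra.
  - by move=> u _; rewrite invr_ge0 sqrtr_ge0.
  - by lra.
  - by move: e2; lra.
  - have h1 : Num.sqrt ((2 + e ^+ 2) - 0) <= 2 by apply: s2; move: e21; lra.
    by have := sqrtr_ge0 ((2 + e ^+ 2) - 2); move: h1; lra.
have i4 : (\int[leb]_(u in `[2%R, 3%R]) (E u)%:E <= (64 * e)%:E)%E.
  have I := @integral_inv_sqrtD 2 3 (- 2 + e ^+ 2).
  apply: (piece _ (fun u => (Num.sqrt ((- 2 + e ^+ 2) + u))^-1) _ (measurable_itv _) _ _ _ (I _ _)).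
  - by apply: measurable_funTS; exact: m_inv_sqrt.
  - move=> u; rewrite /= in_itv/= => /andP[u1 u2].
    have -> : (- 2 + e ^+ 2) + u = `|u - 2| + e ^+ 2.
      by rewrite ger0_norm; [ring|move: u1 u2; lra].
    by apply: Hp; move: u1 u2; lra.
  - by move=> u _; rewrite invr_ge0 sqrtr_ge0.
  - by lra.
  - by move: e2; lra.
  - have h1 : Num.sqrt ((- 2 + e ^+ 2) + 3) <= 2 by apply: s2; move: e21; lra.
    by have := sqrtr_ge0 ((- 2 + e ^+ 2) + 2); move: h1; lra.
have cover : (setT : set MR) = T `|` (`[(- 3)%R, (- 2)%R]%classic `|`
    (`[(- 2)%R, 0%R]%classic `|` (`[0%R, 2%R]%classic `|` `[2%R, 3%R]%classic))).
  apply/seteqP; split => // u _; rewrite /T /= !in_itv/=.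
  have [|/ltr_normlP[u1 u2]] := leP 3 `|u|; first by left.
  right; have [|h1] := leP u (- 2); first by left; move: u1; lra.
  right; have [|h2] := leP u 0; first by left; rewrite ltW.
  right; have [|h3] := leP u 2; first by left; rewrite ltW.
  by right; rewrite !ltW.
rewrite cover.
have mI (a b : R) : measurable (`[a, b]%classic : set MR) by exact: measurable_itv.
apply: (le_trans (ge0_integral_setU_le mT _ mEE E0E)).
  by do 3? apply: measurableU.
have -> : ((508 * e)%:E = (252 * e)%:E + ((64 * e)%:E + ((64 * e)%:E + ((64 * e)%:E + (64 * e)%:E))))%E.
  by rewrite -!EFinD; congr EFin; lra.
apply: leeD => //; apply: (le_trans (ge0_integral_setU_le _ _ mEE E0E)) => //.
  by do 2? apply: measurableU.
apply: leeD => //; apply: (le_trans (ge0_integral_setU_le _ _ mEE E0E)) => //.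
  by apply: measurableU.
apply: leeD => //; apply: (le_trans (ge0_integral_setU_le _ _ mEE E0E)) => //.
exact: leeD.
Qed.

End lebesgue_bounds.

(** * Smoothing *)

Section poisson_kernel.
Context (R : realType).
Notation MR := (measurableTypeR R).
Notation leb := (@lebesgue_measure R).
Implicit Types (v w t u x y : R).

(** The normalising factor [1 / pi] is left out; it reappears as [pi] in front of the measures of
    half-lines. *)
Definition poisson v w : R := v / (w ^+ 2 + v ^+ 2).

Lemma poisson_ge0 v w : 0 < v -> 0 <= poisson v w.
Proof. by move=> v0; rewrite divr_ge0 ?addr_ge0 ?sqr_ge0 ?ltW. Qed.

Lemma is_derive_atan_affine v t u : 0 < v ->
  is_derive u 1 (fun u : R => atan ((u - t) / v)) (poisson v (u - t)).
Proof.
move=> v0.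
have d1 : is_derive u 1 (fun u : R => u - t) (1 - 0).
  exact: (is_deriveB (is_derive_id u 1) (is_derive_cst t u 1)).
have d2 : is_derive u 1 (fun u : R => (u - t) / v) (v^-1 * (1 - 0)).
  have -> : (fun u : R => (u - t) / v) = (fun u : R => v^-1 *: (u - t)).
    by apply/funext => s; rewrite /GRing.scale/= mulrC.
  exact: is_deriveZ.
have d3 := @is_derive1_comp _ (@atan R) (fun u : R => (u - t) / v) u _ _ (is_derive1_atan _) d2.
apply: is_derive_eq d3 _; rewrite /poisson.
have h : (u - t) ^+ 2 + v ^+ 2 != 0 by rewrite gt_eqF// ltr_wpDl ?sqr_ge0 ?exprn_gt0.
by rewrite /GRing.scale/=; field; rewrite h gt_eqF.
Qed.

Lemma cvg_atan_affine v t : 0 < v ->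
  atan ((u - t) / v) @[u --> +oo] --> pi / 2.
Proof.
move=> v0; apply: (@cvg_comp _ _ _ (fun u => (u - t) / v) (@atan R) _ +oo%R).
  apply/cvgryPge => A; near=> u.
  rewrite ler_pdivlMr// lerBrDr; near: u; apply: nbhs_pinfty_ge; exact: num_real.
exact: cvgy_atan.
Unshelve. all: by end_near. Qed.

Lemma continuous_poisson v t : 0 < v -> continuous (fun u : R => poisson v (u - t)).
Proof.
move=> v0 u; apply: (@continuousM R R (fun=> v) (fun u : R => ((u - t) ^+ 2 + v ^+ 2)^-1)); first exact: cst_continuous.
apply: (@continuousV R R (fun u : R => (u - t) ^+ 2 + v ^+ 2)).
  by rewrite gt_eqF// ltr_wpDl ?sqr_ge0 ?exprn_gt0.
apply: continuousD; last exact: cst_continuous.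
apply: (@continuous_comp _ _ _ (fun u => u - t) (fun x => x ^+ 2)).
  by apply: continuousB; [exact: cvg_id|exact: cst_continuous].
exact: exprn_continuous.
Qed.

Lemma integral_poisson_tail v t x : 0 < v ->
  (\int[leb]_(u in `[x, +oo[) (poisson v (u - t))%:E =
   (pi / 2 - atan ((x - t) / v))%:E)%E.
Proof.
move=> v0; have D (u : R) := @is_derive_atan_affine v t u v0.
rewrite (ge0_continuous_FTC2y _ _ (@cvg_atan_affine v t v0))//.
- by move=> u _; exact: poisson_ge0.
- by apply: continuous_subspaceT; exact: continuous_poisson.
- apply: cvg_at_right_filter; apply/differentiable_continuous/derivable1_diffP.
  by have [] := D x.
- by move=> u _; rewrite derive1E; apply: derive_val; exact: D.
Qed.

(* The kernel [2 P_v - P_{2v}] is nonnegative and decays like [w^-4], unlike the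
   Poisson kernel itself; [smooth_tail] is pi times its integrated tail, for v = 1. *)
Definition smooth_tail y : R := pi / 2 - 2 * atan y + atan (y / 2).

Lemma smooth_tailN y : smooth_tail (- y) = pi - smooth_tail y.
Proof. by rewrite /smooth_tail mulNr !atanN; lra. Qed.

(** The integrand is [2 / (1 + u^2) - 2 / (4 + u^2)], that is [2 P_1 - P_2]. *)
Lemma smooth_tailE y : (smooth_tail y)%:E =
  (\int[leb]_(u in `[y, +oo[) (6 / ((1 + u ^+ 2) * (4 + u ^+ 2)))%:E)%E.
Proof.
pose F (u : R) := 2 * atan ((u - 0) / 1) - atan ((u - 0) / 2).
have p1 (u : R) : 1 + u ^+ 2 != 0 by rewrite gt_eqF// ltr_pwDl ?sqr_ge0.
have p4 (u : R) : 4 + u ^+ 2 != 0 by rewrite gt_eqF// ltr_pwDl ?sqr_ge0.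
have D (u : R) : is_derive u 1 F (6 / ((1 + u ^+ 2) * (4 + u ^+ 2))).
  have d1 := @is_derive_atan_affine 1 0 u ltr01.
  have d2 := @is_derive_atan_affine 2 0 u (ltr0n R 2).
  have d3 := @is_deriveZ _ _ _ (fun u : R => atan ((u - 0) / 1)) 2 u 1 _ d1.
  have d4 := @is_deriveB _ _ _ _ _ _ _ _ _ d3 d2.
  apply: is_derive_eq d4 _; rewrite /GRing.scale/= /poisson !subr0 expr1n.
  have q1 : u ^+ 2 + 1 != 0 by rewrite addrC.
  have q2 : u ^+ 2 + 2 ^+ 2 != 0 by rewrite addrC -natrX.
  by field; rewrite ?p1 ?p4 ?q1 ?q2.
have cF : F u @[u --> +oo] --> (2 * (pi / 2) - pi / 2 : R).
  apply: cvgB; last exact: cvg_atan_affine.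
  by apply: cvgMr; exact: cvg_atan_affine.
rewrite (ge0_continuous_FTC2y _ _ cF)//.
- by rewrite /smooth_tail -EFinB /F !subr0 divr1; congr EFin; lra.
- by move=> u _; rewrite divr_ge0// mulr_ge0// addr_ge0// sqr_ge0.
- apply: continuous_subspaceT => u.
  apply: (@continuousM R R (fun=> 6) (fun u : R => ((1 + u ^+ 2) * (4 + u ^+ 2))^-1)); first exact: cst_continuous.
  apply: (@continuousV R R (fun u : R => (1 + u ^+ 2) * (4 + u ^+ 2))).
    by rewrite mulf_neq0.
  by apply: continuousM; apply: continuousD; try exact: cst_continuous; exact: exprn_continuous.
- apply: cvg_at_right_filter; apply/differentiable_continuous/derivable1_diffP.
  by have [] := D y.
- by move=> u _; rewrite derive1E; apply: derive_val; exact: D.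
Qed.

Lemma smooth_tail_ge0 y : 0 <= smooth_tail y.
Proof.
rewrite -lee_fin smooth_tailE; apply: integral_ge0 => u _.
by rewrite lee_fin divr_ge0// mulr_ge0// addr_ge0// sqr_ge0.
Qed.

(** The majorant is a multiple of the Poisson kernel, so that integrating it against [mu] gives back
    [density]. For [y <= 1] the tail is at most [pi / 2 <= 2]; for [y >= 1] the kernel is compared
    with the derivative of [- 3 / (1 + u^2)]. *)
Lemma smooth_tail_le y : 0 <= y -> smooth_tail y <= 4 / (1 + y ^+ 2).
Proof.
move=> y0; have [y1|/ltW y1] := leP y 1.
  have h1 : smooth_tail y <= 2.
    have h2 : atan (y / 2) <= atan y by apply: le_atan; lra.
    have h3 : 0 <= atan y by rewrite -atan0; exact: le_atan.
    by rewrite /smooth_tail; have := @pi_le4 R; lra.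
  rewrite (le_trans h1)// ler_pdivlMr ?ltr_pwDl ?sqr_ge0//.
  by move: y0 y1; nra.
rewrite (@le_trans _ _ (3 / (1 + y ^+ 2)))//; last first.
  by rewrite ler_pM2r ?invr_gt0 ?ltr_pwDl ?sqr_ge0//; lra.
have p1 (u : R) : 1 + u ^+ 2 != 0 by rewrite gt_eqF// ltr_pwDl ?sqr_ge0.
pose F (u : R) := - 3 * (1 + u ^+ 2)^-1.
pose f (u : R) := 6 * u / (1 + u ^+ 2) ^+ 2.
have D (u : R) : is_derive u 1 F (f u).
  have d0 : is_derive u 1 (fun u : R => u * u) (u *: (1 : R) + u *: (1 : R)).
    exact: (is_deriveM (is_derive_id u 1) (is_derive_id u 1)).
  have d1 : is_derive u 1 (fun u : R => 1 + u ^+ 2) (0 + (u *: (1 : R) + u *: (1 : R))).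
    exact: (is_deriveD (is_derive_cst (1 : R) u 1) d0).
  have d2 := @is_deriveV _ (fun u : R => 1 + u ^+ 2) u _ 1 (p1 u) d1.
  have d3 := @is_deriveZ _ _ _ (fun u : R => (1 + u ^+ 2)^-1) (- 3) u 1 _ d2.
  apply: is_derive_eq d3 _; rewrite /GRing.scale/= /f.
  by field; rewrite ?p1.
have cF : F u @[u --> +oo] --> (0 : R).
  rewrite -(mulr0 (- 3)); apply: cvgMr; apply/gtr0_cvgV0.
    by near=> u; rewrite ltr_pwDl ?sqr_ge0.
  apply/cvgryPge => A; near=> u.
  have u1 : 1 <= u by near: u; apply: nbhs_pinfty_ge; exact: num_real.
  have uA : A <= u by near: u; apply: nbhs_pinfty_ge; exact: num_real.
  by nra.
have E : (\int[leb]_(u in `[y, +oo[) (f u)%:E = (3 / (1 + y ^+ 2))%:E)%E.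
  rewrite (ge0_continuous_FTC2y _ _ cF)//.
  - by rewrite sub0e -EFinN /F mulNr opprK.
  - move=> u yu; rewrite divr_ge0 ?sqr_ge0// mulr_ge0//.
    by rewrite (le_trans y0).
  - apply: continuous_subspaceT => u.
    apply: (@continuousM R R (fun u : R => 6 * u) (fun u : R => ((1 + u ^+ 2) ^+ 2)^-1)).
      by apply: continuousM; [exact: cst_continuous|exact: cvg_id].
    apply: (@continuousV R R (fun u : R => (1 + u ^+ 2) ^+ 2)).
      by rewrite expf_neq0.
    apply: (@continuous_comp _ _ _ (fun u => 1 + u ^+ 2) (fun x => x ^+ 2)).
      by apply: continuousD; [exact: cst_continuous|exact: exprn_continuous].
    exact: exprn_continuous.
    - apply: cvg_at_right_filter; apply/differentiable_continuous/derivable1_diffP.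
    by have [] := D y.
  - by move=> u _; rewrite derive1E; apply: derive_val; exact: D.
rewrite -lee_fin -E smooth_tailE; apply: ge0_le_integral => //.
- by move=> u _; rewrite lee_fin divr_ge0// mulr_ge0// addr_ge0// sqr_ge0.
- apply: measurable_funTS; apply/measurable_EFinP; apply: continuous_measurable_fun => u.
  apply: (@continuousM R R (fun=> 6) (fun u : R => ((1 + u ^+ 2) * (4 + u ^+ 2))^-1)); first exact: cst_continuous.
  apply: (@continuousV R R (fun u : R => (1 + u ^+ 2) * (4 + u ^+ 2))).
    by rewrite mulf_neq0// gt_eqF// ltr_pwDl ?sqr_ge0.
  by apply: continuousM; apply: continuousD; try exact: cst_continuous; exact: exprn_continuous.
- apply: measurable_funTS; apply/measurable_EFinP; apply: continuous_measurable_fun => u.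
  apply: (@continuousM R R (fun u : R => 6 * u) (fun u : R => ((1 + u ^+ 2) ^+ 2)^-1)).
    by apply: continuousM; [exact: cst_continuous|exact: cvg_id].
  apply: (@continuousV R R (fun u : R => (1 + u ^+ 2) ^+ 2)).
    by rewrite expf_neq0.
  apply: (@continuous_comp _ _ _ (fun u => 1 + u ^+ 2) (fun x => x ^+ 2)).
    by apply: continuousD; [exact: cst_continuous|exact: exprn_continuous].
  exact: exprn_continuous.
move=> u; rewrite /= in_itv/= andbT => yu; rewrite lee_fin /f.
have u1 : 1 <= u by rewrite (le_trans y1).
rewrite expr2 -mulrA ler_pM2l// ler_pdivlMr ?mulr_gt0 ?ltr_pwDl ?sqr_ge0//.
have -> : ((1 + u ^+ 2) * (4 + u ^+ 2))^-1 * ((1 + u ^+ 2) * (1 + u ^+ 2)) =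
    (1 + u ^+ 2) / (4 + u ^+ 2).
  by field; rewrite p1 gt_eqF// ltr_pwDl ?sqr_ge0.
by rewrite ler_pdivrMr ?ltr_pwDl ?sqr_ge0//; nra.
Unshelve. all: by end_near. Qed.

End poisson_kernel.

Section smoothed_distribution.
Context (R : realType).
Notation MR := (measurableTypeR R).
Notation leb := (@lebesgue_measure R).
Variable mu : probability MR R.
Implicit Types (v u t x : R).

Definition density v u : R := - Im (cauchy_transform mu (u +i* v)).

Lemma poisson_res v u t : 0 < v -> poisson v (u - t) = v * nc (res (u +i* v) t) ^+ 2.
Proof. by move=> v0; rewrite /res ncV_sq nc_sq !ReImE /= subr0. Qed.

Lemma densityE v u : 0 < v -> density v u = \int[mu]_t poisson v (u - t).
Proof.
move=> v0; rewrite /density cauchy_Im//= opprK -RintegralZl//; last exact: (@rint_res2 _ mu (u +i* v) v0).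
by apply: eq_Rintegral => t _; rewrite poisson_res.
Qed.

Lemma rint_poisson v u : 0 < v -> rint mu (fun t => poisson v (u - t)).
Proof.
move=> v0; have -> : (fun t => poisson v (u - t)) = (fun t => v * nc (res (u +i* v) t) ^+ 2).
  by apply/funext => t; rewrite poisson_res.
exact/rintZ/(@rint_res2 _ mu (u +i* v) v0).
Qed.

Lemma EFin_Rintegral (f : R -> R) : rint mu f ->
  ((\int[mu]_t f t)%:E = \int[mu]_t (f t)%:E)%E.
Proof. by move=> fi; rewrite /Rintegral fineK//; exact: integrable_fin_num. Qed.

Lemma density_ge0 v u : 0 < v -> 0 <= density v u.
Proof. by move=> v0; rewrite densityE// Rintegral_ge0// => t _; exact: poisson_ge0. Qed.

Lemma measurable_poisson2 v : 0 < v ->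
  measurable_fun setT (fun p : MR * MR => (poisson v (p.1 - p.2))%:E).
Proof.
move=> v0; apply/measurable_EFinP.
apply: (@measurableT_comp _ _ _ _ _ _ (poisson v : MR -> MR) _ (fun p : MR * MR => p.1 - p.2 : MR)).
  apply: continuous_measurable_fun.
  by have := @continuous_poisson R v 0 v0; under eq_fun do rewrite subr0.
exact: measurable_funB.
Qed.

Lemma measurable_density v : 0 < v -> measurable_fun setT (density v : MR -> R).
Proof.
move=> v0; apply/measurable_EFinP.
have := @measurable_fun_fubini_tonelli_F _ _ MR MR R mu _ (measurable_poisson2 v0).
have p0 : forall p : MR * MR, (0 <= (poisson v (p.1 - p.2))%:E)%E.
  by move=> p; rewrite lee_fin poisson_ge0.
move=> /(_ p0); congr measurable_fun; apply/funext => u.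
by rewrite /fubini_F /= densityE// EFin_Rintegral//; exact: rint_poisson.
Qed.

Definition smoothed_tail v x : R := \int[mu]_t (pi / 2 - atan ((x - t) / v)).

Lemma rint_atan v x : 0 < v -> rint mu (fun t => pi / 2 - atan ((x - t) / v)).
Proof.
move=> v0; apply: (@rint_le _ _ _ (fun=> pi)); last exact: rint_cst.
  apply: continuous_measurable_fun => t.
  apply: (@continuousB _ _ _ (fun=> pi / 2)); first exact: cst_continuous.
  apply: (@continuous_comp _ _ _ (fun t => (x - t) / v) (@atan R)).
    apply: (@continuousM R R (fun t : R => x - t) (fun=> v^-1)); last exact: cst_continuous.
    by apply: continuousB; [exact: cst_continuous|exact: cvg_id].
  exact: continuous_atan.
move=> t; have := atan_gtNpi2 ((x - t) / v); have := atan_ltpi2 ((x - t) / v).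
by rewrite ler_norml => h1 h2; apply/andP; split; lra.
Qed.

Lemma integral_density_tail v x : 0 < v ->
  (\int[leb]_(u in `[x, +oo[) (density v u)%:E = (smoothed_tail v x)%:E)%E.
Proof.
move=> v0; pose D : set MR := `[x, +oo[%classic.
have mD : measurable D by exact: measurable_itv.
pose f (p : MR * MR) : \bar R := (\1_D p.1 * poisson v (p.1 - p.2))%:E.
have mf : measurable_fun setT f.
  rewrite /f; under eq_fun do rewrite EFinM.
  apply: emeasurable_funM; last exact: measurable_poisson2.
  by apply/measurable_EFinP; apply: measurableT_comp => //; exact: measurable_indic.
have f0 p : (0 <= f p)%E by rewrite lee_fin mulr_ge0 ?poisson_ge0// indicE.
have := @fubini_tonelli _ _ MR MR R leb mu f mf f0.
have -> : (\int[leb]_u \int[mu]_t f (u, t) = \int[leb]_(u in D) (density v u)%:E)%E.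
  rewrite [RHS]integral_mkcond; apply: eq_integral => u _; rewrite /f /= patchE.
  have [uD|uD] := boolP (u \in D).
    rewrite indicE uD densityE// EFin_Rintegral; last exact: rint_poisson.
    by apply: eq_integral => t _; rewrite mul1r.
  by rewrite indicE (negbTE uD); under eq_integral do rewrite mul0r; rewrite integral0.
move=> ->; rewrite EFin_Rintegral; last exact: rint_atan.
apply: eq_integral => t _; rewrite -integral_poisson_tail// [RHS]integral_mkcond.
apply: eq_integral => u _; rewrite /f /= patchE indicE -/D.
by case: (u \in D); rewrite ?mul1r ?mul0r.
Qed.

(** With [y = (x - t) / v], the integrand is [smooth_tail y], minus [pi] when [y < 0]. By
    [smooth_tailN] its modulus is [smooth_tail |y|], at most [4 v] times the Poisson kernel, whose
    integral is the density at [x]. *)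
Lemma smoothing_error v x : 0 < v -> density v x <= 1 ->
  `|2 * smoothed_tail v x - smoothed_tail (2 * v) x -
    pi * fine (mu `]x, +oo[%classic)| <= 4 * v.
Proof.
move=> v0 d1; have v20 : 0 < 2 * v by rewrite mulr_gt0.
pose A : set MR := `]x, +oo[%classic.
have mA : measurable A by exact: measurable_itv.
have i1 := rintZ 2 (rint_atan x v0).
have i2 := rintZ (-1) (rint_atan x v20).
have i3 := rintZ (- pi) (rint_indic mu mA).
have -> : 2 * smoothed_tail v x - smoothed_tail (2 * v) x -
    pi * fine (mu `]x, +oo[%classic) =
    \int[mu]_t (2 * (pi / 2 - atan ((x - t) / v)) +
      -1 * (pi / 2 - atan ((x - t) / (2 * v))) + - pi * \1_A t).
  rewrite RintegralD//; last exact: rintD.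
  rewrite RintegralD// !RintegralZl//; [|exact: rint_indic|exact: rint_atan..].
  by rewrite Rintegral_indic// mulN1r mulNr.
apply: (le_trans (le_normr_Rintegral measurableT (rintD (rintD i1 i2) i3))).
apply: (@le_trans _ _ (\int[mu]_t (4 * v * poisson v (x - t)))); last first.
  rewrite RintegralZl//; last exact: rint_poisson.
  by rewrite -densityE// ler_piMr// mulr_ge0// ltW.
apply: le_Rintegral => //.
- by have := integrable_norm (rintD (rintD i1 i2) i3).
- exact/rintZ/rint_poisson.
move=> t _.
pose y := (x - t) / v.
have E1 : 4 * v * poisson v (x - t) = 4 / (1 + y ^+ 2).
  have h : (x - t) ^+ 2 + v ^+ 2 != 0 by rewrite gt_eqF// ltr_wpDl ?sqr_ge0 ?exprn_gt0.
  have h' : v ^+ 2 + (x - t) ^+ 2 != 0 by rewrite addrC.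
  by rewrite /poisson /y; field; rewrite ?h ?h' gt_eqF.
have E2 : 2 * (pi / 2 - atan ((x - t) / v)) + -1 * (pi / 2 - atan ((x - t) / (2 * v))) =
    smooth_tail y.
  have -> : (x - t) / (2 * v) = y / 2 by rewrite /y; field; rewrite gt_eqF.
  by rewrite /smooth_tail -/y; lra.
rewrite E1 E2 indicE; have [xt|tx] := ltP x t.
  have tA : t \in A by rewrite mem_set// /A /= in_itv/= andbT.
  rewrite tA.
  rewrite mulr1 -normrN opprD opprK addrC -smooth_tailN ger0_norm ?smooth_tail_ge0//.
  rewrite -(sqrrN y) smooth_tail_le// oppr_ge0 /y pmulr_lle0 ?invr_gt0//.
  by rewrite subr_le0 ltW.
have tA : (t \in A) = false.
  by apply/negbTE; rewrite notin_setE /A /= in_itv/= andbT; apply/negP; rewrite -leNgt.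
rewrite tA.
rewrite mulr0 addr0 ger0_norm ?smooth_tail_ge0// smooth_tail_le// /y divr_ge0 ?subr_ge0//.
exact: ltW.
Qed.

End smoothed_distribution.

Section semicircle_tail.
Context (R : realType).
Notation MR := (measurableTypeR R).
Notation leb := (@lebesgue_measure R).

(** [pi] times the semicircle density; [Num.sqrt] is [0] on negative numbers, which plays the part
    of the indicator. *)
Definition semidensity (u : R) : R := Num.sqrt (4 - u ^+ 2) / 2.

Lemma semicircle_pdfE (u : R) : semicircle_pdf u = pi^-1 * semidensity u.
Proof.
rewrite /semicircle_pdf /semidensity indicE.
have [_|uI] := boolP (u \in _).
  by rewrite mulr1 invfM; ring.
rewrite mulr0; suff -> : Num.sqrt (4 - u ^+ 2) = 0 by rewrite mul0r mulr0.
apply: ler0_sqrtr; rewrite leNgt; apply/negP => h.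
move: uI; rewrite notin_setE/= in_itv/=; apply.
by apply/andP; split; move: h; nra.
Qed.

Lemma measurable_semidensity : measurable_fun setT (semidensity : MR -> R).
Proof.
by apply: measurable_funM => //; exact: measurable_sqrt_semicircle.
Qed.

Lemma semidensity_ge0 u : 0 <= semidensity u.
Proof. by rewrite divr_ge0// sqrtr_ge0. Qed.

Lemma semicircle_tailE (x : R) :
  (\int[leb]_(u in `[x, +oo[) (semidensity u)%:E =
   (pi * fine (semicircle_prob R `]x, +oo[%classic))%:E)%E.
Proof.
have pi0 := @pi_gt0 R.
have S1 : (semicircle_prob R `]x, +oo[%classic =
    pi^-1%:E * \int[leb]_(u in `[x, +oo[) (semidensity u)%:E)%E.
  rewrite /semicircle_prob integral_itv_obnd_cbnd; last first.
    by apply: measurable_funTS; apply/measurable_EFinP; exact: measurable_semicircle_pdf.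
  under eq_integral do rewrite semicircle_pdfE EFinM.
  rewrite ge0_integralZl//.
  - by apply: measurable_funTS; apply/measurable_EFinP; exact: measurable_semidensity.
  - by move=> u _; rewrite lee_fin semidensity_ge0.
  - by rewrite lee_fin invr_ge0 ltW.
have fin := @fin_num_measure _ _ _ (semicircle_prob R) `]x, +oo[%classic (measurable_itv _).
rewrite EFinM fineK// S1 muleA -EFinM mulfV ?mul1e// gt_eqF//.
Qed.

End semicircle_tail.

(** * Comparison of the tails and the Kolmogorov distance *)

Section kolmogorov_bound.
Context (R : realType).
Notation MR := (measurableTypeR R).
Notation leb := (@lebesgue_measure R).
Variable mu : probability MR R.
Hypothesis i4 : rint mu (pw 4).
Hypothesis mean0 : moment mu 1 = 0.
Hypothesis var1 : moment mu 2 = 1.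
Hypothesis infdiv : free_infinitely_divisible mu.
Variable e : R.
Hypothesis e0 : 0 < e.
Hypothesis e1 : e <= 1 / 2.
Hypothesis m4e : moment mu 4 - 2 <= e ^+ 2.

Let zF (u v : R) (v0 : 0 < v) := @reciprocal_cauchy_dist_le1 _ mu i4 mean0 var1 infdiv (u +i* v) v0.
Let zFG (u v : R) (v0 : 0 < v) :=
  @semicircle_equation_defect _ mu i4 mean0 var1 infdiv (u +i* v) v0 e e0 m4e.
Let Gneg (u v : R) (v0 : 0 < v) := @cauchy_Im_lt0 _ mu (u +i* v) v0.

Lemma density_le1 u : density mu (3 * e) u <= 1.
Proof.
have v0 : 0 < 3 * e by rewrite mulr_gt0.
have := @perturbed_nc_le1 _ (u +i* (3 * e)) _ _ e0 e1 (lexx (3 * e)) (Gneg u v0) (zF u v0) (zFG u v0).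
by apply: le_trans; rewrite -[leRHS]ncN (le_trans _ (Im_le_nc _))// ImN ler_norm.
Qed.

(** The range of [v] covers [3 e] and its double, the two heights in [2 P_v - P_2v]. *)
Lemma smoothed_tail_close v x : 3 * e <= v -> v <= 6 * e ->
  `|smoothed_tail mu v x - pi * fine (semicircle_prob R `]x, +oo[%classic)| <= 508 * e.
Proof.
move=> v3 v6; have v0 : 0 < v by rewrite (lt_le_trans _ v3)// mulr_gt0.
pose E u := `|density mu v u - semidensity u|.
have md := measurable_density mu v0.
have ms := @measurable_semidensity R.
have mE : measurable_fun setT (E : MR -> R).
  by apply: measurableT_comp => //; exact: measurable_funB.
have L1 : (\int[leb]_u (E u)%:E <= (508 * e)%:E)%E.
  apply: L1_bound => //.
  - by move=> u; exact: normr_ge0.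
  - move=> u u0.
    have [X [h1 [h2 _]]] := @perturbation_center _ (u +i* v) _ _ e0 e1 v3 v6 (Gneg u v0) (zF u v0) (zFG u v0).
    exact: le_trans h1 (h2 u0).
  - move=> u u0.
    have [X [h1 [_ h2]]] := @perturbation_center _ (u +i* v) _ _ e0 e1 v3 v6 (Gneg u v0) (zF u v0) (zFG u v0).
    exact: le_trans h1 (h2 u0).
  - move=> u u3.
    exact: (@perturbation_tail _ (u +i* v) _ _ e0 e1 v3 v6 (Gneg u v0) (zF u v0) (zFG u v0)).
have mD : measurable (`[x, +oo[%classic : set MR) by exact: measurable_itv.
have mEE : measurable_fun setT (fun u : MR => (E u)%:E) by exact/measurable_EFinP.
have LD : (\int[leb]_(u in `[x, +oo[) (E u)%:E <= (508 * e)%:E)%E.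
  apply: le_trans L1; apply: ge0_subset_integral => // u _.
  by rewrite lee_fin normr_ge0.
have gen (f g : R -> R) (a b : R) : measurable_fun setT (f : MR -> R) ->
    measurable_fun setT (g : MR -> R) -> (forall u, 0 <= f u) -> (forall u, 0 <= g u) ->
    (forall u, f u <= g u + E u) ->
    (\int[leb]_(u in `[x, +oo[) (f u)%:E = a%:E)%E ->
    (\int[leb]_(u in `[x, +oo[) (g u)%:E = b%:E)%E -> a <= b + 508 * e.
  move=> mf mg f0 g0 fg fa gb; rewrite -lee_fin EFinD -fa -gb.
  apply: le_trans (leeD (lexx _) LD).
  rewrite -ge0_integralD//.
  - apply: ge0_le_integral => //.
    + by move=> u _; rewrite lee_fin.
    + by apply: measurable_funTS; exact/measurable_EFinP.
    + apply: measurable_funTS; apply: emeasurable_funD => //.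
      exact/measurable_EFinP.
    + by move=> u _; rewrite -EFinD lee_fin.
  - by move=> u _; rewrite lee_fin.
  - by apply: measurable_funTS; exact/measurable_EFinP.
  - by move=> u _; rewrite lee_fin normr_ge0.
  - exact: measurable_funTS.
have I1 := integral_density_tail mu x v0.
have I2 := semicircle_tailE x.
have d0 u := density_ge0 mu u v0.
have s0 := @semidensity_ge0 R.
have g1 := gen _ _ _ _ md ms d0 s0 _ I1 I2.
have g2 := gen _ _ _ _ ms md s0 d0 _ I2 I1.
have {}g1 : smoothed_tail mu v x <= pi * fine (semicircle_prob R `]x, +oo[%classic) + 508 * e.
  by apply: g1 => u; rewrite -lerBlDl ler_norm.
have {}g2 : pi * fine (semicircle_prob R `]x, +oo[%classic) <= smoothed_tail mu v x + 508 * e.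
  by apply: g2 => u; rewrite -lerBlDl /E distrC ler_norm.
by rewrite ler_norml; apply/andP; split; move: g1 g2; lra.
Qed.

(** The two smoothed tails contribute [(2 + 1) * 508 e] and the smoothing [4 * 3 e], hence [1536 e]
    for [pi] times the distance; then [pi >= 2]. *)
Lemma tail_distance x :
  `|fine (semicircle_prob R `]x, +oo[%classic) - fine (mu `]x, +oo[%classic)| <= 768 * e.
Proof.
have v0 : 0 < 3 * e by rewrite mulr_gt0.
have h1 := @smoothed_tail_close (3 * e) x (lexx _) _.
have {}h1 : `|smoothed_tail mu (3 * e) x - pi * fine (semicircle_prob R `]x, +oo[%classic)| <= 508 * e.
  by apply: h1; rewrite ler_pM2r//; lra.
have h2 : `|smoothed_tail mu (2 * (3 * e)) x - pi * fine (semicircle_prob R `]x, +oo[%classic)| <= 508 * e.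
  by apply: smoothed_tail_close; move: e0; lra.
have h3 := smoothing_error v0 (density_le1 x).
set S := fine (semicircle_prob R _) in h1 h2 *; set M := fine (mu _) in h3 *.
have : pi * `|S - M| <= 1536 * e.
  rewrite -[X in X * _](ger0_norm (pi_ge0 R)) -normrM mulrBr.
  move: h1 h2 h3; rewrite !ler_norml => /andP[a1 a2] /andP[b1 b2] /andP[c1 c2].
  by apply/andP; split; lra.
have : 2 * `|S - M| <= pi * `|S - M| by rewrite ler_wpM2r// pi_ge2.
by move=> /le_trans H /H; lra.
Qed.

End kolmogorov_bound.

Section distribution_functions.
Context (R : realType).
Notation MR := (measurableTypeR R).

Lemma distribution_tail (P : probability MR R) (x : R) :
  fine (P `]-oo, x]%classic) = 1 - fine (P `]x, +oo[%classic).
Proof.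
have E : (`]-oo, x]%classic : set MR) = ~` `]x, +oo[%classic by rewrite setCitvr.
rewrite E probability_setC; last exact: measurable_itv.
by rewrite fineB// fin_num_measure//; exact: measurable_itv.
Qed.

Lemma kolmogorov_dist_le (P Q : probability MR R) (r : R) :
  (forall x, `|fine (P `]x, +oo[%classic) - fine (Q `]x, +oo[%classic)| <= r) ->
  (kolmogorov_dist P Q <= r%:E)%E.
Proof.
move=> H; apply: ge_ereal_sup => _ [x _ <-].
have fP := @fin_num_measure _ _ _ P `]-oo, x]%classic (measurable_itv _).
have fQ := @fin_num_measure _ _ _ Q `]-oo, x]%classic (measurable_itv _).
rewrite -(fineK fP) -(fineK fQ) -EFinB lee_fin !distribution_tail.
apply: le_trans (H x); rewrite -normrN le_eqVlt; apply/orP; left; apply/eqP.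
by congr `|_|; ring.
Qed.

End distribution_functions.

Local Open Scope ereal_scope.

Theorem theorem1p6 (R : realType) :
  exists K : R, (0 < K)%R /\
    forall mu : probability (measurableTypeR R) R,
      'E_mu[fun x => (x : R)] = 0 ->
      'V_mu[fun x => (x : R)] = 1 ->
      free_infinitely_divisible mu ->
      kolmogorov_dist (semicircle_prob R) mu <=
        K%:E * sqrte ('E_mu[fun x => ((x : R) ^+ 4)%R] - 2%:E).
Proof.
have K0 : (0 < 768 :> R)%R by rewrite ltr0n.
exists 768%R; split=> [|mu Em Vm infdiv]; first exact: K0.
have mpw j : measurable_fun setT (pw j : measurableTypeR R -> R) by exact: measurable_pw.
have pw4_ge0 (t : R) : (0 <= pw 4 t)%R by rewrite /pw exprn_even_ge0.
have E4 : 'E_mu[fun x => ((x : R) ^+ 4)%R] = \int[mu]_t (pw 4 t)%:E by rewrite unlock.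
have [m4fin|m4inf] := boolP ('E_mu[fun x => ((x : R) ^+ 4)%R] == +oo).
  rewrite (eqP m4fin); have -> : sqrte (+oo - 2%:E) = +oo :> \bar R by [].
  by rewrite gt0_muley ?lte_fin ?leey//; exact: K0.
have i4 : rint mu (pw 4).
  apply/integrableP; split; first exact/measurable_EFinP.
  rewrite (eq_integral (fun t : measurableTypeR R => (pw 4 t)%:E)) => [|t _]; last first.
    by rewrite /= ger0_norm.
  by rewrite -E4 ltey.
have i2 : rint mu (pw 2) by exact: rint_pwW i4.
have i1 : rint mu (pw 1) by exact: rint_pwW i4.
have mean0 : moment mu 1 = 0%R.
  by move: Em; rewrite unlock /moment /Rintegral /pw => ->.
have var1 : moment mu 2 = 1%R.
  move: Vm; rewrite /variance unlock Em unlock => V1.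
  apply: EFin_inj; rewrite /moment EFin_Rintegral// -V1.
  apply: eq_integral => t _; congr EFin.
  by rewrite -[RHS]/((t - 0) * (t - 0))%R subr0.
have m4E : 'E_mu[fun x => ((x : R) ^+ 4)%R] = (moment mu 4)%:E.
  by rewrite E4 /moment EFin_Rintegral.
rewrite m4E -EFinB /= -EFinM; set k := (_ - 2)%R.
(* The estimates need [e > 0] and [k <= e^2], while [k] may be [0]; the slack [d] makes [e] positive
   and costs exactly [d] after multiplication by [768]. A negative [k] is covered too, [Num.sqrt k]
   being [0]. *)
apply/lee_addgt0Pr => d d0; rewrite -EFinD.
pose e := (Num.sqrt k + d / 768)%R.
have e0 : (0 < e)%R.
  by apply: ltr_wpDl; [exact: sqrtr_ge0|exact: (divr_gt0 d0 K0)].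
have ke : (k <= e ^+ 2)%R.
  have [k0|k0] := leP 0%R k; last by rewrite (le_trans (ltW k0))// sqr_ge0.
  rewrite -{1}(sqr_sqrtr k0) lerXn2r ?nnegrE ?sqrtr_ge0 ?(ltW e0)//.
  by rewrite lerDl divr_ge0 ?(ltW d0) ?(ltW K0).
have -> : (768 * Num.sqrt k + d = 768 * e)%R by rewrite /e; lra.
apply: kolmogorov_dist_le => x.
(* For [e > 1 / 2] the bound [768 e] exceeds [1], the largest possible difference of two
   probabilities. *)
have [e1|e1] := leP e (1 / 2)%R; first exact: (tail_distance i4 mean0 var1 infdiv e0 e1 ke).
have bnd (P : probability (measurableTypeR R) R) :
    (0 <= fine (P `]x, +oo[%classic) <= 1)%R.
  have mA : measurable (`]x, +oo[%classic : set (measurableTypeR R)) by exact: measurable_itv.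
  rewrite fine_ge0//= -lee_fin fineK; last exact: fin_num_measure.
  exact: probability_le1.
have /andP[s0 s1] := bnd (semicircle_prob R); have /andP[m0 m1] := bnd mu.
by rewrite ler_norml; apply/andP; split; move: s0 s1 m0 m1 e1; lra.
Qed.
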